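(* Let $A$ be a unitary graded associative algebra over $\mathbb{K}$. For every $n\ge 0$, every homogeneous $x,a_1,\ldots,a_n\in A$ and every homogeneous $f\in\mathrm{Hom}^*_{\mathbb{K}}(A,A)$, the Koszul brackets satisfy \[ \Psi_{x}^{n}(a_{1},\ldots, a_{n}) =\sum_{\substack{i,j\ge 0\\ i+j=n}}\frac{B_{i,j}}{i!\,j!} \sum_{\pi\in \Sigma_{n}} \epsilon(\pi,i,x)\, a_{\pi(1)}\cdots a_{\pi(i)}\,x\, a_{\pi(i+1)}\cdots a_{\pi(n)}, \] \[ \Psi_{f}^{n}(a_{1},\ldots, a_{n}) =\sum_{\substack{i,j,k\ge 0\\ i+j+k=n}}\frac{B_{i,j}}{i!\,j!\,k!} \sum_{\pi\in \Sigma_{n}} \epsilon(\pi,i,f)\, a_{\pi(1)}\cdots a_{\pi(i)}\cdot f(1\cdot a_{\pi(i+1)}\cdots a_{\pi(i+k)})\cdot a_{\pi(i+k+1)}\cdots a_{\pi(n)}, \] where $\epsilon(\pi,i,x)=\epsilon(\pi)\cdot(-1)^{|x|(|a_{\pi(1)}|+\cdots+|a_{\pi(i)}|)}$ and $\epsilon(\pi,i,f)=\epsilon(\pi)\cdot(-1)^{|f|(|a_{\pi(1)}|+\cdots+|a_{\pi(i)}|)}$.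
   Context: $\mathbb{K}$ is a fixed field of characteristic $0$; all graded vector spaces and graded algebras are $\mathbb{Z}$-graded over $\mathbb{K}$, and $|v|$ denotes the degree of a homogeneous element $v$. $\Sigma_n$ is the symmetric group and $\epsilon(\pi)$ is the Koszul sign of $\pi$ with respect to $a_1,\ldots,a_n$. In $f(1\cdot a_{\pi(i+1)}\cdots a_{\pi(i+k)})$ the $1$ is the unit of $A$, so for $k=0$ this is $f(1)$. Numbers: the Bernoulli numbers $B_n$ are defined by $\sum_{n\ge 0}B_n\frac{x^n}{n!}=\frac{x}{e^x-1}$ (so $B_1=-\frac12$), and $B_{i,j}=(-1)^j\sum_{k=0}^j\binom{j}{k}B_{i+k}$ for $i,j\ge 0$. The Lie algebra $D(V)$: $V^{\odot n}$ is the $n$th (graded) symmetric power of $V$; a linear map $f\colon V^{\odot n}\to W$ is identified with the graded symmetric multilinear operator $f(v_1,\ldots,v_n)=f(v_1\odot\cdots\odot v_n)$. $\mathrm{End}^*(V)=\mathrm{Hom}^*_{\mathbb{K}}(V,V)=\bigoplus_{n\in\mathbb{Z}}\mathrm{Hom}^n_{\mathbb{K}}(V,V)$. Put $D(V)=\prod_{n\ge -1}D_n(V)$, with $D_{-1}(V)=V$ and $D_n(V)=\mathrm{Hom}^*_{\mathbb{K}}(V^{\odot n+1},V)$ for $n\ge 0$. $D(V)$ is a graded Lie algebra under the Nijenhuis-Richardson bracket $[f,g]=f\barwedge g-(-1)^{|f||g|}g\barwedge f$, where for $f\in D_n(V)$, $g\in D_m(V)$ the product $f\barwedge g\in D_{n+m}(V)$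 is: $f\barwedge g=0$ if $f\in D_{-1}(V)=V$; $f\barwedge g(v_1,\ldots,v_n)=f(g,v_1,\ldots,v_n)$ if $n\ge 0$ and $g\in V$; and for $n,m\ge 0$ \[ f\barwedge g(v_0,\ldots,v_{n+m})=\sum_{\sigma\in S(m+1,n)}\epsilon(\sigma)f(g(v_{\sigma(0)},\ldots,v_{\sigma(m)}),v_{\sigma(m+1)},\ldots,v_{\sigma(m+n)}),\] where $S(m+1,n)$ is the set of permutations $\sigma$ of $0,\ldots,n+m$ with $\sigma(0)<\cdots<\sigma(m)$ and $\sigma(m+1)<\cdots<\sigma(m+n)$, and $\epsilon(\sigma)$ is the Koszul sign. $\mathrm{Aff}^*(V)$ denotes the graded Lie subalgebra $D_{-1}(V)\times D_0(V)=V\times\mathrm{End}^*(V)$ of $D(V)$. The Koszul brackets: $\Psi$ is the unique assignment to every unitary graded associative algebra $A$ of a degree-preserving linear map $\Psi\colon\mathrm{Aff}^*(A)\to D(A)$, $u\mapsto\Psi_u=\sum_{n\ge 0}\Psi^n_u$, $\Psi^n_u\in D_{n-1}(A)$, such that (it is known that such an assignment exists and is unique): (1) $\Psi$ is a morphism of graded Lie algebras; (2) for every morphism $\alpha\colon A\to B$ of unitary graded algebras, $x\in A$, $f\in\mathrm{End}^*(A)$, $g\in\mathrm{End}^*(B)$ with $g\alpha=\alpha f$, one has $\alpha\Psi^n_x=\Psi^n_{\alpha(x)}\alpha^{\odot n}$ and $\alpha\Psi^n_f=\Psi^n_g\alpha^{\odot n}$; (3) if $c\in A$ is homogeneous with $ac=(-1)^{|a||c|}ca$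 for all homogeneous $a\in A$, then $\Psi^n_1(a_1,\ldots,a_nc)=\Psi^n_1(a_1,\ldots,a_n)c$ and $\Psi^n_{Id}(a_1,\ldots,a_nc)=\Psi^n_{Id}(a_1,\ldots,a_n)c$; (4) $\Psi^0_x=x$ and $\Psi^0_f=f(1)$ for $x\in A$, $f\in\mathrm{End}^*(A)$; (5) for $A=\mathbb{K}$, $\Psi^n_{Id}=0$ for every $n>0$. *)

(* Defs.v *)
From HB Require Import structures.
From mathcomp Require Import all_boot all_order all_fingroup all_algebra.

Set Implicit Arguments.
Unset Strict Implicit.
Unset Printing Implicit Defensive.

Import GRing.Theory.
Local Open Scope ring_scope.

(* Z-graded vector spaces and algebras.  A decomposition of V as the direct sum
   of subspaces V_i is given by its projections gproj i : V -> V_i; the last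
   axiom says that every vector is the sum of finitely many of its components. *)

HB.mixin Record Lmodule_isGraded (K : fieldType) V of GRing.Lmodule K V := {
  gproj : int -> V -> V;
  gproj_linear : forall i, linear (gproj i);
  gprojK : forall i j v, gproj i (gproj j v) = if i == j then gproj j v else 0;
  gproj_sum : forall v, exists s : seq int,
    uniq s && (v == \sum_(i <- s) gproj i v)
}.

#[short(type="gradedLmodType")]
HB.structure Definition GradedLmod (K : fieldType) :=
  {V of GRing.Lmodule K V & Lmodule_isGraded K V}.

Definition homog (K : fieldType) (V : gradedLmodType K) (i : int) : {pred V} :=
  [pred v | gproj i v == v].
Arguments homog {K V} i.

HB.mixin Record Algebra_isGraded (K : fieldType) A
    of GRing.Algebra K A & GradedLmod K A := {
  homog1 : (1 : A) \in homog (0 : int);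
  homogM : forall (i j : int) (x y : A),
    x \in homog i -> y \in homog j -> x * y \in homog (i + j)
}.

#[short(type="gradedAlgType")]
HB.structure Definition GradedAlg (K : fieldType) :=
  {A of GRing.Algebra K A & GradedLmod K A & Algebra_isGraded K A}.

(* The ground field, concentrated in degree 0, as the graded algebra K^o. *)

Section BaseField.
Variable K : fieldType.

Definition base_proj (i : int) (v : K^o) : K^o := if i == 0 then v else 0.

Fact base_proj_linear i : linear (base_proj i).
Proof.
by move=> c x y; rewrite /base_proj; case: eqP => // _; rewrite scaler0 addr0.
Qed.

Fact base_projK i j v :
  base_proj i (base_proj j v) = if i == j then base_proj j v else 0.
Proof.
rewrite /base_proj; case: (eqVneq i j) => [->|ij]; first by case: eqP.
by case: eqP => // i0; case: eqP => // j0; rewrite i0 j0 eqxx in ij.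
Qed.

Fact base_proj_sum v : exists s : seq int,
  uniq s && (v == \sum_(i <- s) base_proj i v).
Proof. by exists [:: 0]; rewrite big_seq1 /base_proj eqxx /=. Qed.

HB.instance Definition _ :=
  Lmodule_isGraded.Build K K^o base_proj_linear base_projK base_proj_sum.

Fact base_homog1 : (1 : K^o) \in homog (0 : int).
Proof. by rewrite inE /gproj /= /base_proj eqxx. Qed.

Fact base_homogM (i j : int) (x y : K^o) :
  x \in homog i -> y \in homog j -> x * y \in homog (i + j).
Proof.
rewrite !inE /gproj /= /base_proj.
case: (eqVneq i 0) => [->|_]; last by move=> /eqP<- _; rewrite mul0r if_same.
case: (eqVneq j 0) => [->|_]; last by move=> _ /eqP<-; rewrite mulr0 if_same.
by rewrite addr0 eqxx.
Qed.

HB.instance Definition _ := Algebra_isGraded.Build K K^o base_homog1 base_homogM.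

End BaseField.

Section Operators.
Variables (K : fieldType) (V : gradedLmodType K).
Implicit Types (a : seq V) (d : seq int) (u v : seq V -> V).

Definition homogs d a : Prop :=
  size d = size a /\ forall i, (i < size a)%N -> a`_i \in homog d`_i.

(* The sign e(s) such that a_1 ... a_n = e(s) a_s(1) ... a_s(n) in the graded
   symmetric algebra, d being the sequence of the degrees of the a_i: each
   inversion of s contributes (-1)^(|a||b|). *)
Definition koszul n (s : 'S_n) d : K :=
  \prod_(i < n) \prod_(j < n | (i < j)%N && (s j < s i)%N)
    (-1) ^ (d`_(s i) * d`_(s j)).

Definition permseq (W : nmodType) n (s : 'S_n) (a : seq W) : seq W :=
  [seq a`_(s i) | i <- enum 'I_n].

(* An element of D(V) is encoded by a single function u : seq V -> V; its
   component in D_{n-1}(V) is the restriction of u to sequences of length n.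
   For n = 0 this component is just the vector u [::]. *)

Definition multilinear u : Prop :=
  forall (a b : seq V) (c : K) (x y : V),
    u (a ++ (c *: x + y) :: b) = c *: u (a ++ x :: b) + u (a ++ y :: b).

Definition gsymmetric u : Prop :=
  forall a d (s : 'S_(size a)), homogs d a ->
    u a = koszul s d *: u (permseq s a).

Definition has_degree (p : int) u : Prop :=
  forall a d, homogs d a -> u a \in homog (p + \sum_(e <- d) e).

Definition D_homog (p : int) u : Prop :=
  [/\ multilinear u, gsymmetric u & has_degree p u].

(* Each component is a finite sum of homogeneous operators, as
   Hom^* is the direct sum of the Hom^p. *)
Definition in_D u : Prop :=
  forall n, exists (s : seq int) (g : int -> seq V -> V),
    (forall p, D_homog p (g p)) /\
    (forall a, size a = n -> u a = \sum_(p <- s) g p a).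

Definition in_Aff u : Prop :=
  in_D u /\ forall a, (1 < size a)%N -> u a = 0.

Definition is_Hom (p : int) (f : V -> V) : Prop :=
  linear f /\ forall (i : int) x, x \in homog i -> f x \in homog (p + i).

Definition is_End (f : V -> V) : Prop :=
  exists (s : seq int) (g : int -> V -> V),
    (forall p, is_Hom p (g p)) /\ (forall x, f x = \sum_(p <- s) g p x).

Definition of_vec (x : V) : seq V -> V := fun a => if a is [::] then x else 0.

Definition of_end (f : V -> V) : seq V -> V :=
  fun a => if a is [:: x] then f x else 0.

Definition gsupp (x : V) : seq int := xchoose (gproj_sum x).

(* Multilinear extension to arbitrary arguments of an expression phi d a that is
   only given for homogeneous arguments a, of degrees d. *)
Fixpoint mlext (phi : seq int -> seq V -> V) a : V :=
  if a is x :: a' then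
    \sum_(i <- gsupp x) mlext (fun d b => phi (i :: d) (gproj i x :: b)) a'
  else phi [::] [::].

Lemma gproj_homog (i j : int) (x : V) : x \in homog j ->
  gproj i x = if i == j then x else 0.
Proof. by rewrite inE => /eqP xj; rewrite -xj gprojK xj. Qed.

Lemma mlextE phi a d : homogs d a ->
  (forall e b, 0 \in b -> phi e b = 0) -> mlext phi a = phi d a.
Proof.
elim: a phi d => [|x a IHa] phi [|j d] [] //= [sd] hd phi0.
have xj : x \in homog j := hd 0 isT.
have hd' : homogs d a by split=> // i; apply: (hd i.+1).
have step i : mlext (fun e b => phi (i :: e) (gproj i x :: b)) a
    = phi (i :: d) (gproj i x :: a).
  by apply: IHa => // e b b0; apply: phi0; rewrite inE b0 orbT.
rewrite (eq_bigr _ (fun i _ => step i)) /gsupp.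
move: (xchooseP (gproj_sum x)); set s := xchoose _ => /andP[us /eqP sx].
have out i : i != j -> phi (i :: d) (gproj i x :: a) = 0.
  by move=> ij; apply: phi0; rewrite (gproj_homog _ xj) (negPf ij) mem_head.
have [js|js] := boolP (j \in s).
  rewrite (bigD1_seq j) //= big1 ?addr0; last by move=> i /out.
  by rewrite (gproj_homog _ xj) eqxx.
have sj i : i \in s -> i != j by apply: contraTneq => ->.
have x0 : x = 0.
  rewrite sx big1_seq // => i /andP[_ /sj ij].
  by rewrite (gproj_homog _ xj) (negPf ij).
rewrite big1_seq => [|i /andP[_ /sj /out]//].
by rewrite phi0 // x0 mem_head.
Qed.

Definition shuffle n (m : nat) (s : 'S_n) : bool :=
  [forall i : 'I_n, forall j : 'I_n,
    (i < j)%N && ((j < m)%N || (m <= i)%N) ==> (s i < s j)%N].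

(* The component of arity n of the product of u and v collects the products of
   the component of arity m of v with the one of arity n - m + 1 of u, for all
   m <= n; for m = 0 the only shuffle is the identity and the term is
   u(v, a_1, ..., a_n).  The component of u in V does not contribute. *)
Definition nr_prod_homog u v d a : V :=
  \sum_(m < (size a).+1) \sum_(s : 'S_(size a) | shuffle m s)
    koszul s d *:
      u (v (take m (permseq s a)) :: drop m (permseq s a)).

Definition nr_prod u v : seq V -> V := mlext (nr_prod_homog u v).

(* The Nijenhuis-Richardson bracket of elements of degrees p and q. *)
Definition nr_bracket (p q : int) u v : seq V -> V :=
  fun a => nr_prod u v a - (-1) ^ (p * q) *: nr_prod v u a.

End Operators.
Arguments koszul {K n} s d.
Arguments shuffle {n} m s.

(* Psi A u (a_1, ..., a_n) is Psi^n_u(a_1, ..., a_n), for u in Aff^*(A); the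
   values of Psi A outside Aff^*(A) are irrelevant. *)
Definition assignment (K : fieldType) : Type :=
  forall A : gradedAlgType K, (seq A -> A) -> seq A -> A.

Definition graded_morphism (K : fieldType) (A B : gradedAlgType K)
    (alpha : {lrmorphism A -> B}) : Prop :=
  forall (i : int) (x : A), x \in homog i -> alpha x \in homog i.

Definition graded_central (K : fieldType) (A : gradedAlgType K) (c : A) : Prop :=
  exists2 i : int, c \in homog i &
    forall (j : int) (a : A), a \in homog j -> a * c = (-1) ^ (j * i) *: (c * a).

Record koszul_brackets (K : fieldType) (Psi : assignment K) : Prop := {
  Psi_in_D : forall (A : gradedAlgType K) (u : seq A -> A),
    in_Aff u -> in_D (Psi A u);
  Psi_degree : forall (A : gradedAlgType K) (p : int) (u : seq A -> A),
    in_Aff u -> D_homog p u -> D_homog p (Psi A u);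
  Psi_linear : forall (A : gradedAlgType K) (c : K) (u v : seq A -> A) a,
    in_Aff u -> in_Aff v ->
    Psi A (fun b => c *: u b + v b) a = c *: Psi A u a + Psi A v a;
  Psi_bracket : forall (A : gradedAlgType K) (p q : int) (u v : seq A -> A) a,
    in_Aff u -> in_Aff v -> D_homog p u -> D_homog q v ->
    Psi A (nr_bracket p q u v) a = nr_bracket p q (Psi A u) (Psi A v) a;
  Psi_natural_vec : forall (A B : gradedAlgType K) (alpha : {lrmorphism A -> B})
      (x : A) (a : seq A),
    graded_morphism alpha ->
    alpha (Psi A (of_vec x) a) = Psi B (of_vec (alpha x)) (map alpha a);
  Psi_natural_end : forall (A B : gradedAlgType K) (alpha : {lrmorphism A -> B})
      (f : A -> A) (g : B -> B) (a : seq A),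
    graded_morphism alpha -> is_End f -> is_End g ->
    (forall x, g (alpha x) = alpha (f x)) ->
    alpha (Psi A (of_end f) a) = Psi B (of_end g) (map alpha a);
  Psi_central_1 : forall (A : gradedAlgType K) (c : A) (s : seq A) (a : A),
    graded_central c ->
    Psi A (of_vec 1) (rcons s (a * c)) = Psi A (of_vec 1) (rcons s a) * c;
  Psi_central_id : forall (A : gradedAlgType K) (c : A) (s : seq A) (a : A),
    graded_central c ->
    Psi A (of_end id) (rcons s (a * c)) = Psi A (of_end id) (rcons s a) * c;
  Psi0_vec : forall (A : gradedAlgType K) (x : A), Psi A (of_vec x) [::] = x;
  Psi0_end : forall (A : gradedAlgType K) (f : A -> A), is_End f ->
    Psi A (of_end f) [::] = f 1;
  Psi_base : forall a : seq K^o, (0 < size a)%N -> Psi K^o (of_end id) a = 0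
}.

(* B_n / n! is the coefficient of x^n in x / (e^x - 1): bernoulli_seq computes
   B_0, ..., B_{n-1} by inverting the series (e^x - 1) / x, and bernoulliP is
   the equality (sum_n B_n x^n / n!) (e^x - 1) = x, coefficient by coefficient. *)

Section Bernoulli.
Variable K : fieldType.

Fixpoint bernoulli_seq (n : nat) : seq K :=
  if n is m.+1 then
    let s := bernoulli_seq m in
    rcons s (m`!%:R * ((m == 0%N)%:R
      - \sum_(k < m) s`_k / k`!%:R * ((m - k).+1)`!%:R^-1))
  else [::].

Definition bernoulli (n : nat) : K := (bernoulli_seq n.+1)`_n.

Definition bernoulli2 (i j : nat) : K :=
  (-1) ^+ j * \sum_(k < j.+1) 'C(j, k)%:R * bernoulli (i + k).

Lemma size_bernoulli_seq n : size (bernoulli_seq n) = n.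
Proof. by elim: n => //= n IHn; rewrite size_rcons IHn. Qed.

Lemma nth_bernoulli_seq n k : (k < n)%N -> (bernoulli_seq n)`_k = bernoulli k.
Proof.
elim: n => // n IHn; rewrite ltnS leq_eqVlt => /orP[/eqP-> //|kn].
by rewrite /= nth_rcons size_bernoulli_seq kn IHn.
Qed.

Lemma bernoulliE n : bernoulli n = n`!%:R * ((n == 0%N)%:R
  - \sum_(k < n) bernoulli k / k`!%:R * ((n - k).+1)`!%:R^-1).
Proof.
rewrite {1}/bernoulli /= nth_rcons size_bernoulli_seq ltnn eqxx.
congr (_ * (_ - _)); apply: eq_bigr => k _.
by rewrite nth_bernoulli_seq.
Qed.

Lemma bernoulliP (charK : [pchar K] =i pred0) (n : nat) :
  \sum_(k < n.+1) bernoulli k / k`!%:R *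
    (if (n - k == 0)%N then 0 else (n - k)`!%:R^-1) = (n == 1%N)%:R.
Proof.
have natK m : (m`!%:R != 0 :> K).
  by rewrite ((pcharf0P K).1 charK) -lt0n fact_gt0.
rewrite big_ord_recr /= subnn eqxx mulr0 addr0.
case: n => [|n]; first by rewrite big_ord0.
have E (k : 'I_n.+1) : (n.+1 - k)%N = (n - k).+1 by rewrite subSn // -ltnS.
under eq_bigr => k _ do rewrite E /=.
rewrite big_ord_recr /= subnn invr1 mulr1 (bernoulliE n) mulrAC divff //.
by rewrite mul1r addrC subrK eqSS.
Qed.

End Bernoulli.

(* Main.v *)
(* In terms of vector fields, the claim is that Psi_x and Psi_f are the affine
   vector fields y |-> x and y |-> f(y) transported by y = exp(a): the
   generating series of B_ij is (s - t) / (e^s - e^t), which for s, t the left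
   and right multiplications by a is the inverse of the differential of exp at
   a.

   Naturality along K -> A and along K[X] -> A, X |-> a of degree 0, with the
   axioms on central elements, gives Psi_Id (a, ..., a) = 0 in positive arity and
   Psi_1 (a, ..., a) = (-1)^n a^n.  The brackets with Psi_Id say that
   Psi_x (1, a_1, ..., a_n) = - Psi_x (a_1, ..., a_n) and
   Psi_f (1, a_1, ..., a_n) = 0, and then the brackets with Psi_1 become
   recursions that determine Psi_x, and Psi_f in arity at least 2, from lower
   arities; the arity 1 component of Psi_f comes from [Psi_f, Psi_x] = Psi_(f x).
   These recursions show that Psi_x and Psi_f are linear over the graded central
   elements commuting with f.  In the algebra A + eps A, with eps graded central
   of square zero and of any degree, the expansion at a + eps c then reduces an
   identity between operators to equal arguments of degree 0, where all Koszul
   signs disappear and the recursion is a differential equation for the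
   generating series of B_ij. *)

Require Import Defs.
From HB Require Import structures.
From mathcomp Require Import all_boot all_order all_fingroup all_algebra.
From mathcomp Require Import ring zify.
From mathcomp Require Import boolp.

Set Implicit Arguments.
Unset Strict Implicit.
Unset Printing Implicit Defensive.

Import GRing.Theory.
Local Open Scope ring_scope.

(** * Adjoining a graded central element of square zero *)

(** The recursion is not closed on equal arguments: [Psi_x] at (a, ..., a) calls on [Psi_x] at (a^m,
    a, ..., a). Such a value is the eps-component of the value at a + eps a^m in A + eps A, with eps
    of degree 0. Hence the induction on the arity runs over all graded algebras at once, and
    linearity over eps has to be known beforehand. The axioms provide it only for [Psi_1] and
    [Psi_Id]; the recursions carry it over to [Psi_x] and [Psi_f]. Other degrees of eps serve
    arguments of other degrees: c of degree q needs eps of degree -q for a + eps c to have degree 0.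
    Left and right multiplication by a commute, so the differential equation is an identity in
    K[s, t]. It is proved there, where s - t can be cancelled, and only then evaluated at a.
    Characteristic 0 is used for dividing by factorials, by the factor that the recursions put
    before the unknown component, and by the number of equal arguments in the expansion at a + eps
    c. *)

Section Signs.
Variable K : fieldType.
Implicit Types m n k : int.

Lemma signzD m n : (-1) ^ (m + n) = (-1) ^ m * (-1) ^ n :> K.
Proof. by rewrite expfzDr // oppr_eq0 oner_neq0. Qed.

(** The form in which Koszul signs are compared: the half-difference [k] of two exponents is named
    and [ring] does the rest. *)
Lemma signz_mod2 k m n : m = n + 2 * k -> (-1) ^ m = (-1) ^ n :> K.
Proof.
move=> ->; rewrite signzD -exprz_exp (_ : (2 : int) = Posz 2) // -exprnP sqrrN.
by rewrite expr1n exp1rz mulr1.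
Qed.

Lemma signzMK m : (-1) ^ m * (-1) ^ m = 1 :> K.
Proof. by rewrite -signzD (@signz_mod2 m _ 0) //; ring. Qed.

Lemma signz_neq0 m : (-1) ^ m != 0 :> K.
Proof. by rewrite expfz_neq0 // oppr_eq0 oner_neq0. Qed.

End Signs.

Section GradedModules.
Variables (K : fieldType) (V : gradedLmodType K).
Implicit Types (x y : V) (i j : int).

HB.instance Definition _ i :=
  GRing.isLinear.Build K V V *:%R (gproj i) (gproj_linear i).

Lemma homog_gproj i x : gproj i x \in homog i.
Proof. by rewrite inE gprojK eqxx. Qed.

Lemma homog_is_submod i : submod_closed (@homog K V i).
Proof.
split=> [|c x y]; first by rewrite inE linear0.
by rewrite !inE => /eqP hx /eqP hy; rewrite gproj_linear hx hy.
Qed.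

HB.instance Definition _ i := GRing.isSubmodClosed.Build K V (@homog K V i)
  (homog_is_submod i).

Lemma gsupp_uniq x : uniq (gsupp x).
Proof. by case/andP: (xchooseP (gproj_sum x)). Qed.

Lemma gsuppE x : x = \sum_(i <- gsupp x) gproj i x.
Proof. by case/andP: (xchooseP (gproj_sum x)) => _ /eqP. Qed.

Lemma gproj_notin i x : i \notin gsupp x -> gproj i x = 0.
Proof.
move=> ix; rewrite {1}(gsuppE x) linear_sum big1_seq //= => j jx.
by rewrite gprojK; case: eqP => // ij; rewrite ij jx in ix.
Qed.

(** [gsupp] is a chosen list, with no relation between the lists of x, y and x + y. Passing to a
    common larger list makes decompositions comparable, since the added components are 0. *)
Lemma sum_gsupp (W : nmodType) (F : int -> V -> W) x (s : seq int) :
  (forall i, F i 0 = 0) -> uniq s -> {subset gsupp x <= s} ->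
  \sum_(i <- gsupp x) F i (gproj i x) = \sum_(i <- s) F i (gproj i x).
Proof.
move=> F0 us sub; rewrite [RHS](bigID (mem (gsupp x))) /= [X in _ + X]big1.
  rewrite addr0 -[RHS]big_filter; apply: perm_big; apply: uniq_perm.
  - exact: gsupp_uniq.
  - exact: filter_uniq.
  by move=> i; rewrite mem_filter /=; case: (boolP (i \in gsupp x)) => //= /sub.
by move=> i /gproj_notin->.
Qed.

Lemma sum_gproj x (s : seq int) : uniq s -> {subset gsupp x <= s} ->
  x = \sum_(i <- s) gproj i x.
Proof. by move=> us sub; rewrite {1}(gsuppE x); apply: (sum_gsupp (F := fun _ y => y)). Qed.

(** The sign of passing an element of degree e over x, extended from homogeneous x by linearity: the
    product of A + eps A has to be defined on all elements. *)
Definition koszul_twist (e : int) x : V :=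
  \sum_(i <- gsupp x) (-1) ^ (e * i) *: gproj i x.

Lemma koszul_twist_sum e x (s : seq int) : uniq s -> {subset gsupp x <= s} ->
  koszul_twist e x = \sum_(i <- s) (-1) ^ (e * i) *: gproj i x.
Proof.
by apply: (sum_gsupp (F := fun i y => (-1) ^ (e * i) *: y)) => i; rewrite scaler0.
Qed.

Lemma koszul_twist_is_linear e : linear (koszul_twist e).
Proof.
move=> c x y; pose s := undup (gsupp x ++ gsupp y ++ gsupp (c *: x + y)).
have sub z : z \in [:: x; y; c *: x + y] -> {subset gsupp z <= s}.
  rewrite !inE => zs i iz; rewrite mem_undup !mem_cat.
  by case/or3P: zs iz => /eqP-> ->; rewrite ?orbT.
rewrite !(@koszul_twist_sum _ _ s) ?undup_uniq //; try by apply: sub; rewrite !inE eqxx ?orbT.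
rewrite scaler_sumr -big_split; apply: eq_bigr => i _ /=.
by rewrite linearP scalerDr !scalerA mulrC.
Qed.

HB.instance Definition _ e :=
  GRing.isLinear.Build K V V *:%R (koszul_twist e) (koszul_twist_is_linear e).

Lemma koszul_twist_homog e i x : x \in homog i ->
  koszul_twist e x = (-1) ^ (e * i) *: x.
Proof.
move=> xi; rewrite (@koszul_twist_sum _ _ (undup (i :: gsupp x))) ?undup_uniq //.
  rewrite (bigD1_seq i) ?undup_uniq ?mem_undup ?mem_head //= big1 => [|j /negPf ji].
    by rewrite addr0 (gproj_homog _ xi) eqxx.
  by rewrite (gproj_homog _ xi) ji scaler0.
by move=> j jx; rewrite mem_undup inE jx orbT.
Qed.

Lemma koszul_twist0 x : koszul_twist 0 x = x.
Proof.
rewrite [RHS]gsuppE; apply: eq_bigr => i _.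
by rewrite mul0r expr0z scale1r.
Qed.

End GradedModules.

(** What makes the product of A + eps A associative. *)
Lemma koszul_twistM (K : fieldType) (A : gradedAlgType K) e (x y : A) :
  koszul_twist e (x * y) = koszul_twist e x * koszul_twist e y.
Proof.
rewrite {1}(gsuppE x) {1}(gsuppE y) mulr_suml linear_sum /= {2}/koszul_twist mulr_suml.
apply: eq_bigr => i _; rewrite mulr_sumr linear_sum /= mulr_sumr; apply: eq_bigr => j _.
rewrite (koszul_twist_homog _ (homogM _ _ _ _ (homog_gproj i x) (homog_gproj j y))).
by rewrite -scalerAr -scalerAl scalerA mulrDr signzD mulrC.
Qed.

Lemma koszul_twist1 (K : fieldType) (A : gradedAlgType K) e :
  koszul_twist e (1 : A) = 1.
Proof. by rewrite (koszul_twist_homog _ homog1) mulr0 scale1r. Qed.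

Lemma is_Hom0 (K : fieldType) (V : gradedLmodType K) p (f : V -> V) :
  is_Hom p f -> f 0 = 0.
Proof. by case=> fl _; have := fl (-1) 0 0; rewrite scaler0 addr0 scaleN1r addNr. Qed.

Lemma is_HomZ (K : fieldType) (V : gradedLmodType K) p (f : V -> V) k x :
  is_Hom p f -> f (k *: x) = k *: f x.
Proof. by move=> hf; rewrite -[k *: x]addr0; case: (hf) => -> _; rewrite (is_Hom0 hf) addr0. Qed.

Lemma is_Hom_1 (K : fieldType) (A : gradedAlgType K) p (f : A -> A) :
  is_Hom p f -> f 1 \in homog p.
Proof. by case=> _ fh; rewrite -[p]addr0 fh // homog1. Qed.

(* The graded algebra A + eps A, with eps a graded central variable of degree e
   and square zero; the pair (a, b) stands for a + eps b. *)
Definition adjoin (K : fieldType) (A : gradedAlgType K) (e : int) : Type :=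
  (A * A)%type.

Section Adjoin.
Variables (K : fieldType) (A : gradedAlgType K) (e : int).
Local Notation B := (adjoin A e).
Implicit Types x y z : B.

HB.instance Definition _ := GRing.Lmodule.copy B (A * A)%type.

(** Expansion of (a + eps b)(a' + eps b') with eps^2 = 0 and a eps = eps [koszul_twist e a]. *)
Definition adjoin_mul x y : B := (x.1 * y.1, x.2 * y.1 + koszul_twist e x.1 * y.2).

Fact adjoin_mulA : associative adjoin_mul.
Proof.
move=> x y z; congr (_, _) => /=; first by rewrite mulrA.
by rewrite mulrDl mulrDr !mulrA koszul_twistM addrA.
Qed.

Fact adjoin_mul1 : left_id ((1, 0) : B) adjoin_mul.
Proof. by case=> a b; rewrite /adjoin_mul /= koszul_twist1 mul0r add0r !mul1r. Qed.

Fact adjoin_1mul : right_id ((1, 0) : B) adjoin_mul.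
Proof. by case=> a b; rewrite /adjoin_mul /= mulr0 addr0 !mulr1. Qed.

Fact adjoin_mulDl : left_distributive adjoin_mul +%R.
Proof.
move=> x y z; congr (_, _) => /=; first by rewrite mulrDl.
by rewrite linearD !mulrDl /= addrACA.
Qed.

Fact adjoin_mulDr : right_distributive adjoin_mul +%R.
Proof.
move=> x y z; congr (_, _) => /=; first by rewrite mulrDr.
by rewrite !mulrDr addrACA.
Qed.

Fact adjoin_1neq0 : ((1, 0) : B) != 0.
Proof. by apply/eqP => -[/eqP]; rewrite oner_eq0. Qed.

HB.instance Definition _ := GRing.Zmodule_isNzRing.Build B
  adjoin_mulA adjoin_mul1 adjoin_1mul adjoin_mulDl adjoin_mulDr adjoin_1neq0.

Lemma adjoin_mulE x y : x * y = (x.1 * y.1, x.2 * y.1 + koszul_twist e x.1 * y.2).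
Proof. by []. Qed.

Lemma adjoin_scaleE (c : K) x : c *: x = (c *: x.1, c *: x.2) :> B.
Proof. by []. Qed.

Lemma adjoin_addE x y : x + y = (x.1 + y.1, x.2 + y.2) :> B.
Proof. by []. Qed.

Lemma adjoin_mulrn x n : (x *+ n).2 = x.2 *+ n.
Proof. by elim: n => [|n IH] //; rewrite !mulrS adjoin_addE /= IH. Qed.

Fact adjoin_scaleAl (c : K) x y : c *: (x * y) = (c *: x : B) * y.
Proof.
by rewrite !adjoin_mulE !adjoin_scaleE /= scalerDr linearZ /= !scalerAl.
Qed.

HB.instance Definition _ := GRing.Lmodule_isLalgebra.Build K B adjoin_scaleAl.

Fact adjoin_scaleAr (c : K) x y : c *: (x * y) = x * (c *: y : B).
Proof. by rewrite !adjoin_mulE !adjoin_scaleE /= scalerDr !scalerAr. Qed.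

HB.instance Definition _ := GRing.Lalgebra_isAlgebra.Build K B adjoin_scaleAr.

(** The shift by [e] accounts for the degree of eps in eps b. *)
Definition adjoin_gproj i x : B := (gproj i x.1, gproj (i - e) x.2).

Fact adjoin_gproj_linear i : linear (adjoin_gproj i).
Proof. by move=> c x y; congr (_, _); rewrite linearP. Qed.

Fact adjoin_gprojK i j x :
  adjoin_gproj i (adjoin_gproj j x) = if i == j then adjoin_gproj j x else 0.
Proof.
rewrite /adjoin_gproj /= !gprojK (inj_eq (addIr (- e))).
by case: eqP.
Qed.

Lemma adjoin_sumE (I : Type) (r : seq I) (F : I -> B) :
  \sum_(i <- r) F i = (\sum_(i <- r) (F i).1, \sum_(i <- r) (F i).2) :> B.
Proof. by elim: r => [|i r IH]; rewrite ?big_nil // !big_cons IH. Qed.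

Fact adjoin_gproj_sum x : exists s : seq int,
  uniq s && (x == \sum_(i <- s) adjoin_gproj i x).
Proof.
exists (undup (gsupp x.1 ++ [seq i + e | i <- gsupp x.2])).
rewrite undup_uniq adjoin_sumE /=; apply/eqP.
rewrite [LHS]surjective_pairing; congr (_, _).
  apply: sum_gproj; rewrite ?undup_uniq // => i ix.
  by rewrite mem_undup mem_cat ix.
rewrite -(big_map (fun i => i - e) predT (fun i => gproj i x.2)); apply: sum_gproj.
  by rewrite map_inj_uniq ?undup_uniq //; exact: addIr.
move=> i ix; apply/mapP; exists (i + e); last by rewrite addrK.
by rewrite mem_undup mem_cat (map_f (fun i => i + e) ix) orbT.
Qed.

HB.instance Definition _ := Lmodule_isGraded.Build K B
  adjoin_gproj_linear adjoin_gprojK adjoin_gproj_sum.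

Lemma adjoin_homog i x : (x \in homog i) = (x.1 \in homog i) && (x.2 \in homog (i - e)).
Proof. by rewrite !inE -pair_eqE. Qed.

Fact adjoin_homog1 : (1 : B) \in homog (0 : int).
Proof. by rewrite adjoin_homog homog1 /= rpred0. Qed.

Fact adjoin_homogM i j x y :
  x \in homog i -> y \in homog j -> x * y \in homog (i + j).
Proof.
rewrite !adjoin_homog => /andP[x1 x2] /andP[y1 y2]; rewrite homogM //= rpredD //.
  by rewrite addrAC homogM.
by rewrite (koszul_twist_homog _ x1) -addrA -scalerAl rpredZ // homogM.
Qed.

HB.instance Definition _ := Algebra_isGraded.Build K B adjoin_homog1 adjoin_homogM.

Definition adjoin_in (a : A) : B := (a, 0).

Fact adjoin_in_linear : linear adjoin_in.
Proof. by move=> c a b; rewrite adjoin_addE adjoin_scaleE /= scaler0 add0r. Qed.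

HB.instance Definition _ := GRing.isLinear.Build K A B *:%R adjoin_in adjoin_in_linear.

Fact adjoin_in_monoid_morphism : monoid_morphism adjoin_in.
Proof. by split=> // a b; rewrite adjoin_mulE /= mul0r mulr0 addr0. Qed.

HB.instance Definition _ := GRing.isMonoidMorphism.Build A B adjoin_in
  adjoin_in_monoid_morphism.

Lemma adjoin_in_homog i a : (adjoin_in a \in homog i) = (a \in homog i).
Proof. by rewrite adjoin_homog rpred0 andbT. Qed.

Definition adjoin_eps : B := (0, 1).

Lemma adjoin_eps_homog : adjoin_eps \in homog e.
Proof. by rewrite adjoin_homog rpred0 subrr homog1. Qed.

Lemma adjoin_epsM x : adjoin_eps * x = (0, x.1).
Proof. by rewrite adjoin_mulE /= linear0 !mul0r mul1r addr0. Qed.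

Lemma adjoin_eps_in_inj a : adjoin_eps * adjoin_in a = 0 -> a = 0.
Proof. by rewrite adjoin_epsM => -[]. Qed.

Lemma adjoin_epsMK x : adjoin_eps * (adjoin_eps * x) = 0.
Proof. by rewrite !adjoin_epsM. Qed.

Lemma adjoin_eps_comm j x : x \in homog j ->
  x * adjoin_eps = (-1) ^ (j * e) *: (adjoin_eps * x).
Proof.
rewrite adjoin_homog => /andP[x1 _]; rewrite adjoin_epsM.
rewrite adjoin_mulE adjoin_scaleE /= !mulr0 mulr1 add0r scaler0.
by rewrite (koszul_twist_homog _ x1) mulrC.
Qed.

Lemma adjoinE x : x = adjoin_in x.1 + adjoin_eps * adjoin_in x.2.
Proof. by rewrite adjoin_epsM adjoin_addE /= addr0 add0r -surjective_pairing. Qed.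

(* The extension of f of degree p to A + eps A that graded commutes with eps. *)
Definition adjoin_map p (f : A -> A) x : B := (f x.1, (-1) ^ (e * p) *: f x.2).

Lemma is_Hom_adjoin_map p f : is_Hom p f -> is_Hom p (adjoin_map p f).
Proof.
case=> fl fh; split=> [c x y|i x].
  by rewrite /adjoin_map !fl adjoin_addE adjoin_scaleE /= scalerDr !scalerA mulrC.
rewrite !adjoin_homog => /andP[x1 x2].
by rewrite fh //= rpredZ // -addrA fh.
Qed.

Lemma adjoin_map_in p f a : is_Hom p f ->
  adjoin_map p f (adjoin_in a) = adjoin_in (f a).
Proof.
move=> /is_Hom0 f0.
by rewrite /adjoin_map f0 scaler0.
Qed.

Lemma adjoin_map_eps p f x : is_Hom p f ->
  adjoin_map p f (adjoin_eps * x) = (-1) ^ (e * p) *: (adjoin_eps * adjoin_map p f x).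
Proof.
move=> /is_Hom0 f0.
by rewrite !adjoin_epsM /adjoin_map adjoin_scaleE /= f0 scaler0.
Qed.

End Adjoin.

(** * Polarization of graded operators *)

Section PolyGrading.
Variable K : fieldType.

(** K[X] in degree 0 maps to every graded algebra by sending X to a given element of degree 0. There
    X is central, so the axioms on central elements apply although its image need not be central. *)
Definition poly_gproj (i : int) (v : {poly K}) : {poly K} := if i == 0 then v else 0.

Fact poly_gproj_linear i : linear (poly_gproj i).
Proof.
by move=> c x y; rewrite /poly_gproj; case: eqP => // _; rewrite scaler0 addr0.
Qed.

Fact poly_gprojK i j v :
  poly_gproj i (poly_gproj j v) = if i == j then poly_gproj j v else 0.
Proof.
rewrite /poly_gproj; case: (eqVneq i j) => [->|ij]; first by case: eqP.
by case: eqP => // i0; case: eqP => // j0; rewrite i0 j0 eqxx in ij.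
Qed.

Fact poly_gproj_sum v : exists s : seq int,
  uniq s && (v == \sum_(i <- s) poly_gproj i v).
Proof. by exists [:: 0]; rewrite big_seq1 /poly_gproj eqxx /=. Qed.

HB.instance Definition _ := Lmodule_isGraded.Build K {poly K}
  poly_gproj_linear poly_gprojK poly_gproj_sum.

Lemma poly_homog (i : int) (v : {poly K}) :
  (v \in homog i) = (i == 0) || (v == 0).
Proof. by rewrite inE /gproj /= /poly_gproj; case: (i == 0); rewrite ?eqxx // eq_sym. Qed.

Fact poly_homog1 : (1 : {poly K}) \in homog (0 : int).
Proof. by rewrite poly_homog. Qed.

Fact poly_homogM (i j : int) (x y : {poly K}) :
  x \in homog i -> y \in homog j -> x * y \in homog (i + j).
Proof.
rewrite !poly_homog => /orP[/eqP->|/eqP->]; last by rewrite mul0r eqxx orbT.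
by rewrite add0r => /orP[->//|/eqP->]; rewrite mulr0 eqxx orbT.
Qed.

HB.instance Definition _ := Algebra_isGraded.Build K {poly K} poly_homog1 poly_homogM.

End PolyGrading.

Section PolyEval.
Variables (K : fieldType) (A : gradedAlgType K) (a : A).

Definition poly_eval (p : {poly K}) : A := horner_alg a p.

Fact poly_eval_linear : linear poly_eval.
Proof.
by move=> c p q; rewrite /poly_eval linearP /= -[in RHS]mulr_algl.
Qed.

HB.instance Definition _ :=
  GRing.isLinear.Build K {poly K} A *:%R poly_eval poly_eval_linear.

Fact poly_eval_monoid_morphism : monoid_morphism poly_eval.
Proof. by split=> [|p q]; rewrite /poly_eval (rmorph1, rmorphM). Qed.

HB.instance Definition _ :=
  GRing.isMonoidMorphism.Build {poly K} A poly_eval poly_eval_monoid_morphism.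

Lemma poly_evalX : poly_eval 'X = a.
Proof. exact: horner_algX. Qed.

Lemma homog_exp n : a \in homog 0 -> a ^+ n \in homog 0.
Proof.
move=> a0; elim: n => [|n IH]; first exact: homog1.
by rewrite exprS -[X in homog X](addr0 (0 : int)) homogM.
Qed.

Lemma poly_eval_graded : a \in homog 0 -> graded_morphism poly_eval.
Proof.
move=> a0 i p; rewrite poly_homog => /orP[/eqP->|/eqP->]; last by rewrite linear0 rpred0.
rewrite -[p]coefK poly_def linear_sum rpred_sum // => k _.
by rewrite linearZ rpredZ // rmorphXn /= poly_evalX homog_exp.
Qed.

End PolyEval.

Section GradedOperators.
Variable K : fieldType.

(* Operators on lists of homogeneous arguments; the first list is that of the
   degrees of the arguments. *)
Definition gop (V : Type) : Type := seq int -> seq V -> V.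

Section Modules.
Variable V : gradedLmodType K.
Implicit Types (W : gop V) (d : seq int) (a b : seq V).

Definition gop_linear W : Prop :=
  forall d1 q d2 b1 b2 (k : K) (x y : V), homogs d1 b1 -> homogs d2 b2 ->
    x \in homog q -> y \in homog q ->
    W (d1 ++ q :: d2) (b1 ++ (k *: x + y) :: b2) =
      k *: W (d1 ++ q :: d2) (b1 ++ x :: b2) + W (d1 ++ q :: d2) (b1 ++ y :: b2).

(** Stated for neighbours only: the form in which a marked argument is moved one place at a time. *)
Definition gop_symmetric W : Prop :=
  forall d1 q r d2 b1 b2 (x y : V), homogs d1 b1 -> homogs d2 b2 ->
    x \in homog q -> y \in homog r ->
    W (d1 ++ q :: r :: d2) (b1 ++ x :: y :: b2) =
      (-1) ^ (q * r) *: W (d1 ++ r :: q :: d2) (b1 ++ y :: x :: b2).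

Lemma homogs_nil : homogs [::] ([::] : seq V).
Proof. by []. Qed.

Lemma homogs_cons q d x a : homogs (q :: d) (x :: a) <-> x \in homog q /\ homogs d a.
Proof.
split=> [[/= [sd] h]|[xq [sd h]]].
  by split; [exact: (h 0)|split=> // i; exact: (h i.+1)].
by split=> [|[|i]] //=; [rewrite sd|exact: h].
Qed.

Lemma homogs_size d a : homogs d a -> size d = size a.
Proof. by case. Qed.

Lemma homogs_cat d1 d2 a b : homogs d1 a -> homogs d2 b -> homogs (d1 ++ d2) (a ++ b).
Proof.
elim: a d1 => [|x a IH] [|q d] //= ha hb; try by case: ha.
by case/homogs_cons: ha => xq ha; apply/homogs_cons; split=> //; exact: IH.
Qed.

Lemma homogs_take i d a : homogs d a -> homogs (take i d) (take i a).
Proof.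
elim: a i d => [|x a IH] [|i] [|q d] //=; try by case.
by move=> /homogs_cons[xq ha]; apply/homogs_cons; split=> //; exact: IH.
Qed.

Lemma homogs_drop i d a : homogs d a -> homogs (drop i d) (drop i a).
Proof.
elim: a i d => [|x a IH] [|i] [|q d] //=; try by case.
by move=> /homogs_cons[_ ha]; exact: IH.
Qed.

Lemma homogs_nseq n q (x : V) : x \in homog q -> homogs (nseq n q) (nseq n x).
Proof. by move=> xq; elim: n => // n IH; apply/homogs_cons. Qed.

Lemma homogs_last d x a : homogs d (rcons a x) ->
  exists d1 q, [/\ d = rcons d1 q, homogs d1 a & x \in homog q].
Proof.
elim: a d => [|y a IH] [|q d] //=; try by case.
  by case: d => [|r d] /homogs_cons[xq h]; [exists [::], q|case: h].
move=> /homogs_cons[yq /IH[d1 [r [-> h1 h2]]]]; exists (q :: d1), r; split=> //.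
exact/homogs_cons.
Qed.

Lemma sum_nseq0 n : \sum_(i <- nseq n (0 : int)) i = 0.
Proof. by elim: n => [|n IH]; rewrite /= ?big_nil // big_cons IH. Qed.

Lemma gop_linearD W d1 q d2 b1 b2 x y : gop_linear W -> homogs d1 b1 ->
  homogs d2 b2 -> x \in homog q -> y \in homog q ->
  W (d1 ++ q :: d2) (b1 ++ (x + y) :: b2) =
    W (d1 ++ q :: d2) (b1 ++ x :: b2) + W (d1 ++ q :: d2) (b1 ++ y :: b2).
Proof. by move=> Wl h1 h2 xq yq; rewrite -{1}[x]scale1r Wl // scale1r. Qed.

(** Multilinear expansion at a + w: terms with w twice vanish by hypothesis and symmetry, and the n
    terms with a single w agree without sign because a and w have degree 0. The prefix [b] collects
    the arguments already expanded in the induction. *)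
Lemma gop_expand W d b n (a w : V) : gop_linear W -> gop_symmetric W ->
  a \in homog 0 -> w \in homog 0 -> homogs d b ->
  (forall d1 b1 d2 b2, homogs d1 b1 -> homogs d2 b2 ->
     W (d1 ++ 0 :: 0 :: d2) (b1 ++ w :: w :: b2) = 0) ->
  W (d ++ nseq n 0) (b ++ nseq n (a + w)) =
    W (d ++ nseq n 0) (b ++ nseq n a) +
    W (d ++ nseq n 0) (b ++ w :: nseq n.-1 a) *+ n.
Proof.
move=> Wl Ws a0 w0 + ww; elim: n d b => [|n IH] d b h; first by rewrite addr0.
have a1 : a + w \in homog 0 by rewrite rpredD.
have st x : W (d ++ 0 :: nseq n 0) (b ++ x :: nseq n (a + w)) =
    W ((d ++ [:: 0]) ++ nseq n 0) ((b ++ [:: x]) ++ nseq n (a + w)).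
  by rewrite -!catA.
have hx x : x \in homog 0 -> homogs (d ++ [:: 0]) (b ++ [:: x]).
  by move=> x0; apply: homogs_cat => //; apply/homogs_cons.
rewrite /= gop_linearD //; last exact: homogs_nseq.
rewrite !st !IH; try exact: hx.
rewrite -!catA /=; case: n {IH st} => [|n] /=; first by rewrite !mulr0n !addr0 mulr1n.
rewrite (ww d b (nseq n 0) (nseq n a)) // ?mul0rn ?addr0; last exact: homogs_nseq.
rewrite (Ws d 0 0 (nseq n 0) b (nseq n a) a w) //; last exact: homogs_nseq.
by rewrite mul0r expr0z scale1r -addrA -mulrSr.
Qed.

End Modules.

Section Algebras.
Variable A : gradedAlgType K.
Implicit Types (W : gop A) (d : seq int) (a b : seq A).

(* The sign of moving c, of degree e, to the left through an operator of
   degree p and the preceding arguments. *)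
Definition gop_clinear (c : A) e p W : Prop :=
  forall d1 q d2 b1 b2 (x : A), homogs d1 b1 -> homogs d2 b2 -> x \in homog q ->
    W (d1 ++ (e + q) :: d2) (b1 ++ (c * x) :: b2) =
      (-1) ^ (e * (p + \sum_(i <- d1) i)) *: (c * W (d1 ++ q :: d2) (b1 ++ x :: b2)).

Definition gop_degree p W : Prop :=
  forall d a, homogs d a -> W d a \in homog (p + \sum_(e <- d) e).

End Algebras.

Lemma adjoin_eps_homog0 (A : gradedAlgType K) e (c : adjoin A e) :
  c \in homog (- e) -> adjoin_eps A e * c \in homog 0.
Proof. by move=> ce; rewrite -[X in homog X](subrr e) homogM // adjoin_eps_homog. Qed.

(** Two factors eps pulled to the front meet in eps (eps x) = 0, the vanishing that [gop_expand]
    asks for. The sign is that of bringing eps to the left of the operator and of the prefix. *)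
Lemma adjoin_expand (A : gradedAlgType K) e (p : int) (W : gop (adjoin A e)) d (b : seq (adjoin A e)) n
    (a c : adjoin A e) :
  gop_linear W -> gop_symmetric W -> gop_clinear (adjoin_eps A e) e p W ->
  a \in homog 0 -> c \in homog (- e) -> homogs d b ->
  W (d ++ nseq n 0) (b ++ nseq n (a + adjoin_eps A e * c)) =
    W (d ++ nseq n 0) (b ++ nseq n a) +
    (-1) ^ (e * (p + \sum_(i <- d) i)) *:
    (adjoin_eps A e * W (d ++ (- e) :: nseq n.-1 0) (b ++ c :: nseq n.-1 a) *+ n).
Proof.
move=> Wl Ws Wc a0 ce h; have w0 := adjoin_eps_homog0 ce.
have Wc0 d1 d2 b1 b2 (x : adjoin A e) : homogs d1 b1 -> homogs d2 b2 ->
    x \in homog (- e) -> W (d1 ++ 0 :: d2) (b1 ++ (adjoin_eps A e * x) :: b2) =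
      (-1) ^ (e * (p + \sum_(i <- d1) i)) *:
        (adjoin_eps A e * W (d1 ++ (- e) :: d2) (b1 ++ x :: b2)).
  by move=> h1 h2 xe; rewrite -Wc // subrr.
rewrite gop_expand //.
  case: n => [|n] /=; first by rewrite !mulr0n scaler0.
  by rewrite Wc0 ?scalerMnr //; exact: homogs_nseq.
move=> d1 b1 d2 b2 h1 h2; rewrite Wc0 //; last exact/homogs_cons.
rewrite -cat_rcons -[b1 ++ _ :: _ :: _]cat_rcons Wc0 //.
  by rewrite -scalerAr adjoin_epsMK !scaler0.
by rewrite -!cats1; apply: homogs_cat => //; apply/homogs_cons.
Qed.

Lemma homogs_in (A : gradedAlgType K) e d (a : seq A) :
  homogs d a -> homogs d (map (adjoin_in e) a).
Proof.
elim: a d => [|x a IH] [|q d] //=; try by case.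
by case/homogs_cons => xq h; apply/homogs_cons; rewrite adjoin_in_homog; split=> //; exact: IH.
Qed.

(* Applied to a + eps c, vanishing on equal arguments of degree 0 propagates to
   one more arbitrary argument c. *)
Lemma gop_polarize (U : forall A : gradedAlgType K, gop A -> Prop) (p : int) :
  [pchar K] =i pred0 ->
  (forall A W, U A W -> gop_linear W /\ gop_symmetric W) ->
  (forall A W e, U A W -> exists W', [/\ U (adjoin A e) W',
     gop_clinear (adjoin_eps A e) e p W' &
     forall d a, homogs d a -> W' d (map (adjoin_in e) a) = adjoin_in e (W d a)]) ->
  (forall A W a n, U A W -> a \in homog 0 -> W (nseq n 0) (nseq n a) = 0) ->
  forall A W d a, U A W -> homogs d a -> W d a = 0.
Proof.
move=> charK Uls Ue U0 A W d a UW h.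
(* Further equal arguments of degree 0 are carried along, so that the induction on the number m of
   arbitrary arguments starts from the hypothesis on equal arguments; n = 0 gives the claim. *)
suff: forall n (x : A), x \in homog 0 -> W (d ++ nseq n 0) (a ++ nseq n x) = 0.
  by move/(_ 0 0 (rpred0 _)); rewrite /= !cats0.
have: exists m, size a = m by exists (size a).
case=> m; elim: m A W d a UW h => [|m IH] A W d a UW h.
  by move=> /eqP/nilP a0; case: d a a0 h => [|q d] [|y a] // _ [] // _ _ n x; exact: U0.
case/lastP: a h => [|a c] // h; rewrite size_rcons => -[sa] n x x0.
case: (homogs_last h) => {h} d' [q [-> h cq]].
(* eps gets the degree opposite to that of the last argument c, so that eps c can be added to x. *)
case: (Ue A W (- q) UW) => W' [UW' W'c W'in]; have [W'l W's] := Uls _ _ UW'.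
have ha := homogs_in (- q) h.
have sa' : size (map (adjoin_in (- q)) a) = m by rewrite size_map.
have x0' : adjoin_in (- q) x \in homog 0 by rewrite adjoin_in_homog.
have c0' : adjoin_in (- q) c \in homog (- - q) by rewrite adjoin_in_homog opprK.
have := adjoin_expand n.+1 W'l W's W'c x0' c0' ha.
(* With one arbitrary argument fewer, the operator vanishes both at x and at x + eps c. The
   expansion leaves, up to sign, n.+1 times eps W(a, c, x, ..., x). *)
rewrite (IH _ _ _ _ UW' ha sa' _ _ x0') (IH _ _ _ _ UW' ha sa').
  rewrite add0r /= => /esym/eqP; rewrite scaler_eq0 (negPf (signz_neq0 _ _)) /=.
  rewrite opprK -map_nseq -map_cons -map_cat W'in; last first.
    by apply: homogs_cat => //; apply/homogs_cons; split=> //; exact: homogs_nseq.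
  rewrite -scaler_nat scaler_eq0 ((pcharf0P K).1 charK) /= => /eqP/adjoin_eps_in_inj.
  by rewrite !cat_rcons.
by apply: rpredD => //; exact: adjoin_eps_homog0.
Qed.

End GradedOperators.

(** * Koszul signs *)

Lemma nth_cat_cons_neq (V : nmodType) (l1 l2 : seq V) y z i : i != size l1 ->
  (l1 ++ y :: l2)`_i = (l1 ++ z :: l2)`_i.
Proof.
move=> il; rewrite !nth_cat; case: ltnP => // li.
have l0 : (0 < i - size l1)%N by rewrite subn_gt0 ltn_neqAle eq_sym il.
by case: (i - size l1)%N l0.
Qed.

Section Permutations.
Variable n : nat.
Implicit Types (s : 'S_n) (i : 'I_n).

Lemma enum_ord_split i : enum 'I_n =
  filter (fun j : 'I_n => (j < i)%N) (enum 'I_n) ++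
  i :: filter (fun j : 'I_n => (i < j)%N) (enum 'I_n).
Proof.
apply: (inj_map val_inj); rewrite map_cat /= val_enum_ord.
rewrite -(filter_map val (fun j => (j < i)%N)) -(filter_map val (fun j => (i < j)%N)).
rewrite val_enum_ord; move: (ltn_ord i); move: (nat_of_ord i) => k kn.
have -> : n = (k + (n - k.+1).+1)%N by rewrite addnS -addSn subnKC.
move: (n - k.+1)%N => m.
rewrite iotaD add0n !filter_cat /= ltnn.
have /all_filterP-> : all (fun j => (j < k)%N) (iota 0 k).
  by apply/allP => j; rewrite mem_iota.
have /all_filterP-> : all (fun j => (k < j)%N) (iota k.+1 m).
  by apply/allP => j; rewrite mem_iota => /andP[].
have nil (P : pred nat) l : all (predC P) l -> filter P l = [::].
  by elim: l => //= j l IH /andP[/negPf-> /IH].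
rewrite nil ?cats0; last by apply/allP => j; rewrite mem_iota /= -leqNgt => /andP[/ltnW].
by rewrite nil //; apply/allP => j; rewrite mem_iota /= -leqNgt => /ltnW.
Qed.

Lemma size_permseq (V : nmodType) s (l : seq V) : size (permseq s l) = n.
Proof. by rewrite size_map size_enum_ord. Qed.

Lemma nth_permseq (V : nmodType) s (l : seq V) i : (permseq s l)`_i = l`_(s i).
Proof. by rewrite (nth_map i) ?size_enum_ord // nth_ord_enum. Qed.

Lemma permseq1 (V : nmodType) (l : seq V) : size l = n -> permseq (1%g : 'S_n) l = l.
Proof.
move=> sl; apply: (@eq_from_nth _ 0); rewrite size_permseq // => i ln.
by rewrite -[i]/(val (Ordinal ln)) nth_permseq perm1.
Qed.

Lemma permseq_nseq (V : nmodType) s (x : V) : permseq s (nseq n x) = nseq n x.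
Proof.
apply: (@eq_from_nth _ 0); rewrite size_permseq ?size_nseq // => i ln.
by rewrite -[i]/(val (Ordinal ln)) nth_permseq !nth_nseq !ltn_ord.
Qed.

Lemma permseq_map (V W : nmodType) (f : V -> W) s (l : seq V) : size l = n ->
  permseq s (map f l) = map f (permseq s l).
Proof.
move=> sl; rewrite -map_comp; apply: eq_map => i /=.
by rewrite (nth_map 0) // sl.
Qed.

Variable K : fieldType.

Lemma koszul1 d : koszul (1%g : 'S_n) d = 1 :> K.
Proof.
rewrite /koszul big1 // => i _; rewrite big1 // => j.
by rewrite !perm1 => /andP[ij]; rewrite ltnNge ltnW.
Qed.

Lemma koszul_nseq0 s m : koszul s (nseq m 0) = 1 :> K.
Proof.
rewrite /koszul big1 // => i _; rewrite big1 // => j _.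
by rewrite nth_nseq if_same mul0r expr0z.
Qed.

Lemma homogs_permseq (V : gradedLmodType K) s d (a : seq V) : size a = n ->
  homogs d a -> homogs (permseq s d) (permseq s a).
Proof.
move=> sa [sd h]; split=> [|i]; rewrite !size_permseq // => ln.
by rewrite -[i]/(val (Ordinal ln)) !nth_permseq h // sa.
Qed.

Section Split.
Variables (s : 'S_n) (i0 : 'I_n).

Definition perm_before (V : nmodType) (l : seq V) :=
  [seq l`_(s j) | j <- [seq j : 'I_n <- enum 'I_n | (j < i0)%N]].
Definition perm_after (V : nmodType) (l : seq V) :=
  [seq l`_(s j) | j <- [seq j : 'I_n <- enum 'I_n | (i0 < j)%N]].

(** The lists around y are computed with 0 in its place, hence do not depend on y. In this form a
    property of an operator at one marked argument passes to its sum over permutations. *)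
Lemma permseq_split (V : nmodType) (l1 l2 : seq V) y : s i0 = size l1 :> nat ->
  permseq s (l1 ++ y :: l2) =
  perm_before (l1 ++ 0 :: l2) ++ y :: perm_after (l1 ++ 0 :: l2).
Proof.
move=> si0; rewrite /permseq (enum_ord_split i0) map_cat /= si0 nth_cat ltnn subnn /=.
have nthy (j : 'I_n) : j != i0 -> (l1 ++ y :: l2)`_(s j) = (l1 ++ 0 :: l2)`_(s j).
  by move=> ji; apply: nth_cat_cons_neq; rewrite -si0 val_eqE (inj_eq perm_inj).
by rewrite /perm_before /perm_after; congr (_ ++ _ :: _); apply/eq_in_map => j;
  rewrite mem_filter => /andP[ji _];
  apply: nthy; rewrite -val_eqE neq_ltn ji ?orbT.
Qed.

Lemma sum_perm_before (l : seq int) :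
  \sum_(x <- perm_before l) x = \sum_(j < n | (j < i0)%N) l`_(s j).
Proof. by rewrite big_map big_filter big_enum_cond. Qed.

(* Adding e to the degree of the argument that s moves to position i0
   multiplies the Koszul sign by (-1)^(e|b|) for each argument b that changes
   sides with it, that is, for each b before it either in the original or in
   the permuted order, but not in both. *)
Lemma koszul_split (d1 d2 : seq int) q e :
  size (d1 ++ q :: d2) = n -> s i0 = size d1 :> nat ->
  koszul s (d1 ++ (e + q) :: d2) =
    (-1) ^ (e * \sum_(i <- d1) i) *
    (-1) ^ (e * \sum_(i <- perm_before (d1 ++ 0 :: d2)) i) *
    koszul s (d1 ++ q :: d2) :> K.
Proof.
move=> sd si0; set k := size d1 in si0 *.
pose D := d1 ++ q :: d2; pose D' := d1 ++ (e + q) :: d2.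
have Dk : D`_k = q by rewrite nth_cat ltnn subnn.
have D'k : D'`_k = e + q by rewrite nth_cat ltnn subnn.
have kE (j : 'I_n) : (s j == k :> nat) = (j == i0).
  by rewrite -si0 val_eqE (inj_eq perm_inj).
have DD' (j : 'I_n) : j != i0 -> D'`_(s j) = D`_(s j) /\ (d1 ++ 0 :: d2)`_(s j) = D`_(s j).
  by rewrite -kE => jk; split; apply: nth_cat_cons_neq.
pose G (j : 'I_n) : K := (-1) ^ (e * D`_(s j)).
have GK (P : pred 'I_n) : (\prod_(j | P j) G j) * (\prod_(j | P j) G j) = 1.
  by rewrite -big_split big1 //= => j _; rewrite signzMK.
have sumG (P : pred 'I_n) (F : 'I_n -> int) : (forall j, P j -> F j = D`_(s j)) ->
    (-1) ^ (e * \sum_(j | P j) F j) = \prod_(j | P j) G j.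
  move=> FD; rewrite mulr_sumr.
  rewrite (big_morph (fun m : int => (-1 : K) ^ m) (@signzD K) (expr0z _)).
  by apply: eq_bigr => j Pj; rewrite FD.
have -> : (-1) ^ (e * \sum_(i <- perm_before (d1 ++ 0 :: d2)) i) =
    \prod_(j < n | (j < i0)%N) G j.
  by rewrite sum_perm_before sumG // => j ji; case: (DD' j); rewrite // -val_eqE neq_ltn ji.
have -> : (-1) ^ (e * \sum_(i <- d1) i) = \prod_(j < n | (s j < k)%N) G j.
  rewrite -(sumG _ (fun j => D`_(s j))) //; congr (_ ^ (_ * _)).
  have kn : (k <= n)%N by rewrite -sd size_cat leq_addr.
  rewrite (big_nth 0) big_mkord (big_ord_widen _ (fun i : nat => d1`_i) kn).
  rewrite (reindex_inj (@perm_inj _ s)) /=; apply: eq_bigr => j jk.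
  by rewrite nth_cat jk.
(* Arguments before the marked one in both orders contribute to both signs and cancel, since [G] has
   square 1. Those before it in exactly one order form the inversions with it. *)
have -> : \prod_(j < n | (s j < k)%N) G j =
    \prod_(j < n | (s j < k)%N && (j < i0)%N) G j * \prod_(j < n | (s j < k)%N && (i0 < j)%N) G j.
  rewrite (bigID (fun j : 'I_n => (j < i0)%N)) /=; congr (_ * _).
  apply: eq_bigl => j; case: (ltngtP j i0) => //= ji; rewrite ?andbT //.
  by move/val_inj: ji => ->; rewrite si0 ltnn.
have -> : \prod_(j < n | (j < i0)%N) G j =
    \prod_(j < n | (s j < k)%N && (j < i0)%N) G j * \prod_(j < n | (k < s j)%N && (j < i0)%N) G j.
  rewrite (bigID (fun j : 'I_n => (s j < k)%N)) /=; congr (_ * _).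
    by apply: eq_bigl => j; rewrite andbC.
  apply: eq_bigl => j; rewrite andbC; case: (ltngtP (s j) k) => //= /eqP.
  by rewrite kE => /eqP->; rewrite ltnn.
rewrite [X in _ = X * _](_ : _ = \prod_(j < n | (s j < k)%N && (i0 < j)%N) G j *
    \prod_(j < n | (k < s j)%N && (j < i0)%N) G j); last first.
  by rewrite mulrACA GK mul1r.
(* In the product over inversions the row of i0 changes as a whole, and another row only through its
   factor at i0. *)
have inner i : \prod_(j < n | (i < j)%N && (s j < s i)%N) (-1) ^ (D'`_(s i) * D'`_(s j)) =
    (if i == i0 then \prod_(j < n | (s j < k)%N && (i0 < j)%N) G j else 1) *
    (if (k < s i)%N && (i < i0)%N then G i else 1) *
    \prod_(j < n | (i < j)%N && (s j < s i)%N) (-1) ^ (D`_(s i) * D`_(s j)) :> K.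
  case: eqP => [->|/eqP ii0].
    rewrite ltnn andbF mulr1 si0 D'k Dk.
    rewrite [X in X * _](eq_bigl (fun j : 'I_n => (i0 < j)%N && (s j < k)%N)); last first.
      by move=> j; rewrite andbC.
    rewrite -big_split; apply: eq_bigr => j /andP[ji _] /=.
    have ji0 : j != i0 by rewrite -val_eqE neq_ltn ji orbT.
    by case: (DD' j ji0) => -> _; rewrite mulrDl signzD.
  case: (DD' i ii0) => -> _; rewrite mul1r.
  case: ifP => [/andP[ki ii]|ki]; last first.
    rewrite mul1r; apply: eq_bigr => j /andP[ij sij].
    case: (eqVneq j i0) => [ji|ji]; last by case: (DD' j ji) => ->.
    by rewrite -ji in si0 ki; rewrite -si0 sij ij in ki.
  have Pi0 : (i < i0)%N && (s i0 < s i)%N by rewrite ii si0.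
  rewrite (bigD1 i0) // [in RHS](bigD1 i0) //= si0 D'k Dk mulrA; congr (_ * _).
    by rewrite /G -signzD; congr (_ ^ _); ring.
  by apply: eq_bigr => j /andP[_ ji]; case: (DD' j ji) => ->.
rewrite /koszul -/D -/D' (eq_bigr _ (fun i _ => inner i)) !big_split /=.
by congr (_ * _ * _); rewrite -big_mkcond ?big_pred1_eq.
Qed.

End Split.

Section Swap.
Variables (k : nat) (kn : (k.+1 < n)%N).
Let k1 := Ordinal (ltnW kn).
Let k2 := Ordinal kn.
Local Notation t := (tperm k1 k2).

Lemma nth_swap (W : nmodType) (l1 l2 : seq W) x y i : size l1 = k ->
  (l1 ++ y :: x :: l2)`_i = (l1 ++ x :: y :: l2)`_(t i).
Proof.
move=> sl; case: tpermP => [->|->|/eqP ik1 /eqP ik2] /=.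
- by rewrite !nth_cat sl ltnn subnn ltnNge leqnSn /= subSn // subnn.
- by rewrite !nth_cat sl ltnn subnn ltnNge leqnSn /= subSn // subnn.
rewrite !nth_cat sl; case: ltnP => // ki; rewrite -!val_eqE /= in ik1 ik2.
have l1k : (1 < i - k)%N by clear -ki ik1 ik2; lia.
by case: (i - k)%N l1k => [|[|m]].
Qed.

Lemma permseq_swap (W : nmodType) (l1 l2 : seq W) x y s : size l1 = k ->
  permseq s (l1 ++ y :: x :: l2) = permseq (s * t)%g (l1 ++ x :: y :: l2).
Proof. by move=> sl; apply: eq_map => i; rewrite (nth_swap _ _ _ _ sl) permM. Qed.

(** The inversions of s and of s t differ only in the pair sent to the two swapped positions, which
    is an inversion of exactly one of them; its factor is (-1)^(q r). *)
Lemma koszul_swap (d1 d2 : seq int) q r s : size d1 = k ->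
  koszul s (d1 ++ r :: q :: d2) =
    (-1) ^ (q * r) * koszul (s * t)%g (d1 ++ q :: r :: d2) :> K.
Proof.
move=> sd; pose D := d1 ++ q :: r :: d2.
have D1 : D`_k1 = q by rewrite /D nth_cat /= sd ltnn subnn.
have D2 : D`_k2 = r by rewrite /D nth_cat /= sd ltnNge leqnSn /= subSn // subnn.
pose i1 := (s^-1)%g k1; pose i2 := (s^-1)%g k2.
have s1 : s i1 = k1 by rewrite permKV.
have s2 : s i2 = k2 by rewrite permKV.
pose F (p : 'I_n * 'I_n) : K := (-1) ^ (D`_(t (s p.1)) * D`_(t (s p.2))).
have -> : koszul s (d1 ++ r :: q :: d2) =
    \prod_(p : 'I_n * 'I_n | (p.1 < p.2)%N && (s p.2 < s p.1)%N) F p.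
  rewrite /koszul pair_big_dep; apply: eq_bigr => p _.
  by rewrite /F !(nth_swap d2 q r _ sd).
have -> : koszul (s * t)%g D =
    \prod_(p : 'I_n * 'I_n | (p.1 < p.2)%N && (t (s p.2) < t (s p.1))%N) F p.
  rewrite /koszul pair_big_dep; apply: eq_big => [p|p _]; by rewrite /F !permM.
have tE (i j : 'I_n) : (i < j)%N -> (i, j) != (i1, i2) -> (i, j) != (i2, i1) ->
    (t (s j) < t (s i))%N = (s j < s i)%N.
  rewrite !xpair_eqE => ij e1 e2.
  have sE (l : 'I_n) : (s l == k1) = (l == i1) /\ (s l == k2) = (l == i2).
    by rewrite -s1 -s2 !(inj_eq perm_inj).
  have sij : s i != s j by rewrite (inj_eq perm_inj) -val_eqE neq_ltn ij.
  have [i_1 i_2] := sE i; have [j_1 j_2] := sE j.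
  rewrite -i_1 -j_2 in e1; rewrite -i_2 -j_1 in e2.
  move: sij e1 e2; rewrite -!val_eqE /=.
  by do 2 case: tpermP => [->|->|/eqP + /eqP +] /=; rewrite -?val_eqE /=; lia.
have Fqr p : (p == (i1, i2)) || (p == (i2, i1)) -> F p = (-1) ^ (q * r).
  by case/orP => /eqP->; rewrite /F /= s1 s2 tpermL tpermR D1 D2 // mulrC.
have i12 : i1 != i2 by rewrite (inj_eq perm_inj) -val_eqE /= neq_ltn ltnSn.
case: (ltngtP i1 i2) => [lt12|lt21|/val_inj/eqP]; last by rewrite (negPf i12).
- rewrite [in RHS](bigD1 (i1, i2)) /=; last by rewrite lt12 s1 s2 tpermL tpermR /=.
  rewrite Fqr ?eqxx // mulrA signzMK mul1r; apply: eq_bigl => -[i j] /=.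
  case: (ltnP i j) => //= ij; case: (eqVneq (i, j) (i1, i2)) => [[-> ->]|ne].
    by rewrite s1 s2 /= andbF ltnNge leqnSn.
  rewrite andbT tE //; apply: contraTneq ij => -[-> ->]; by rewrite -leqNgt ltnW.
- rewrite [LHS](bigD1 (i2, i1)) /=; last by rewrite lt21 s1 s2 /=.
  rewrite Fqr ?eqxx ?orbT //; congr (_ * _); apply: eq_bigl => -[i j] /=.
  case: (ltnP i j) => //= ij; case: (eqVneq (i, j) (i2, i1)) => [[-> ->]|ne].
    by rewrite s1 s2 tpermL tpermR /= andbF ltnNge leqnSn.
  rewrite andbT tE //; apply: contraTneq ij => -[-> ->]; by rewrite -leqNgt ltnW.
Qed.

End Swap.
End Permutations.

(** * Shuffles *)

Section CountShuffles.
Variables (n m : nat).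
Hypothesis mn : (m <= n)%N.
Implicit Types (S : {set 'I_n}) (k l : 'I_n) (s : 'S_n).

Lemma shuffleP s : reflect
  (forall i j : 'I_n, (i < j)%N -> (j < m)%N || (m <= i)%N -> (s i < s j)%N)
  (shuffle m s).
Proof.
apply: (iffP forallP) => [h i j ij jm|h i].
  by have /forallP/(_ j)/implyP := h i; rewrite ij jm; exact.
by apply/forallP => j; apply/implyP => /andP[]; exact: h.
Qed.

(** The inverse of the shuffle that sends the first m positions to S: the rank of k when S is listed
    first and its complement second, both increasingly. *)
Definition shuffle_rank S k : nat :=
  if k \in S then #|[set l in S | (l < k)%N]| else (m + #|[set l in ~: S | (l < k)%N]|)%N.

Lemma card_below_lt S k l : k \in S -> (k < l)%N ->
  (#|[set x in S | (x < k)%N]| < #|[set x in S | (x < l)%N]|)%N.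
Proof.
move=> kS kl; apply/proper_card/properP; split.
  by apply/subsetP => x; rewrite !inE => /andP[-> /ltn_trans->].
by exists k; rewrite !inE kS ?ltnn.
Qed.

Lemma card_below_max S k : k \in S -> (#|[set x in S | (x < k)%N]| < #|S|)%N.
Proof.
move=> kS; apply/proper_card/properP; split.
  by apply/subsetP => x; rewrite !inE => /andP[].
by exists k; rewrite // !inE kS ltnn.
Qed.

Lemma shuffle_rank_lt S k : #|S| = m -> (shuffle_rank S k < m)%N = (k \in S).
Proof.
move=> Sm; rewrite /shuffle_rank; case: ifP => kS; first by rewrite -Sm card_below_max.
by rewrite ltnNge leq_addr.
Qed.

Lemma shuffle_rank_ord S k : #|S| = m -> (shuffle_rank S k < n)%N.
Proof.
move=> Sm; rewrite /shuffle_rank; case: ifP => kS.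
  by apply: leq_trans mn; rewrite -Sm card_below_max.
have : k \in ~: S by rewrite inE kS.
move/card_below_max; rewrite -(ltn_add2l m); move/leq_trans; apply.
by rewrite -{1}Sm cardsC card_ord.
Qed.

Lemma shuffle_rank_mono S k l : (k \in S) = (l \in S) -> (k < l)%N ->
  (shuffle_rank S k < shuffle_rank S l)%N.
Proof.
move=> kl lt; rewrite /shuffle_rank -kl; case: ifP => kS; first exact: card_below_lt.
by rewrite ltn_add2l card_below_lt // inE kS.
Qed.

Lemma shuffle_rank_inj S : #|S| = m -> injective (shuffle_rank S).
Proof.
move=> Sm k l kl; have klS : (k \in S) = (l \in S) by rewrite -!shuffle_rank_lt // kl.
apply: val_inj; case: (ltngtP k l) => // lt.
  by have := shuffle_rank_mono klS lt; rewrite kl ltnn.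
by have := shuffle_rank_mono (esym klS) lt; rewrite kl ltnn.
Qed.

Definition shuffle_set s : {set 'I_n} := [set s i | i : 'I_n & (i < m)%N].

Lemma mem_shuffle_set s i : (s i \in shuffle_set s) = (i < m)%N.
Proof.
apply/imsetP/idP => [[j]|im]; first by rewrite inE => jm /perm_inj->.
by exists i => //; rewrite inE.
Qed.

Lemma card_shuffle_set s : #|shuffle_set s| = m.
Proof.
rewrite card_imset; last exact: perm_inj.
rewrite -sum1dep_card -(big_ord_widen _ (fun=> 1%N) mn).
by rewrite sum_nat_const card_ord muln1.
Qed.

Lemma shuffle_rank_perm s i : shuffle m s -> shuffle_rank (shuffle_set s) (s i) = i.
Proof.
move/shuffleP => sh; rewrite /shuffle_rank mem_shuffle_set.
have cnt (P : pred 'I_n) S : (forall j, P j -> (s j < s i)%N = (j < i)%N) ->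
    (forall j, (s j \in S) = P j) ->
    #|[set l in S | (l < s i)%N]| = #|[set j : 'I_n | P j && (j < i)%N]|.
  move=> hP hS; rewrite -[RHS](card_imset _ (@perm_inj _ s)); congr #|pred_of_set _|.
  apply/setP => l; rewrite -(permKV s l); move: ((s^-1)%g l) => j.
  rewrite mem_imset ?inE; last exact: perm_inj.
  by rewrite hS; case Pj: (P j) => //=; rewrite hP.
have mono (j : 'I_n) : (i < m)%N = (j < m)%N -> (s j < s i)%N = (j < i)%N.
  move=> ij; case: (ltngtP j i) => [lt|lt|/val_inj->]; last by rewrite ltnn.
  - by rewrite sh // ij; case: ltnP.
  - by apply/negbTE; rewrite -leqNgt ltnW // sh // -ij; case: ltnP.
have cnt_int (k : nat) : #|[set j : 'I_n | (k <= j)%N && (j < i)%N]| = (i - k)%N.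
  rewrite -sum1dep_card -(big_ord_widen_cond n (leq k) (fun=> 1%N) (ltnW (ltn_ord i))).
  by rewrite -[RHS]muln1 -sum_nat_const_nat big_geq_mkord.
case: ifP => im.
  rewrite (cnt (fun j : 'I_n => (j < m)%N)) => [|j jm|j].
  - transitivity (i - 0)%N; last by rewrite subn0.
    rewrite -cnt_int; congr #|pred_of_set _|; apply/setP => j; rewrite !inE.
    by case: (ltnP j i); rewrite ?andbF // => /ltn_trans->.
  - by rewrite mono // im jm.
  - exact: mem_shuffle_set.
rewrite (cnt (fun j : 'I_n => (m <= j)%N)) => [|j jm|j].
- by rewrite cnt_int subnKC // leqNgt im.
- by rewrite mono // im ltnNge jm.
- by rewrite in_setC mem_shuffle_set -leqNgt.
Qed.

(** A shuffle is determined by the image of the first m positions ([shuffle_rank_perm]), and every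
    m-subset occurs, through the inverse of its [shuffle_rank]. This is the origin of the binomial
    coefficients at equal arguments. *)
Lemma card_shuffle : #|[set s : 'S_n | shuffle m s]| = 'C(n, m).
Proof.
have <- : #|[set S : {set 'I_n} | #|S| == m]| = 'C(n, m) by rewrite card_draws card_ord.
rewrite -(card_in_imset (f := shuffle_set)) => [|s s']; last first.
  rewrite !inE => sh sh' ss'; apply/permP => i.
  apply: (shuffle_rank_inj (card_shuffle_set s)).
  by rewrite {2}ss' !shuffle_rank_perm.
congr #|pred_of_set _|; apply/setP => S; rewrite inE.
apply/imsetP/eqP => [[s _ ->]|Sm]; first exact: card_shuffle_set.
pose r k := Ordinal (shuffle_rank_ord k Sm).
have rinj : injective r by move=> k l [] /(shuffle_rank_inj Sm).
pose s := (perm rinj)^-1%g.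
have rs i : shuffle_rank S (s i) = i.
  by rewrite -[RHS]/(val i) -[in RHS](permKV (perm rinj) i) permE.
have sS i : (s i \in S) = (i < m)%N by rewrite -shuffle_rank_lt // rs.
exists s; last first.
  by apply/setP => k; rewrite -(permKV s k) mem_shuffle_set sS.
rewrite inE; apply/shuffleP => i j ij jm; rewrite ltnNge leq_eqVlt; apply/negP.
case/orP => [/eqP/val_inj/perm_inj ji|lt]; first by rewrite ji ltnn in ij.
suff ijS : (s j \in S) = (s i \in S).
  by have := shuffle_rank_mono ijS lt; rewrite !rs ltnNge (ltnW ij).
rewrite !sS; case/orP: jm => [jm|mi]; first by rewrite jm (ltn_trans ij).
by rewrite !ltnNge mi (leq_trans mi (ltnW ij)).
Qed.

End CountShuffles.

(** * The Nijenhuis-Richardson product *)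

(** Whether the cut falls before or after the mark is decided once for all y, since an operator is
    compared at several values of the marked argument. *)
Lemma take_drop_mark (T : Type) i (l1 l2 : seq T) :
  (forall y : T, take i (l1 ++ y :: l2) = l1 ++ y :: take (i - (size l1).+1) l2 /\
     drop i (l1 ++ y :: l2) = drop (i - (size l1).+1) l2) /\ (size l1 < i)%N \/
  (forall y : T, take i (l1 ++ y :: l2) = take i l1 /\
     drop i (l1 ++ y :: l2) = drop i l1 ++ y :: l2) /\ (i <= size l1)%N.
Proof.
case: (ltnP (size l1) i) => li; [left|right]; split=> // y.
  by rewrite take_cat drop_cat ltnNge (ltnW li) /= -(subnSK li).
rewrite take_cat drop_cat; case: ltnP => // mb.
have -> : i = size l1 by apply/eqP; rewrite eqn_leq li.
by rewrite subnn /= ?take0 ?drop0 cats0 take_size drop_size.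
Qed.

Section KoszulSums.
Variables (K : fieldType) (V : gradedLmodType K).
Implicit Types (W : gop V) (u v : seq V -> V) (d : seq int) (a b : seq V).

Lemma homogs_perm_split n (s : 'S_n) i0 d1 d2 b1 b2 :
  (size b1 + size b2).+1 = n -> homogs d1 b1 -> homogs d2 b2 ->
  homogs (perm_before s i0 (d1 ++ 0 :: d2)) (perm_before s i0 (b1 ++ 0 :: b2)) /\
  homogs (perm_after s i0 (d1 ++ 0 :: d2)) (perm_after s i0 (b1 ++ 0 :: b2)).
Proof.
move=> sz h1 h2; have [sd h] : homogs (d1 ++ 0 :: d2) (b1 ++ 0 :: b2).
  by apply: homogs_cat => //; apply/homogs_cons; rewrite rpred0.
suff H (l : seq 'I_n) : homogs [seq (d1 ++ 0 :: d2)`_(s j) | j <- l]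
    [seq (b1 ++ 0 :: b2)`_(s j) | j <- l] by split; exact: H.
elim: l => // j l IH; apply/homogs_cons; split=> //; apply: h.
by rewrite size_cat /= addnS sz.
Qed.

Definition gop_sum n (P : pred 'S_n) W : gop V := fun d a =>
  \sum_(s : 'S_n | P s) koszul s d *: W (permseq s d) (permseq s a).

Lemma gop_sum_linear n (P : pred 'S_n) W d1 q d2 b1 b2 (k : K) x y :
  gop_linear W -> (size b1 + size b2).+1 = n -> homogs d1 b1 -> homogs d2 b2 ->
  x \in homog q -> y \in homog q ->
  gop_sum P W (d1 ++ q :: d2) (b1 ++ (k *: x + y) :: b2) =
    k *: gop_sum P W (d1 ++ q :: d2) (b1 ++ x :: b2) +
    gop_sum P W (d1 ++ q :: d2) (b1 ++ y :: b2).
Proof.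
move=> Wl sz h1 h2 xq yq; rewrite /gop_sum scaler_sumr -big_split; apply: eq_bigr => s _ /=.
have b1n : (size b1 < n)%N by rewrite -sz ltnS leq_addr.
pose i0 := (s^-1)%g (Ordinal b1n); have si0 : s i0 = size b1 :> nat by rewrite permKV.
have sd := homogs_size h1; rewrite !(permseq_split (i0 := i0)) ?sd //.
have [ha hb] := homogs_perm_split s i0 sz h1 h2.
by rewrite Wl // scalerDr !scalerA mulrC.
Qed.

Lemma gop_sum_symmetric n W d1 q r d2 b1 b2 x y :
  (size b1 + size b2).+2 = n -> homogs d1 b1 ->
  gop_sum (@predT 'S_n) W (d1 ++ q :: r :: d2) (b1 ++ x :: y :: b2) =
    (-1) ^ (q * r) *: gop_sum (@predT 'S_n) W (d1 ++ r :: q :: d2) (b1 ++ y :: x :: b2).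
Proof.
move=> sz h1; have kn : ((size b1).+1 < n)%N by rewrite -sz !ltnS leq_addr.
pose t := tperm (Ordinal (ltnW kn)) (Ordinal kn).
rewrite /gop_sum scaler_sumr [LHS](reindex_inj (mulIg t)); apply: eq_bigr => s _ /=.
rewrite (koszul_swap K kn d2 q r s (homogs_size h1)).
rewrite (permseq_swap kn d2 q r s (homogs_size h1)) (permseq_swap kn b2 x y s (erefl _)).
by rewrite scalerA mulrA signzMK mul1r.
Qed.

Lemma gop_sum_const n m W d a w : (m <= n)%N ->
  (forall s : 'S_n, koszul s d *: W (permseq s d) (permseq s a) = w) ->
  gop_sum (@shuffle n m) W d a = 'C(n, m)%:R *: w.
Proof.
move=> mn Ww; rewrite /gop_sum (eq_bigr (fun=> w)) => [|s _]; last exact: Ww.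
by rewrite sumr_const scaler_nat -(card_shuffle mn) cardsE.
Qed.

Lemma gsymmetric_gop u : gsymmetric u -> gop_symmetric (fun=> u).
Proof.
move=> us d1 q r d2 b1 b2 x y h1 h2 xq yr.
have h : homogs (d1 ++ q :: r :: d2) (b1 ++ x :: y :: b2).
  by apply: homogs_cat => //; apply/homogs_cons; split=> //; apply/homogs_cons.
set a := b1 ++ _ in h *; have sa : size a = (size b1 + size b2).+2.
  by rewrite size_cat /= !addnS.
have kn : ((size b1).+1 < size a)%N by rewrite sa !ltnS leq_addr.
pose t := tperm (Ordinal (ltnW kn)) (Ordinal kn).
rewrite (us a _ t h) -[t]mul1g -(permseq_swap kn b2 x y 1 (erefl _)).
have := koszul_swap K kn d2 q r 1 (homogs_size h1); rewrite koszul1 => kt.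
have -> : koszul (1 * t)%g (d1 ++ q :: r :: d2) = (-1) ^ (q * r) :> K.
  by apply: (mulfI (signz_neq0 K (q * r))); rewrite -kt signzMK.
by rewrite permseq1 // size_cat /= !addnS sa.
Qed.

Lemma multilinear_gop u : multilinear u -> gop_linear (fun=> u).
Proof. by move=> ul d1 q d2 b1 b2 k x y _ _ _ _; exact: ul. Qed.

Lemma multilinear0 u b : multilinear u -> 0 \in b -> u b = 0.
Proof.
move=> ul; case/splitPr => b1 b2; have := ul b1 b2 (-1) 0 0.
by rewrite scaler0 addr0 scaleN1r addNr.
Qed.

Definition nr_term u v m : gop V := fun=> fun b => u (v (take m b) :: drop m b).

Lemma nr_prod_homogE u v d a n : size a = n ->
  nr_prod_homog u v d a = \sum_(m < n.+1) gop_sum (@shuffle n m) (nr_term u v m) d a.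
Proof. by move=> <-. Qed.

(** [mlext] gives back its expression on homogeneous arguments provided that this vanishes as soon
    as an argument is 0, which multilinearity of both factors ensures. *)
Lemma nr_prodE u v d a : multilinear u -> multilinear v -> homogs d a ->
  nr_prod u v a = nr_prod_homog u v d a.
Proof.
move=> ul vl h; apply: mlextE => // e b b0.
rewrite /nr_prod_homog big1 // => m _; rewrite big1 // => s _.
have /(nthP 0)[i ib bi0] := b0; pose j := (s^-1)%g (Ordinal ib).
have : 0 \in permseq s b.
  apply/(nthP 0); exists j; rewrite ?size_permseq //.
  by rewrite nth_permseq permKV.
rewrite -{1}(cat_take_drop m (permseq s b)) mem_cat => /orP[z|z].
  by rewrite (multilinear0 vl z) (multilinear0 ul) ?mem_head // scaler0.
by rewrite (multilinear0 ul) ?scaler0 // inE z orbT.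
Qed.

Lemma nr_prod_homog_nseq u v n x :
  nr_prod_homog u v (nseq n 0) (nseq n x) =
  \sum_(m < n.+1) 'C(n, m)%:R *: u (v (nseq m x) :: nseq (n - m) x).
Proof.
rewrite (nr_prod_homogE _ _ _ (size_nseq n x)); apply: eq_bigr => m _.
apply: gop_sum_const => [|s]; first by rewrite -ltnS.
rewrite !permseq_nseq koszul_nseq0 scale1r /nr_term take_nseq ?drop_nseq //.
by rewrite -ltnS.
Qed.

(** Keeps the arities that are already known when a recursion reaches arity n. *)
Definition op_trunc n u : seq V -> V := fun a => if (size a < n)%N then u a else 0.

Lemma op_trunc_multilinear n u : multilinear u -> multilinear (op_trunc n u).
Proof.
move=> ul a b c x y; rewrite /op_trunc !size_cat /=.
by case: ifP => _; rewrite ?scaler0 ?addr0.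
Qed.

Lemma op_trunc_degree n p u : has_degree p u -> has_degree p (op_trunc n u).
Proof. by move=> ud a d h; rewrite /op_trunc; case: ifP; rewrite ?rpred0 // ud. Qed.

(* With v = Psi_1, this isolates the contribution of the component of arity n
   of u to the bracket [u, v] in arity n. *)
Lemma nr_bracket_top u v d a n (l : V) (lam : K) p :
  [/\ multilinear u, gsymmetric u & has_degree p u] -> multilinear v ->
  homogs d a -> size a = n.+1 -> v [::] = l ->
  (forall e b, homogs e b -> u (l :: b) = lam *: u b) ->
  (forall q x, x \in homog q -> v [:: x] = - x) ->
  nr_prod_homog u v d a - nr_prod_homog v u d a =
    (lam - n%:R) *: u a +
    (nr_prod_homog (op_trunc n.+1 u) v d a - nr_prod_homog v (op_trunc n.+1 u) d a).
Proof.
case=> ul us ud vl h sa vl0 u1 v1; rewrite !(nr_prod_homogE _ _ _ sa).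
have us' (s : 'S_n.+1) : koszul s d *: u (permseq s a) = u a.
  by move: s; rewrite -sa => s; rewrite -us.
have hs (s : 'S_n.+1) : homogs (permseq s d) (permseq s a) by apply: homogs_permseq.
have trunc_lt b : (size b <= n)%N -> op_trunc n.+1 u b = u b.
  by move=> bn; rewrite /op_trunc ltnS bn.
have trunc_ge b : (n < size b)%N -> op_trunc n.+1 u b = 0.
  by move=> bn; rewrite /op_trunc ltnNge bn.
(* The term m = 0 is u(l, a) = lam u(a), and each of the n.+1 shuffles for m = 1 gives -u(a).
   Truncation kills both; from m = 2 on only lower arities of u occur. *)
have -> : \sum_(m < n.+2) gop_sum (@shuffle n.+1 m) (nr_term u v m) d a =
    (lam - n.+1%:R) *: u a +
    \sum_(m < n.+2) gop_sum (@shuffle n.+1 m) (nr_term (op_trunc n.+1 u) v m) d a.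
  rewrite !big_ord_recl /= -[bump 0 0]/1%N.
  rewrite (gop_sum_const (w := lam *: u a)) // => [|s]; last first.
    rewrite /nr_term take0 drop0 vl0 (u1 _ _ (hs s)) scalerA mulrC -scalerA us' //.
  rewrite (gop_sum_const (w := - u a)) // => [|s]; last first.
    rewrite -(us' s) /nr_term; have := hs s; have := size_permseq s a.
    case: (permseq s a) => [//|x b] _; case: (permseq s d) => [[] //|q e] /homogs_cons[xq _].
    rewrite /= take0 drop0 (v1 _ _ xq) -scaleN1r.
    have u0 : u (0 :: b) = 0 by rewrite (multilinear0 ul) ?mem_head.
    have := ul [::] b (-1) x 0; rewrite addr0 /= u0 addr0 => ->.
    by rewrite scaleN1r scalerN.
  rewrite (gop_sum_const (w := 0)) // => [|s]; last first.
    rewrite /nr_term trunc_ge ?scaler0 //= drop0 size_permseq //.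
  rewrite (gop_sum_const (w := 0)) // => [|s]; last first.
    by rewrite /nr_term trunc_ge ?scaler0 //= size_drop size_permseq subn1.
  rewrite !scaler0 !add0r bin0 bin1 scale1r scalerN -scaleNr addrA -scalerDl.
  congr (_ + _); apply: eq_bigr => m _; apply: eq_bigr => s _; congr (_ *: _).
  rewrite /nr_term trunc_lt //= size_drop size_permseq subSS.
  by clear; have := ltn_ord m; rewrite /bump; lia.
(* Here u has top arity only for m = n.+1, as v(u(a)) = -u(a). In the difference this turns lam -
   n.+1 into lam - n. *)
have -> : \sum_(m < n.+2) gop_sum (@shuffle n.+1 m) (nr_term v u m) d a =
    - u a +
    \sum_(m < n.+2) gop_sum (@shuffle n.+1 m) (nr_term v (op_trunc n.+1 u) m) d a.
  rewrite big_ord_recr [in RHS]big_ord_recr /= addrC.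
  rewrite (gop_sum_const (W := nr_term v u n.+1) (w := - u a)) // => [|s]; last first.
    rewrite /nr_term take_oversize ?drop_oversize ?size_permseq //.
    have uh := ud _ _ (hs s); rewrite (v1 _ _ uh) scalerN us' //.
  rewrite (gop_sum_const (W := nr_term v (op_trunc n.+1 u) n.+1) (w := 0)) // => [|s]; last first.
    rewrite /nr_term trunc_ge ?size_take ?size_permseq ?ltnn //.
    by rewrite (multilinear0 vl) ?mem_head // scaler0.
  rewrite scaler0 addr0 binn scale1r; congr (_ + _).
  apply: eq_bigr => m _; apply: eq_bigr => s _; congr (_ *: _).
  rewrite /nr_term trunc_lt // size_take size_permseq; case: ltnP => //.
  by rewrite leqNgt ltn_ord.
rewrite opprD opprK addrACA; congr (_ + _).
by rewrite -[X in _ + X]scale1r -scalerDl mulrS; congr (_ *: _); ring.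
Qed.

End KoszulSums.

Section KoszulSumsAlgebra.
Variables (K : fieldType) (A : gradedAlgType K).
Implicit Types (W : gop A) (u v : seq A -> A) (d : seq int) (a b : seq A).

(** [W] yields the sign of passing the permuted predecessors, and [koszul_split] yields that sign
    again together with the one for the original predecessors. The former occurs twice and
    cancels. *)
Lemma gop_sum_clinear n (P : pred 'S_n) W (c : A) e p d1 q d2 b1 b2 x :
  gop_clinear c e p W -> (size b1 + size b2).+1 = n -> homogs d1 b1 ->
  homogs d2 b2 -> x \in homog q ->
  gop_sum P W (d1 ++ (e + q) :: d2) (b1 ++ (c * x) :: b2) =
    (-1) ^ (e * (p + \sum_(i <- d1) i)) *:
      (c * gop_sum P W (d1 ++ q :: d2) (b1 ++ x :: b2)).
Proof.
move=> Wc sz h1 h2 xq; rewrite /gop_sum mulr_sumr scaler_sumr; apply: eq_bigr => s _ /=.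
have b1n : (size b1 < n)%N by rewrite -sz ltnS leq_addr.
pose i0 := (s^-1)%g (Ordinal b1n); have si0 : s i0 = size b1 :> nat by rewrite permKV.
have sd := homogs_size h1; rewrite !(permseq_split (i0 := i0)) ?sd //.
have [ha hb] := homogs_perm_split s i0 sz h1 h2.
have sz' : size (d1 ++ q :: d2) = n by rewrite size_cat /= addnS sd (homogs_size h2).
have si0' : s i0 = size d1 :> nat by rewrite sd.
rewrite Wc // (koszul_split K e sz' si0').
rewrite -scalerAr !scalerA; congr (_ *: _); rewrite mulrAC; congr (_ * _).
rewrite -!signzD; set D := \sum_(i <- perm_before _ _ _) i; set S := \sum_(i <- _) i.
by apply: (@signz_mod2 _ (e * D)); ring.
Qed.

(** [gop_clinear] in a single arity k, to be proved by induction on the arity. *)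
Definition op_clinear_at (c : A) e p u k : Prop :=
  forall d1 q d2 b1 b2 (x : A), (size b1 + size b2).+1 = k ->
    homogs d1 b1 -> homogs d2 b2 -> x \in homog q ->
    u (b1 ++ (c * x) :: b2) =
      (-1) ^ (e * (p + \sum_(i <- d1) i)) *: (c * u (b1 ++ x :: b2)).

Lemma op_trunc_clinear c e p u n : (forall k, (k < n)%N -> op_clinear_at c e p u k) ->
  gop_clinear c e p (fun=> op_trunc n u).
Proof.
move=> uc d1 q d2 b1 b2 x h1 h2 xq; rewrite /op_trunc !size_cat /= addnS.
by case: ltnP => [lt|_]; [apply: uc lt _ _ _ _ _ _ _ h1 h2 xq|rewrite mulr0 scaler0].
Qed.

(** If c x is an argument of v, then c leaves v first and next leaves u from its first argument;
    otherwise it passes the value of v, whose degree is q plus that of its arguments. Both ways give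
    the sign for the degree p + q. *)
Lemma nr_term_clinear u v m (c : A) e p q :
  multilinear u -> has_degree q v ->
  gop_clinear c e p (fun=> u) -> gop_clinear c e q (fun=> v) ->
  gop_clinear c e (p + q) (nr_term u v m).
Proof.
move=> ul vd uc vc d1 r d2 b1 b2 x h1 h2 xr; rewrite /nr_term.
case: (take_drop_mark m b1 b2) => -[split bm].
  have [-> ->] := split (c * x); have [-> ->] := split x.
  have ht := homogs_take (m - (size b1).+1) h2.
  rewrite (vc _ _ _ _ _ _ h1 ht xr).
  have hv : v (b1 ++ x :: take (m - (size b1).+1) b2) \in
      homog (q + \sum_(i <- d1 ++ r :: take (m - (size b1).+1) d2) i).
    by apply: vd; apply: homogs_cat => //; apply/homogs_cons.
  move: (v _) hv => y yv; have hd := homogs_drop (m - (size b1).+1) h2.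
  have := ul [::] (drop (m - (size b1).+1) b2) ((-1) ^ (e * (q + \sum_(i <- d1) i))) (c * y) 0.
  have -> : u ([::] ++ 0 :: drop (m - (size b1).+1) b2) = 0.
    by rewrite (multilinear0 ul) ?mem_head.
  rewrite !addr0 /= => ->.
  have /= -> := uc [::] _ _ [::] _ _ (homogs_nil A) hd yv.
  rewrite big_nil scalerA addr0 -signzD; congr (_ ^ _ *: _); ring.
have [-> ->] := split (c * x); have [-> ->] := split x.
have hv := vd _ _ (homogs_take m h1).
have hh : homogs ((q + \sum_(i <- take m d1) i) :: drop m d1) (v (take m b1) :: drop m b1).
  by apply/homogs_cons; split=> //; exact: homogs_drop.
rewrite -!cat_cons (uc _ _ _ _ _ _ hh h2 xr) big_cons.
congr (_ ^ (_ * _) *: _); rewrite -!addrA; congr (_ + (_ + _)).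
by rewrite -big_cat cat_take_drop.
Qed.

Lemma nr_prod_homog_clinear u v (c : A) e p q n :
  multilinear u -> has_degree q v ->
  gop_clinear c e p (fun=> u) -> gop_clinear c e q (fun=> v) ->
  forall d1 r d2 b1 b2 x, (size b1 + size b2).+1 = n ->
    homogs d1 b1 -> homogs d2 b2 -> x \in homog r ->
    nr_prod_homog u v (d1 ++ (e + r) :: d2) (b1 ++ (c * x) :: b2) =
      (-1) ^ (e * (p + q + \sum_(i <- d1) i)) *:
      (c * nr_prod_homog u v (d1 ++ r :: d2) (b1 ++ x :: b2)).
Proof.
move=> ul vd uc vc d1 r d2 b1 b2 x sz h1 h2 xr.
rewrite !(@nr_prod_homogE _ _ _ _ _ _ n) ?size_cat /= ?addnS //.
rewrite mulr_sumr scaler_sumr; apply: eq_bigr => m _; apply: gop_sum_clinear => //.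
exact: nr_term_clinear.
Qed.

End KoszulSumsAlgebra.

(** * Affine operators *)

Section AffineOperators.
Variables (K : fieldType) (V : gradedLmodType K).
Implicit Types (u v : seq V -> V) (d : seq int) (a b : seq V) (f g : V -> V) (x y : V).

Lemma multilinearZ u a b (k : K) x : multilinear u ->
  u (a ++ (k *: x) :: b) = k *: u (a ++ x :: b).
Proof.
move=> ul; have := ul a b k x 0.
by rewrite addr0 [u (_ ++ 0 :: _)](multilinear0 ul) ?addr0 // mem_cat mem_head orbT.
Qed.

Lemma D_homog0 p : @D_homog K V p (fun=> 0).
Proof.
split=> [a b c x y|a d s _|a d _]; by rewrite ?scaler0 ?addr0 ?rpred0.
Qed.

Lemma in_D_homog p u : D_homog p u -> in_D u.
Proof.
move=> hu n; exists [:: p], (fun q => if q == p then u else fun=> 0); split=> [q|a _].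
  by case: eqP => [->//|_]; exact: D_homog0.
by rewrite big_seq1 eqxx.
Qed.

Lemma D_homog_vec p x : x \in homog p -> D_homog p (of_vec x).
Proof.
move=> xp; split=> [[|z a] b c y y'|[|z a] d s h|[|z a] [|q d] h] /=;
  rewrite ?scaler0 ?addr0 ?rpred0 ?big_nil ?addr0 //; try by case: h.
- have -> : s = 1%g by apply/permP => -[].
  by rewrite koszul1 permseq1 // scale1r.
- have := size_permseq s (z :: a); case: (permseq s (z :: a)) => // y b _.
  by rewrite scaler0.
Qed.

Lemma in_Aff_vec p x : x \in homog p -> in_Aff (of_vec x).
Proof.
by move=> xp; split=> [|[|y a] //]; exact: in_D_homog (D_homog_vec xp).
Qed.

Lemma perm_ord1 (s : 'S_1) : s = 1%g.
Proof. by apply/permP => i; rewrite !ord1. Qed.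

Lemma D_homog_end p f : is_Hom p f -> D_homog p (of_end f).
Proof.
move=> hf; have f0 := is_Hom0 hf; case: hf => fl fh; split.
- move=> [|z [|z' a]] [|y' b] c x y //=; rewrite ?scaler0 ?addr0 //; exact: fl.
- move=> [|y [|z a]] d s h /=.
  + by case: (permseq s [::]) (size_permseq s ([::] : seq V)) => //; rewrite scaler0.
  + by rewrite (perm_ord1 s) koszul1 permseq1 // scale1r.
  + have := size_permseq s [:: y, z & a]; case: (permseq s _) => // y' [|z' b] // _.
    by rewrite scaler0.
- move=> [|y [|z a]] [|q d] h; rewrite /= ?rpred0 //; first by case: h.
  by case/homogs_cons: h => yq; case: d => [|r d] [] // _ _; rewrite big_seq1 fh.
Qed.

Lemma in_Aff_end p f : is_Hom p f -> in_Aff (of_end f).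
Proof.
by move=> hf; split=> [|[|y [|z a]] //]; exact: in_D_homog (D_homog_end hf).
Qed.

Lemma is_End_Hom p f : is_Hom p f -> is_End f.
Proof.
move=> hf; exists [:: p], (fun q => if q == p then f else fun=> 0).
split=> [q|x]; last by rewrite big_seq1 eqxx.
case: eqP => [->//|_]; split=> [c x y|i x _]; last exact: rpred0.
by rewrite scaler0 addr0.
Qed.

Lemma is_Hom_id : is_Hom 0 (id : V -> V).
Proof. by split=> // i x; rewrite add0r. Qed.

Lemma mlext0 (phi : seq int -> seq V -> V) a :
  (forall d b, size b = size a -> phi d b = 0) -> mlext phi a = 0.
Proof.
elim: a phi => [|x a IH] phi h /=; first exact: h.
by rewrite big1 // => i _; apply: IH => d b sb; apply: h; rewrite /= sb.
Qed.

(** By counting there is exactly one 0-shuffle, and the identity is one. *)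
Lemma gop_sum_shuffle0 n (W : gop V) d a : size d = n -> size a = n ->
  gop_sum (@shuffle n 0) W d a = W d a.
Proof.
move=> sd sa; have := card_shuffle (leq0n n); rewrite bin0 => /eqP/cards1P[t st].
have s1 : (1%g : 'S_n) \in [set s : 'S_n | shuffle 0 s].
  by rewrite inE; apply/(shuffleP 0) => i j ij _; rewrite !perm1.
have sE s : shuffle 0 s = (s == t) by have := in_set1 s t; rewrite -st inE.
rewrite /gop_sum (big_pred1 t) //.
by move: s1; rewrite st inE => /eqP<-; rewrite koszul1 !permseq1 // scale1r.
Qed.

Lemma nr_prod_homog_eq0 u v d a :
  (forall m b, size b = size a -> (m <= size b)%N -> u (v (take m b) :: drop m b) = 0) ->
  nr_prod_homog u v d a = 0.
Proof.
move=> h; rewrite /nr_prod_homog big1 // => m _; rewrite big1 // => s _.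
by rewrite h ?scaler0 // size_permseq // -ltnS.
Qed.

Lemma nr_prod_nil u v : nr_prod u v [::] = u [:: v [::]].
Proof.
have /= := nr_prod_homog_nseq u v 0 0; rewrite /nr_prod /= => ->.
by rewrite big_ord1 bin0 scale1r.
Qed.

Lemma nr_prod_homog1 u v d x :
  nr_prod_homog u v d [:: x] = u [:: v [::]; x] + u [:: v [:: x]].
Proof.
have E m : (m <= 1)%N ->
    gop_sum (@shuffle 1 m) (nr_term u v m) d [:: x] = nr_term u v m d [:: x].
  move=> m1; rewrite (gop_sum_const (w := nr_term u v m d [:: x])) // => [|s].
    by case: m m1 => [|[|]] // _; rewrite scale1r.
  by rewrite (perm_ord1 s) koszul1 scale1r (@permseq1 1 V [:: x]).
by rewrite (@nr_prod_homogE _ _ _ _ _ _ 1) // big_ord_recl big_ord1 !E.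
Qed.

Lemma nr_prod_vec x v a : nr_prod (of_vec x) v a = 0.
Proof. by apply: mlext0 => d b _; apply: nr_prod_homog_eq0. Qed.

Lemma nr_prod_end_vec f x a : f 0 = 0 -> nr_prod (of_end f) (of_vec x) a = of_vec (f x) a.
Proof.
move=> f0; case: a => [|y a]; first by rewrite nr_prod_nil.
apply: mlext0 => d b sb; apply: nr_prod_homog_eq0 => -[|m] [|z c] //= sc.
  by move: sc; rewrite sb.
by move=> _; case: (drop m c).
Qed.

Lemma nr_prod_end_end f g a : linear f -> linear g ->
  nr_prod (of_end f) (of_end g) a = of_end (f \o g) a.
Proof.
move=> fl gl; have lin0 (h : V -> V) : linear h -> h 0 = 0.
  by move=> hl; have := hl (-1) 0 0; rewrite scaler0 addr0 scaleN1r addNr.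
have f0 := lin0 _ fl; have g0 := lin0 _ gl.
case: a => [|y [|z a]]; first by rewrite nr_prod_nil.
  rewrite /nr_prod /=; under eq_bigr => i _ do rewrite nr_prod_homog1 /= add0r.
  have lsum (h : V -> V) (r : seq int) (F : int -> V) : linear h ->
      \sum_(i <- r) h (F i) = h (\sum_(i <- r) F i).
    move=> hl; elim: r => [|i r IH]; first by rewrite !big_nil lin0.
    by rewrite !big_cons IH -[F i in RHS]scale1r hl scale1r.
  by rewrite !lsum // -gsuppE.
apply: mlext0 => d b sb; apply: nr_prod_homog_eq0 => m c sc mc.
have s2 : (1 < size c)%N by rewrite sc sb.
case E: (drop m c) => [|x [|x' e]] //=.
have cm : size c = m.
  by apply/eqP; rewrite eqn_leq mc andbT -subn_eq0 -size_drop E.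
have : size (take m c) = size c by rewrite -cm take_size.
case: (take m c) => [|t [|t' e]] //= st; by rewrite -st in s2.
Qed.

Lemma nr_bracket_vec_vec p q x y : nr_bracket p q (of_vec x) (of_vec y) = (fun=> 0 : V).
Proof. by apply: funext => a; rewrite /nr_bracket !nr_prod_vec scaler0 subr0. Qed.

Lemma nr_bracket_end_vec p q f x : f 0 = 0 ->
  nr_bracket p q (of_end f) (of_vec x) = of_vec (f x).
Proof.
move=> f0; apply: funext => a.
by rewrite /nr_bracket nr_prod_vec scaler0 subr0 nr_prod_end_vec.
Qed.

Lemma nr_bracket_id_end p f : linear f ->
  nr_bracket 0 p (of_end id) (of_end f) = (fun=> 0 : V).
Proof.
move=> fl; apply: funext => a; rewrite /nr_bracket !nr_prod_end_end //.
by rewrite mul0r expr0z scale1r subrr.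
Qed.

Lemma nr_bracketE p q u v d a : multilinear u -> multilinear v -> homogs d a ->
  nr_bracket p q u v a =
  nr_prod_homog u v d a - (-1) ^ (p * q) *: nr_prod_homog v u d a.
Proof. by move=> ul vl h; rewrite /nr_bracket !(@nr_prodE _ _ _ _ d). Qed.

End AffineOperators.

(** The axioms let c leave on the right of the last argument. By induction on the number of
    arguments behind c x, graded symmetry moves c x to the end; c then returns to the front across
    the value of u. *)
Lemma gop_clinear_right (K : fieldType) (A : gradedAlgType K) (u : seq A -> A) (c : A) e :
  c \in homog e ->
  (forall j (a : A), a \in homog j -> a * c = (-1) ^ (j * e) *: (c * a)) ->
  D_homog 0 u -> (forall s a, u (rcons s (a * c)) = u (rcons s a) * c) ->
  gop_clinear c e 0 (fun=> u).
Proof.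
move=> ce cc [ul us ud] uc d1 q d2 b1 b2 x h1 h2 xq.
have cx : c * x = (-1) ^ (q * e) *: (x * c).
  by rewrite (cc _ _ xq) scalerA signzMK scale1r.
elim: b2 d2 b1 d1 h1 h2 => [|y b2 IH] [|r d2] b1 d1 h1 //= h2; try by case: h2.
  have hx : homogs (rcons d1 q) (rcons b1 x).
    by rewrite -!cats1; apply: homogs_cat => //; apply/homogs_cons.
  rewrite cx multilinearZ //.
  rewrite !cats1 uc (cc _ _ (ud _ _ hx)) scalerA -signzD; congr (_ *: _).
  rewrite add0r -cats1 big_cat big_seq1 /=; set D := \sum_(i <- _) i.
  by apply: (@signz_mod2 _ (q * e)); ring.
case/homogs_cons: h2 => yr h2.
have xc : c * x \in homog (e + q) by rewrite homogM.
have sw := gsymmetric_gop us.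
rewrite (sw _ _ _ _ _ _ _ _ h1 h2 xc yr) (sw _ _ _ _ _ _ _ _ h1 h2 xq yr).
have h1' : homogs (rcons d1 r) (rcons b1 y).
  by rewrite -!cats1; apply: homogs_cat => //; apply/homogs_cons.
have := IH _ _ _ h1' h2; rewrite !cat_rcons => ->.
rewrite -scalerAr !scalerA -!signzD; congr (_ *: _).
rewrite -cats1 big_cat big_seq1 /=; set D := \sum_(i <- _) i.
by apply: (@signz_mod2 _ (e * r)); ring.
Qed.

(** * Brackets with Psi_1 and Psi_Id *)

Section BaseInclusion.
Variables (K : fieldType) (A : gradedAlgType K).

Definition base_in (k : K^o) : A := @GRing.scale K A k 1.

Fact base_in_linear : linear base_in.
Proof. by move=> c k l; rewrite /base_in scalerDl scalerA. Qed.

HB.instance Definition _ := GRing.isLinear.Build K K^o A *:%R base_in base_in_linear.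

Fact base_in_monoid_morphism : monoid_morphism base_in.
Proof.
by split=> [|k l]; rewrite /base_in ?scale1r // -scalerAl mul1r scalerA.
Qed.

HB.instance Definition _ :=
  GRing.isMonoidMorphism.Build K^o A base_in base_in_monoid_morphism.

Lemma base_in_graded : graded_morphism base_in.
Proof.
move=> i x; rewrite inE /gproj /= /base_proj => /eqP<-; rewrite /base_in.
by case: eqP => [->|_]; rewrite ?scale0r ?rpred0 // rpredZ // homog1.
Qed.

End BaseInclusion.

Section KoszulBrackets.
Variables (K : fieldType) (charK : [pchar K] =i pred0).
Variable (Psi : assignment K) 
  (hPsi : koszul_brackets Psi).

Section FixedAlgebra.
Variable A : gradedAlgType K.
Implicit Types (d : seq int) (a b : seq A) (x y : A) (f : A -> A).

Lemma Psi_vec_D p x : x \in homog p -> D_homog p (Psi (of_vec x)).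
Proof. by move=> xp; apply: Psi_degree (in_Aff_vec xp) (D_homog_vec xp). Qed.

Lemma Psi_end_D p f : is_Hom p f -> D_homog p (Psi (of_end f)).
Proof. by move=> hf; apply: Psi_degree (in_Aff_end hf) (D_homog_end hf). Qed.

Lemma Psi_0 a : Psi (fun=> 0 : A) a = 0.
Proof.
have h : in_Aff (of_vec (0 : A)) by apply: (@in_Aff_vec _ _ 0); rewrite rpred0.
have := Psi_linear hPsi (-1) a h h; rewrite scaleN1r addNr => e; rewrite -[RHS]e.
by congr (@Psi A _ _); apply: funext => b; rewrite scaleN1r addNr.
Qed.

Lemma D_homog_gop p (u : seq A -> A) : D_homog p u ->
  gop_linear (fun=> u) /\ gop_symmetric (fun=> u).
Proof. by case=> ul us _; split; [exact: multilinear_gop|exact: gsymmetric_gop]. Qed.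

(** The ones come from K, where the normalization makes [Psi_Id] vanish in positive arity. *)
Lemma Psi_id_ones (n : nat) : Psi (of_end id) (nseq n.+1 (1 : A)) = 0.
Proof.
have h B := is_End_Hom (@is_Hom_id K B).
have E (x : K^o) : id (base_in A x) = base_in A (id x) by [].
have := Psi_natural_end hPsi (nseq n.+1 1) (@base_in_graded _ A) (h _) (h _) E.
by rewrite map_nseq rmorph1 (Psi_base hPsi) // rmorph0 => <-.
Qed.

End FixedAlgebra.

Lemma adjoin_in_graded (A : gradedAlgType K) e : graded_morphism (@adjoin_in K A e).
Proof. by move=> i x; rewrite adjoin_in_homog. Qed.

Lemma gop_clinear_nseq (A : gradedAlgType K) (u : seq A -> A) (c : A) n :
  c \in homog 0 -> gop_clinear c 0 0 (fun=> u) ->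
  u (nseq n c) = c ^+ n * u (nseq n 1).
Proof.
move=> c0 uc; suff H k j : u (nseq j 1 ++ nseq k c) = c ^+ k * u (nseq (j + k) 1).
  exact: (H n 0).
elim: k j => [|k IH] j; first by rewrite cats0 addn0 mul1r.
have := uc _ 0 _ _ _ 1 (homogs_nseq j (@homog1 K A)) (homogs_nseq k c0) (@homog1 K A).
rewrite mulr1 mul0r expr0z scale1r /= => ->.
have := IH j.+1; rewrite -[j.+1]addn1 nseqD -catA /= => ->.
by rewrite exprS mulrA -addnA add1n.
Qed.

Lemma polyX_central : forall j (a : {poly K}), a \in homog j ->
  a * 'X = (-1) ^ (j * 0) *: ('X * a).
Proof. by move=> j a _; rewrite mulr0 expr0z scale1r mulrC. Qed.

Lemma polyX_homog : ('X : {poly K}) \in homog (0 : int).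
Proof. by rewrite poly_homog. Qed.

Lemma Psi_id_clinear (A : gradedAlgType K) (c : A) e : c \in homog e ->
  (forall j (a : A), a \in homog j -> a * c = (-1) ^ (j * e) *: (c * a)) ->
  gop_clinear c e 0 (fun=> Psi (of_end (id : A -> A))).
Proof.
move=> ce cc; apply: gop_clinear_right => // [|s a]; first exact: Psi_end_D (@is_Hom_id K A).
by apply: Psi_central_id => //; exists e.
Qed.

Lemma Psi_1_clinear (A : gradedAlgType K) (c : A) e : c \in homog e ->
  (forall j (a : A), a \in homog j -> a * c = (-1) ^ (j * e) *: (c * a)) ->
  gop_clinear c e 0 (fun=> Psi (of_vec (1 : A))).
Proof.
move=> ce cc; apply: gop_clinear_right => // [|s a]; first exact: Psi_vec_D (@homog1 K A).
by apply: Psi_central_1 => //; exists e.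
Qed.

Lemma Psi_id_nseq (A : gradedAlgType K) (a : A) n : a \in homog 0 ->
  Psi (of_end id) (nseq n.+1 a) = 0.
Proof.
move=> a0; have h B := is_End_Hom (@is_Hom_id K B).
have E (x : {poly K}) : id (poly_eval a x) = poly_eval a (id x) by [].
have := Psi_natural_end hPsi (nseq n.+1 'X) (poly_eval_graded a0) (h _) (h _) E.
rewrite map_nseq /= poly_evalX => <-; rewrite -['X :: _]/(nseq n.+1 'X).
rewrite (gop_clinear_nseq (u := Psi (of_end id)) _ polyX_homog); last first.
  exact: Psi_id_clinear polyX_homog polyX_central.
by rewrite Psi_id_ones mulr0 rmorph0.
Qed.

Lemma Psi_id_eq0 (A : gradedAlgType K) d (a : seq A) : homogs d a -> (0 < size a)%N ->
  Psi (of_end id) a = 0.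
Proof.
(* Polarization asks for vanishing in arity 0 as well, where [Psi_Id] is 1; that component is
   replaced by 0. *)
pose W (B : gradedAlgType K) : gop B :=
  fun _ b => if b is [::] then 0 else Psi (of_end id) b.
have WE (B : gradedAlgType K) e (b1 b2 : seq B) x :
      W B e (b1 ++ x :: b2) = Psi (of_end id) (b1 ++ x :: b2).
  by case: b1.
move=> h a0; suff : W A d a = 0 by case: (a) a0.
apply: (@gop_polarize K (fun B V => V = W B) 0 charK _ _ _ A _ d a erefl h).
- move=> B _ ->; have [l s] := D_homog_gop (Psi_end_D (@is_Hom_id K B)).
  split=> [d1 q d2 b1 b2 k x y h1 h2 xq yq|d1 q r d2 b1 b2 x y h1 h2 xq yr].
    by rewrite !WE; exact: (l _ _ _ _ _ _ _ _ h1 h2 xq yq).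
  by rewrite !WE; exact: (s _ _ _ _ _ _ _ _ h1 h2 xq yr).
- move=> B _ e ->; exists (W (adjoin B e)); split=> //.
    move=> d1 q d2 b1 b2 x h1 h2 xq; rewrite !WE.
    exact: (Psi_id_clinear (adjoin_eps_homog B e) (@adjoin_eps_comm _ B e) h1 h2 xq).
  move=> _ [|x b] _ /=; first by rewrite rmorph0.
  have hh C := is_End_Hom (@is_Hom_id K C).
  have E (z : B) : id (adjoin_in e z) = adjoin_in e (id z) by [].
  by rewrite (Psi_natural_end hPsi (x :: b) (@adjoin_in_graded B e) (hh _) (hh _) E).
by move=> B _ x [|n] -> x0 //=; exact: Psi_id_nseq.
Qed.

Section Recursion.
Variable A : gradedAlgType K.
Implicit Types (d : seq int) (a b : seq A) (x y : A) (f : A -> A) (u v : seq A -> A).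

(** By [Psi_id_eq0] the image of [Id] is the vector 1, which contributes nothing as a left
    factor. *)
Lemma nr_prod_id_left q v d a : has_degree q v -> homogs d a ->
  nr_prod_homog (Psi (of_end id)) v d a = 0.
Proof.
move=> vd h; rewrite /nr_prod_homog big1 // => m _; rewrite big1 // => s _.
have hs := homogs_permseq s erefl h.
have hh : homogs ((q + \sum_(i <- take m (permseq s d)) i) :: drop m (permseq s d))
    (v (take m (permseq s a)) :: drop m (permseq s a)).
  by apply/homogs_cons; split; [exact/vd/homogs_take|exact: homogs_drop].
by rewrite (Psi_id_eq0 hh) ?scaler0.
Qed.

(** As a right factor the vector 1 leaves only the term m = 0, the insertion of 1. *)
Lemma nr_prod_id_right u d a : multilinear u -> homogs d a ->
  nr_prod_homog u (Psi (of_end id)) d a = u (1 :: a).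
Proof.
move=> ul h; rewrite (@nr_prod_homogE _ _ _ _ _ _ (size a)) // big_ord_recl big1 => [|m _].
  rewrite addr0 gop_sum_shuffle0 ?(homogs_size h) // /nr_term take0 drop0.
  by rewrite (Psi0_end hPsi) //; exact: is_End_Hom (@is_Hom_id K A).
rewrite /gop_sum big1 // => s _; rewrite /nr_term.
rewrite (Psi_id_eq0 (homogs_take _ (homogs_permseq s erefl h))).
  by rewrite (multilinear0 ul) ?mem_head // scaler0.
by rewrite size_take size_permseq /bump /=; case: ifP => // _; have := ltn_ord m; lia.
Qed.

(** From [Id, x] = x: the bracket with the vector 1 on the left is minus the insertion of 1. *)
Lemma Psi_vec_unit p x d a : x \in homog p -> homogs d a ->
  Psi (of_vec x) (1 :: a) = - Psi (of_vec x) a.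
Proof.
move=> xp h; have hid := @is_Hom_id K A.
have := Psi_bracket hPsi a (in_Aff_end hid) (in_Aff_vec xp) (D_homog_end hid) (D_homog_vec xp).
rewrite nr_bracket_end_vec //.
have [idl _ idd] := Psi_end_D hid; have [xl _ xd] := Psi_vec_D xp.
rewrite (nr_bracketE _ _ idl xl h) (nr_prod_id_left xd h) (nr_prod_id_right xl h).
by rewrite mul0r expr0z scale1r add0r => ->; rewrite opprK.
Qed.

(** From [Id, f] = 0, in the same way. *)
Lemma Psi_end_unit p f d a : is_Hom p f -> homogs d a ->
  Psi (of_end f) (1 :: a) = 0.
Proof.
move=> hf h; have hid := @is_Hom_id K A; have [fl _] := hf.
have := Psi_bracket hPsi a (in_Aff_end hid) (in_Aff_end hf) (D_homog_end hid) (D_homog_end hf).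
rewrite nr_bracket_id_end // Psi_0.
have [idl _ idd] := Psi_end_D hid; have [ul _ ud] := Psi_end_D hf.
rewrite (nr_bracketE _ _ idl ul h) (nr_prod_id_left ud h) (nr_prod_id_right ul h).
by rewrite mul0r expr0z scale1r add0r => /eqP; rewrite eq_sym oppr_eq0 => /eqP.
Qed.

Lemma Psi_vec_1_bracket p x d a : x \in homog p -> homogs d a ->
  nr_prod_homog (Psi (of_vec x)) (Psi (of_vec 1)) d a -
  nr_prod_homog (Psi (of_vec 1)) (Psi (of_vec x)) d a = 0.
Proof.
move=> xp h; have h1 := @homog1 K A.
have := Psi_bracket hPsi a (in_Aff_vec xp) (in_Aff_vec h1) (D_homog_vec xp) (D_homog_vec h1).
rewrite nr_bracket_vec_vec Psi_0.
have [l1 _ _] := Psi_vec_D h1; have [xl _ _] := Psi_vec_D xp.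
by rewrite (nr_bracketE _ _ xl l1 h) mulr0 expr0z scale1r.
Qed.

Lemma Psi_end_vec_bracket p q f x d a : is_Hom p f -> x \in homog q -> homogs d a ->
  nr_prod_homog (Psi (of_end f)) (Psi (of_vec x)) d a -
  (-1) ^ (p * q) *: nr_prod_homog (Psi (of_vec x)) (Psi (of_end f)) d a =
  Psi (of_vec (f x)) a.
Proof.
move=> hf xq h.
have := Psi_bracket hPsi a (in_Aff_end hf) (in_Aff_vec xq) (D_homog_end hf) (D_homog_vec xq).
rewrite nr_bracket_end_vec ?(is_Hom0 hf) // => ->.
have [l1 _ _] := Psi_end_D hf; have [xl _ _] := Psi_vec_D xq.
by rewrite (nr_bracketE _ _ l1 xl h).
Qed.

Lemma nr_prod_homog_nil u v : nr_prod_homog u v [::] [::] = u [:: v [::]].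
Proof. by have /= := nr_prod_homog_nseq u v 0 0; rewrite big_ord1 bin0 scale1r. Qed.

(** Arity 0 of [x, 1] = 0 reads Psi_x(1) = Psi_1(x), and Psi_x(1) = -x by [Psi_vec_unit]. *)
Lemma Psi_1_arity1 q x : x \in homog q -> Psi (of_vec 1) [:: x] = - x.
Proof.
move=> xq; have := Psi_vec_1_bracket xq (homogs_nil A).
rewrite !nr_prod_homog_nil !(Psi0_vec hPsi) (Psi_vec_unit xq (homogs_nil A)).
by rewrite (Psi0_vec hPsi) => /eqP; rewrite subr_eq0 => /eqP.
Qed.

Lemma Psi_1_ones n : Psi (of_vec 1) (nseq n (1 : A)) = (-1) ^+ n.
Proof.
elim: n => [|n IH]; first by rewrite (Psi0_vec hPsi).
by rewrite /= (Psi_vec_unit (@homog1 K A) (homogs_nseq n (@homog1 K A))) IH exprS mulN1r.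
Qed.

(** [nr_bracket_top] with lam = -1, by [Psi_vec_unit]. The factor n.+1 is invertible, so [x, 1] = 0
    determines every positive arity of Psi_x. *)
Lemma Psi_vec_rec p x d a n : x \in homog p -> homogs d a -> size a = n.+1 ->
  n.+1%:R *: Psi (of_vec x) a =
  nr_prod_homog (op_trunc n.+1 (Psi (of_vec x))) (Psi (of_vec 1)) d a -
  nr_prod_homog (Psi (of_vec 1)) (op_trunc n.+1 (Psi (of_vec x))) d a.
Proof.
move=> xp h sa; have [l1 _ _] := Psi_vec_D (@homog1 K A).
have := Psi_vec_1_bracket xp h.
rewrite (nr_bracket_top (lam := -1) (Psi_vec_D xp) l1 h sa (Psi0_vec hPsi 1))
  => [|e b hb|q y]; last 2 first.
- by rewrite (Psi_vec_unit xp hb) scaleN1r.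
- exact: Psi_1_arity1.
move/eqP; rewrite addr_eq0 => /eqP e; rewrite -[RHS]opprK -e -scaleNr.
by congr (_ *: _); rewrite -natr1; ring.
Qed.

(** Here lam = 0 by [Psi_end_unit], and [f, 1] = f 1 supplies the inhomogeneous term. In arity 1 the
    factor n is 0 and the component of Psi_f drops out. *)
Lemma Psi_end_rec p f d a n : is_Hom p f -> homogs d a -> size a = n.+1 ->
  n%:R *: Psi (of_end f) a =
  nr_prod_homog (op_trunc n.+1 (Psi (of_end f))) (Psi (of_vec 1)) d a -
  nr_prod_homog (Psi (of_vec 1)) (op_trunc n.+1 (Psi (of_end f))) d a -
  Psi (of_vec (f 1)) a.
Proof.
move=> hf h sa; have [l1 _ _] := Psi_vec_D (@homog1 K A).
have := Psi_end_vec_bracket hf (@homog1 K A) h; rewrite mulr0 expr0z scale1r => <-.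
rewrite (nr_bracket_top (lam := 0) (Psi_end_D hf) l1 h sa (Psi0_vec hPsi 1))
  => [|e b hb|q y]; last 2 first.
- by rewrite (Psi_end_unit hf hb) scale0r.
- exact: Psi_1_arity1.
by rewrite sub0r scaleNr opprD opprK addrCA subrr addr0.
Qed.

Lemma Psi_vec_arity1 p q x y : x \in homog p -> y \in homog q ->
  Psi (of_vec x) [:: y] = - Psi (of_vec 1) [:: x; y].
Proof.
move=> xp yq; have h : homogs [:: q] [:: y] by apply/homogs_cons.
have := Psi_vec_rec xp h (erefl _); rewrite scale1r => ->.
rewrite !nr_prod_homog1 /op_trunc /= (Psi0_vec hPsi).
have [l1 _ _] := Psi_vec_D (@homog1 K A).
by rewrite (multilinear0 (b := [:: 0]) l1) ?mem_head // !addr0 sub0r.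
Qed.

(* Psi_f is only determined up to a linear term by the brackets with Psi_1 and
   Psi_Id; the brackets with Psi_x for all x fix that term. *)
Lemma Psi_end_arity1 p q f y : is_Hom p f -> y \in homog q ->
  Psi (of_end f) [:: y] = f y + Psi (of_vec (f 1)) [:: y].
Proof.
move=> hf yq; have fe : is_End f := is_End_Hom hf.
have f1p := is_Hom_1 hf.
have := Psi_end_vec_bracket hf yq (homogs_nil A).
rewrite !nr_prod_homog_nil !(Psi0_vec hPsi) (Psi0_end hPsi) // => <-.
(* Both arity 1 values are values of [Psi_1] in arity 2, whose graded symmetry identifies (-1)^(p q)
   Psi_y(f 1) with Psi_(f 1)(y). *)
rewrite (Psi_vec_arity1 f1p yq) (Psi_vec_arity1 yq f1p).
have [_ s1 _] := Psi_vec_D (@homog1 K A).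
have := gsymmetric_gop s1 (homogs_nil A) (homogs_nil A) f1p yq => /= ->.
by rewrite scalerN opprK addrK.
Qed.

End Recursion.

End KoszulBrackets.

(** * Symmetrized words *)

Section Words.
Variable K : fieldType.

Definition gop_symm (V : gradedLmodType K) (W : gop V) : gop V :=
  fun d a => gop_sum (@predT 'S_(size a)) W d a.

Lemma gop_symmE (V : gradedLmodType K) (W : gop V) n d a : size a = n ->
  gop_symm W d a = gop_sum (@predT 'S_n) W d a.
Proof. by move=> <-. Qed.

Lemma gop_symm_linear (V : gradedLmodType K) (W : gop V) :
  gop_linear W -> gop_linear (gop_symm W).
Proof.
move=> Wl d1 q d2 b1 b2 k x y h1 h2 xq yq.
rewrite !(@gop_symmE _ _ (size b1 + size b2).+1) ?size_cat /= ?addnS //.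
exact: gop_sum_linear.
Qed.

Lemma gop_symm_symmetric (V : gradedLmodType K) (W : gop V) : gop_symmetric (gop_symm W).
Proof.
move=> d1 q r d2 b1 b2 x y h1 h2 xq yr.
rewrite !(@gop_symmE _ _ (size b1 + size b2).+2) ?size_cat /= ?addnS //.
exact: gop_sum_symmetric.
Qed.

Lemma gop_symm_nseq (V : gradedLmodType K) (W : gop V) n x :
  gop_symm W (nseq n 0) (nseq n x) = n`!%:R *: W (nseq n 0) (nseq n x).
Proof.
rewrite (@gop_symmE _ _ n) ?size_nseq // /gop_sum.
under eq_bigr => s _ do rewrite !permseq_nseq koszul_nseq0 scale1r.
by rewrite sumr_const card_Sn scaler_nat.
Qed.

Variable A : gradedAlgType K.
Implicit Types (W : gop A) (d : seq int) (a b : seq A) (x y c : A) (f : A -> A).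

Lemma gop_symm_clinear W c e p : gop_clinear c e p W -> gop_clinear c e p (gop_symm W).
Proof.
move=> Wc d1 q d2 b1 b2 x h1 h2 xq.
rewrite !(@gop_symmE _ _ (size b1 + size b2).+1) ?size_cat /= ?addnS //.
exact: gop_sum_clinear.
Qed.

Definition gop_prod : gop A := fun _ a => \prod_(b <- a) b.

(** The sign is that of W2, of degree p, passing the arguments of W1. *)
Definition gop_cat i p W1 W2 : gop A := fun d a =>
  (-1) ^ (p * \sum_(j <- take i d) j) *:
  (W1 (take i d) (take i a) * W2 (drop i d) (drop i a)).

Lemma gop_prod_linear : gop_linear gop_prod.
Proof.
move=> d1 q d2 b1 b2 k x y h1 h2 xq yq; rewrite /gop_prod !big_cat !big_cons /=.
by rewrite mulrDl mulrDr -scalerAl -scalerAr.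
Qed.

Lemma gop_prod_degree d a : homogs d a -> gop_prod d a \in homog (\sum_(i <- d) i).
Proof.
elim: a d => [|x a IH] [|q d] //; try by case.
  by rewrite /gop_prod !big_nil homog1.
by case/homogs_cons=> xq /IH h; rewrite /gop_prod !big_cons homogM.
Qed.

Variables (c : A) (e : int).
Hypothesis (cc : forall j (a : A), a \in homog j -> a * c = (-1) ^ (j * e) *: (c * a)).

Lemma gop_prod_clinear : gop_clinear c e 0 gop_prod.
Proof.
move=> d1 q d2 b1 b2 x h1 h2 xq; rewrite /gop_prod !big_cat !big_cons /=.
rewrite !mulrA (cc (gop_prod_degree h1)) add0r [e * _]mulrC.
by rewrite -!scalerAl.
Qed.

Lemma gop_cat_linear i p W1 W2 : gop_linear W1 -> gop_linear W2 ->
  gop_linear (gop_cat i p W1 W2).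
Proof.
move=> l1 l2 d1 q d2 b1 b2 k x y h1 h2 xq yq; rewrite /gop_cat.
have sd := homogs_size h1; have ht := homogs_take (i - (size b1).+1) h2.
case: (take_drop_mark i b1 b2) => -[E lt]; case: (take_drop_mark i d1 d2) => -[F]; rewrite sd => lt'.
- have [-> ->] := E (k *: x + y); have [-> ->] := E x; have [-> ->] := E y; have [-> ->] := F q.
  rewrite sd l1 // mulrDl scalerDr -scalerAl; congr (_ + _).
  by rewrite !scalerA mulrC.
- by move: lt'; rewrite leqNgt lt.
- by move: lt'; rewrite ltnNge lt.
have [-> ->] := E (k *: x + y); have [-> ->] := E x; have [-> ->] := E y; have [-> ->] := F q.
rewrite l2 //; last exact: homogs_drop.
by rewrite mulrDr scalerDr -scalerAr; congr (_ + _); rewrite !scalerA mulrC.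
Qed.

Lemma gop_cat_clinear i p1 p2 W1 W2 :
  gop_degree p1 W1 -> gop_clinear c e p1 W1 -> gop_clinear c e p2 W2 ->
  gop_clinear c e (p1 + p2) (gop_cat i p2 W1 W2).
Proof.
move=> g1 l1 l2 d1 q d2 b1 b2 x h1 h2 xq; rewrite /gop_cat.
have sd := homogs_size h1; have ht := homogs_take (i - (size b1).+1) h2.
case: (take_drop_mark i b1 b2) => -[E lt]; case: (take_drop_mark i d1 d2) => -[F]; rewrite sd => lt'.
- have [-> ->] := E (c * x); have [-> ->] := E x; have [-> ->] := F q; have [-> ->] := F (e + q).
  rewrite sd l1 // -scalerAl -!scalerAr !scalerA -!signzD mulrA; congr (_ *: _).
  rewrite !big_cat !big_cons /=; set D := \sum_(j <- d1) j; set D' := \sum_(j <- take _ _) j.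
  by apply: (@signz_mod2 _ 0); ring.
- by move: lt'; rewrite leqNgt lt.
- by move: lt'; rewrite ltnNge lt.
have [-> ->] := E (c * x); have [-> ->] := E x; have [-> ->] := F q; have [-> ->] := F (e + q).
have hi := homogs_take i h1.
rewrite l2 //; last exact: homogs_drop.
rewrite -scalerAr mulrA (cc (g1 _ _ hi)) -scalerAl -!scalerAr !scalerA -!signzD mulrA.
congr (_ *: _); have -> : \sum_(j <- d1) j = \sum_(j <- take i d1) j + \sum_(j <- drop i d1) j.
  by rewrite -big_cat cat_take_drop.
set D := \sum_(j <- take _ _) j; set D' := \sum_(j <- drop _ _) j.
by apply: (@signz_mod2 _ 0); ring.
Qed.

Definition gop_vec_prod x : gop A := fun _ a => x * \prod_(b <- a) b.

Lemma gop_vec_prod_linear x : gop_linear (gop_vec_prod x).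
Proof.
move=> d1 q d2 b1 b2 k y z h1 h2 yq zq; rewrite /gop_vec_prod.
have := gop_prod_linear k h1 h2 yq zq; rewrite /gop_prod => ->.
by rewrite mulrDr scalerAr.
Qed.

Lemma gop_vec_prod_clinear x p : x \in homog p -> gop_clinear c e p (gop_vec_prod x).
Proof.
move=> xp d1 q d2 b1 b2 y h1 h2 yq; rewrite /gop_vec_prod.
have := gop_prod_clinear h1 h2 yq; rewrite /gop_prod => ->.
rewrite -scalerAr !mulrA (cc xp) -scalerAl scalerA -signzD; congr (_ *: _).
by set D := \sum_(j <- _) j; apply: (@signz_mod2 _ 0); ring.
Qed.

Definition gop_end_prod f : gop A := fun _ a => f (1 * \prod_(b <- a) b).

Lemma gop_end_prod_linear p f : is_Hom p f -> gop_linear (gop_end_prod f).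
Proof.
case=> fl _ d1 q d2 b1 b2 k y z h1 h2 yq zq; rewrite /gop_end_prod !mul1r.
by have := gop_prod_linear k h1 h2 yq zq; rewrite /gop_prod => ->; rewrite fl.
Qed.

Lemma gop_end_prod_degree p f : is_Hom p f -> gop_degree p (gop_end_prod f).
Proof.
by case=> _ fh d a h; rewrite /gop_end_prod mul1r; apply: fh; exact: gop_prod_degree.
Qed.

Lemma gop_end_prod_clinear p f : is_Hom p f ->
  (forall x, f (c * x) = (-1) ^ (e * p) *: (c * f x)) ->
  gop_clinear c e p (gop_end_prod f).
Proof.
move=> hf fc d1 q d2 b1 b2 y h1 h2 yq; rewrite /gop_end_prod !mul1r.
have := gop_prod_clinear h1 h2 yq; rewrite /gop_prod => ->.
rewrite (is_HomZ _ _ hf) fc scalerA -signzD; congr (_ *: _).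
by set D := \sum_(j <- _) j; apply: (@signz_mod2 _ 0); ring.
Qed.

End Words.

Section BernoulliWords.
Variables (K : fieldType).

Section Def.
Variable A : gradedAlgType K.

(** The claimed formula before symmetrization. Each summand is linear over graded central elements,
    and symmetrization keeps that. *)
Definition vec_word p (x : A) : gop A := fun d a =>
  \sum_(i < (size a).+1) \sum_(j < (size a).+1 | (i + j == size a)%N)
    (bernoulli2 K i j / (i`!%:R * j`!%:R)) *: gop_cat i p (@gop_prod K A) (gop_vec_prod x) d a.

Definition end_word p (f : A -> A) : gop A := fun d a =>
  \sum_(i < (size a).+1) \sum_(j < (size a).+1) \sum_(k < (size a).+1 | (i + j + k == size a)%N)
    (bernoulli2 K i j / (i`!%:R * j`!%:R * k`!%:R)) *:
      gop_cat i p (@gop_prod K A) (gop_cat k 0 (gop_end_prod f) (@gop_prod K A)) d a.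

Lemma vec_word_linear p x : gop_linear (vec_word p x).
Proof.
move=> d1 q d2 b1 b2 k y z h1 h2 yq zq; rewrite /vec_word !size_cat /=.
rewrite scaler_sumr -big_split; apply: eq_bigr => i _ /=.
rewrite scaler_sumr -big_split; apply: eq_bigr => j _ /=.
rewrite (gop_cat_linear _ _ (@gop_prod_linear K A) (gop_vec_prod_linear x)) //.
by rewrite scalerDr !scalerA [_ * k]mulrC.
Qed.

Lemma end_word_linear p f : is_Hom p f -> gop_linear (end_word p f).
Proof.
move=> hf d1 q d2 b1 b2 k y z h1 h2 yq zq; rewrite /end_word !size_cat /=.
rewrite scaler_sumr -big_split; apply: eq_bigr => i _ /=.
rewrite scaler_sumr -big_split; apply: eq_bigr => j _ /=.
rewrite scaler_sumr -big_split; apply: eq_bigr => l _ /=.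
rewrite (gop_cat_linear _ _ (@gop_prod_linear K A)) //; last first.
  by apply: gop_cat_linear; [exact: gop_end_prod_linear hf|exact: gop_prod_linear].
by rewrite scalerDr !scalerA [_ * k]mulrC.
Qed.

Section Central.
Variables (c : A) (e : int).
Hypothesis (cc : forall j (a : A), a \in homog j -> a * c = (-1) ^ (j * e) *: (c * a)).

Lemma vec_word_clinear p x : x \in homog p -> gop_clinear c e p (vec_word p x).
Proof.
move=> xp d1 q d2 b1 b2 y h1 h2 yq; rewrite /vec_word !size_cat /=.
rewrite mulr_sumr scaler_sumr; apply: eq_bigr => i _ /=.
rewrite mulr_sumr scaler_sumr; apply: eq_bigr => j _ /=.
have hp : gop_degree 0 (@gop_prod K A) by move=> d a h; rewrite add0r gop_prod_degree.
have := gop_cat_clinear cc i hp (gop_prod_clinear cc) (gop_vec_prod_clinear cc xp) h1 h2 yq.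
rewrite add0r => ->; set X := gop_cat _ _ _ _ _ _.
by rewrite -[in RHS]scalerAr !scalerA; congr (_ *: _); exact: mulrC.
Qed.

Lemma end_word_clinear p f : is_Hom p f ->
  (forall x, f (c * x) = (-1) ^ (e * p) *: (c * f x)) ->
  gop_clinear c e p (end_word p f).
Proof.
move=> hf fc d1 q d2 b1 b2 y h1 h2 yq; rewrite /end_word !size_cat /=.
rewrite mulr_sumr scaler_sumr; apply: eq_bigr => i _ /=.
rewrite mulr_sumr scaler_sumr; apply: eq_bigr => j _ /=.
rewrite mulr_sumr scaler_sumr; apply: eq_bigr => k _ /=.
have hp : gop_degree 0 (@gop_prod K A) by move=> d a h; rewrite add0r gop_prod_degree.
have := gop_cat_clinear cc k (gop_end_prod_degree hf) (gop_end_prod_clinear cc hf fc)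
  (gop_prod_clinear cc); rewrite addr0 => hk.
have := gop_cat_clinear cc i hp (gop_prod_clinear cc) hk h1 h2 yq.
rewrite add0r => ->; set X := gop_cat _ _ _ _ _ _.
by rewrite -[in RHS]scalerAr !scalerA; congr (_ *: _); exact: mulrC.
Qed.

End Central.
End Def.

Variables (A : gradedAlgType K) (e : int).
Local Notation iota := (@adjoin_in K A e).

Lemma gop_prod_in d a : gop_prod d (map iota a) = iota (gop_prod d a).
Proof. by rewrite /gop_prod big_map rmorph_prod. Qed.

Lemma gop_cat_in i p (W1 W2 : gop A) (W1' W2' : gop (adjoin A e)) d a :
  (forall d a, W1' d (map iota a) = iota (W1 d a)) ->
  (forall d a, W2' d (map iota a) = iota (W2 d a)) ->
  gop_cat i p W1' W2' d (map iota a) = iota (gop_cat i p W1 W2 d a).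
Proof.
by move=> h1 h2; rewrite /gop_cat -map_take -map_drop h1 h2 -rmorphM -linearZ.
Qed.

Lemma vec_word_in p x d a : vec_word p (iota x) d (map iota a) = iota (vec_word p x d a).
Proof.
have h d' a' : gop_vec_prod (iota x) d' (map iota a') = iota (gop_vec_prod x d' a').
  by rewrite /gop_vec_prod big_map rmorphM rmorph_prod.
rewrite /vec_word size_map linear_sum; apply: eq_bigr => i _; rewrite linear_sum.
by apply: eq_bigr => j _; rewrite (gop_cat_in i p d a gop_prod_in h) -linearZ.
Qed.

Lemma end_word_in p f d a : is_Hom p f ->
  end_word p (@adjoin_map K A e p f) d (map iota a) = iota (end_word p f d a).
Proof.
move=> hf; have h d' a' : gop_end_prod (@adjoin_map K A e p f) d' (map iota a') =
    iota (gop_end_prod f d' a').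
  by rewrite /gop_end_prod !mul1r big_map -(adjoin_map_in e _ hf) rmorph_prod.
rewrite /end_word size_map linear_sum; apply: eq_bigr => i _; rewrite linear_sum.
apply: eq_bigr => j _; rewrite linear_sum; apply: eq_bigr => k _.
rewrite (gop_cat_in i p d a gop_prod_in (fun d a => gop_cat_in k 0 d a h gop_prod_in)).
by rewrite -linearZ.
Qed.

Lemma gop_symm_in (W : gop A) (W' : gop (adjoin A e)) :
  (forall d a, W' d (map iota a) = iota (W d a)) ->
  forall d a, gop_symm W' d (map iota a) = iota (gop_symm W d a).
Proof.
move=> WW d a; rewrite (@gop_symmE _ _ _ (size a)) ?size_map // /gop_symm /gop_sum.
rewrite linear_sum; apply: eq_bigr => s _.
by rewrite linearZ /= permseq_map ?WW.
Qed.

End BernoulliWords.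

(** * The Bernoulli generating series *)

(** Series as bare coefficient sequences: by functional extensionality, equality is equality of
    coefficients. The ring laws come from truncation to polynomials. *)
Definition fps (R : comNzRingType) : Type := nat -> R.

Section PowerSeries.
Variable R : comNzRingType.
Implicit Types f g h : fps R.

HB.instance Definition _ := gen_eqMixin (fps R).
HB.instance Definition _ := gen_choiceMixin (fps R).

Definition fps_add f g : fps R := fun n => f n + g n.
Definition fps_opp f : fps R := fun n => - f n.
Definition fps_zero : fps R := fun=> 0.

Fact fps_addA : associative fps_add.
Proof. by move=> f g h; apply: funext => n; rewrite /fps_add addrA. Qed.
Fact fps_addC : commutative fps_add.
Proof. by move=> f g; apply: funext => n; rewrite /fps_add addrC. Qed.
Fact fps_add0 : left_id fps_zero fps_add.
Proof. by move=> f; apply: funext => n; rewrite /fps_add add0r. Qed.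
Fact fps_addN : left_inverse fps_zero fps_opp fps_add.
Proof. by move=> f; apply: funext => n; rewrite /fps_add addNr. Qed.

HB.instance Definition _ :=
  GRing.isZmodule.Build (fps R) fps_addA fps_addC fps_add0 fps_addN.

Definition fps_mul f g : fps R := fun n => \sum_(i < n.+1) f i * g (n - i)%N.
Definition fps_one : fps R := fun n => (n == 0%N)%:R.

Definition fps_poly N f : {poly R} := \poly_(i < N) f i.

Lemma fps_mul_poly N f g n : (n < N)%N ->
  fps_mul f g n = (fps_poly N f * fps_poly N g)`_n.
Proof.
move=> nN; rewrite coefM; apply: eq_bigr => i _; rewrite !coef_poly.
have iN : (i < N)%N by apply: leq_ltn_trans nN; rewrite -ltnS.
by rewrite iN (leq_ltn_trans (leq_subr _ _) nN).
Qed.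

Fact fps_mulC : commutative fps_mul.
Proof.
by move=> f g; apply: funext => n; rewrite !(fps_mul_poly _ _ (ltnSn n)) mulrC.
Qed.

Fact fps_mulA : associative fps_mul.
Proof.
move=> f g h; apply: funext => n.
pose F := fps_poly n.+1 f; pose G := fps_poly n.+1 g; pose H := fps_poly n.+1 h.
transitivity ((F * (G * H))`_n).
  rewrite coefM; apply: eq_bigr => i _; rewrite coef_poly ltn_ord; congr (_ * _).
  by apply: fps_mul_poly; rewrite ltnS leq_subr.
rewrite mulrA coefM; apply: eq_bigr => i _; rewrite [H`__]coef_poly ltnS leq_subr.
by congr (_ * _); rewrite -fps_mul_poly.
Qed.

Fact fps_mul1 : left_id fps_one fps_mul.
Proof.
move=> f; apply: funext => n; rewrite /fps_mul big_ord_recl mul1r subn0 big1 ?addr0 // => i _.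
by rewrite mul0r.
Qed.

Fact fps_mulDl : left_distributive fps_mul fps_add.
Proof.
move=> f g h; apply: funext => n; rewrite /fps_mul /fps_add -big_split.
by apply: eq_bigr => i _; rewrite mulrDl.
Qed.

Fact fps_1neq0 : fps_one != fps_zero.
Proof. by apply/eqP => /(congr1 (fun f : fps R => f 0%N))/eqP; rewrite oner_eq0. Qed.

HB.instance Definition _ := GRing.Zmodule_isComNzRing.Build (fps R)
  fps_mulA fps_mulC fps_mul1 fps_mulDl fps_1neq0.

Lemma fpsM f g n : (f * g) n = \sum_(i < n.+1) f i * g (n - i)%N.
Proof. by []. Qed.

Lemma fpsD f g n : (f + g) n = f n + g n.
Proof. by []. Qed.

Lemma fpsN f n : (- f) n = - f n.
Proof. by []. Qed.

Definition fps_monom1 (z : R) : fps R := fun n => if n == 1%N then z else 0.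

Lemma fps_monom1M z f n : (fps_monom1 z * f) n.+1 = z * f n.
Proof.
rewrite fpsM !big_ord_recl /= /fps_monom1 mul0r add0r subn1 big1 ?addr0 // => i _.
by rewrite mul0r.
Qed.

End PowerSeries.

Section BernoulliSeries.
Variables (K : fieldType) (charK : [pchar K] =i pred0).
Variables (R : comNzRingType) (kappa : {rmorphism K -> R}).

Lemma natr_neq0 n : (n.+1%:R != 0 :> K).
Proof. by rewrite ((pcharf0P K).1 charK). Qed.

Lemma factr_neq0 n : (n`!%:R != 0 :> K).
Proof. by rewrite -(prednK (fact_gt0 n)) natr_neq0. Qed.

Lemma factrS n : n.+1`!%:R = n.+1%:R * n`!%:R :> K.
Proof. by rewrite factS natrM. Qed.

Definition fps_exp (w : R) : fps R := fun n => kappa (n`!%:R^-1) * w ^+ n.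

Lemma bin_fact_inv n i : (i <= n)%N ->
  'C(n, i)%:R / n`!%:R = i`!%:R^-1 * (n - i)`!%:R^-1 :> K.
Proof.
move=> le_in; rewrite -(bin_fact le_in) !natrM.
have := factr_neq0 i; have := factr_neq0 (n - i).
have : 'C(n, i)%:R != 0 :> K.
  by rewrite -(prednK (n := 'C(n, i))) ?natr_neq0 // bin_gt0.
by move=> ? ? ?; field; do !(apply/andP; split).
Qed.

Lemma fps_expD w w' : fps_exp (w + w') = fps_exp w * fps_exp w'.
Proof.
apply: funext => n; rewrite fpsM /fps_exp addrC exprDn mulr_sumr; apply: eq_bigr => i _.
have le_in : (i <= n)%N by rewrite -ltnS.
rewrite [RHS]mulrACA -rmorphM -bin_fact_inv // rmorphM rmorph_nat -[_ *+ 'C(n, i)]mulr_natl.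
by move: (w ^+ i) (w' ^+ _) (kappa _) => x y z; ring.
Qed.

Lemma fps_exp0 : fps_exp 0 = 1.
Proof.
apply: funext => -[|n]; first by rewrite /fps_exp fact0 invr1 rmorph1 mul1r.
by rewrite /fps_exp expr0n mulr0.
Qed.

Lemma fps_exp_opp w n : fps_exp (- w) n = kappa ((-1) ^+ n / n`!%:R) * w ^+ n.
Proof.
have -> : kappa ((-1) ^+ n / n`!%:R) = (-1) ^+ n * kappa n`!%:R^-1.
  by rewrite rmorphM; congr (_ * _); rewrite rmorphXn; congr (_ ^+ _); rewrite rmorphN1.
by rewrite /fps_exp [(- w) ^+ n]exprNn mulrCA mulrA.
Qed.

Lemma fps_expN w : fps_exp w * fps_exp (- w) = 1.
Proof. by rewrite -fps_expD subrr fps_exp0. Qed.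

(** The series sum b_n x^n / n! at x = z tau; the series variable tau records the total degree in
    the later variables s and t. *)
Definition fps_bern (b : nat -> K) (z : R) : fps R :=
  fun n => kappa (b n / n`!%:R) * z ^+ n.

Definition expm1_coef n : K := if n == 0%N then 0 else n`!%:R^-1.

Lemma fps_expm1E z n : (fps_exp z - 1) n = kappa (expm1_coef n) * z ^+ n.
Proof.
rewrite fpsD fpsN /fps_exp /expm1_coef; case: n => [|n]; last by rewrite subr0.
by rewrite fact0 invr1 rmorph1 rmorph0 mul0r mul1r subrr.
Qed.

Lemma fps_bernM b f z n (F : fps R) : (forall m, F m = kappa (f m) * z ^+ m) ->
  (fps_bern b z * F) n = kappa (\sum_(k < n.+1) b k / k`!%:R * f (n - k)%N) * z ^+ n.
Proof.
move=> FE; rewrite fpsM rmorph_sum mulr_suml; apply: eq_bigr => k _.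
have kn : (k <= n)%N by rewrite -ltnS.
by rewrite FE /fps_bern mulrACA -exprD subnKC // -rmorphM.
Qed.

Lemma fps_bernP z : fps_bern (bernoulli K) z * (fps_exp z - 1) = fps_monom1 z.
Proof.
apply: funext => n; rewrite (fps_bernM _ _ (fps_expm1E z)) (bernoulliP charK).
by rewrite /fps_monom1; case: eqP => [->|_]; rewrite ?rmorph1 ?mul1r ?rmorph0 ?mul0r.
Qed.

(** The derivative of b(x) (e^x - 1) = x, that is b' (e^x - 1) + b e^x = 1, by coefficients.
    Splitting the factor n.+1 as k + (n.+1 - k) is the Leibniz rule. *)
Lemma bernoulli_deriv n :
  \sum_(k < n.+1) bernoulli K k.+1 / k`!%:R * expm1_coef (n - k)%N +
  \sum_(k < n.+1) bernoulli K k / k`!%:R * (n - k)`!%:R^-1 = (n == 0%N)%:R.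
Proof.
have := bernoulliP charK n.+1; move/(congr1 (fun x => n.+1%:R * x)).
have -> : n.+1%:R * (n.+1 == 1%N)%:R = (n == 0%N)%:R :> K.
  by case: n => [|n]; rewrite ?mulr1 ?mulr0.
move=> <-; rewrite mulr_sumr.
rewrite [RHS](eq_bigr (fun k : 'I_n.+2 =>
    k%:R * (bernoulli K k / k`!%:R * expm1_coef (n.+1 - k)%N) +
    (n.+1 - k)%:R * (bernoulli K k / k`!%:R * expm1_coef (n.+1 - k)%N))); last first.
  move=> k _; have kn : (k <= n.+1)%N by rewrite -ltnS.
  by rewrite -mulrDl -natrD subnKC.
rewrite big_split /=; congr (_ + _).
  rewrite [RHS]big_ord_recl mul0r add0r; apply: eq_bigr => k _ /=.
  rewrite /bump /= add1n subSS factrS.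
  have := natr_neq0 k; have := factr_neq0 k; move: (k.+1%:R) (k`!%:R) => u v hv hu.
  by field; rewrite hu hv.
rewrite [RHS]big_ord_recr /= subnn mul0r addr0; apply: eq_bigr => k _ /=.
have kn : (k <= n)%N by rewrite -ltnS.
rewrite mulrCA; congr (_ * _); rewrite subSn // /expm1_coef /= factrS invfM mulrA.
by rewrite mulfV ?natr_neq0 // mul1r.
Qed.

Lemma fps_bern_derivP z :
  fps_bern (fun k => bernoulli K k.+1) z * (fps_exp z - 1) +
  fps_bern (bernoulli K) z * fps_exp z = 1.
Proof.
apply: funext => n; rewrite fpsD (fps_bernM _ _ (fps_expm1E z)).
rewrite (@fps_bernM _ (fun m => m`!%:R^-1) _ _ (fps_exp z)) //.
rewrite -mulrDl -rmorphD bernoulli_deriv.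
by case: n => [|n]; rewrite ?rmorph1 ?mul1r // rmorph0 mul0r.
Qed.

(* (e^(-s tau) - e^(-t tau)) / ((s - t) tau) *)
Definition fps_dexp (s t : R) : fps R := fun m =>
  kappa ((-1) ^+ m.+1 / m.+1`!%:R) * \sum_(r < m.+1) s ^+ r * t ^+ (m - r).

Lemma fps_dexpP s t :
  fps_monom1 (s - t) * fps_dexp s t = fps_exp (- s) - fps_exp (- t).
Proof.
apply: funext => -[|m]; rewrite fpsD fpsN.
  by rewrite fpsM big_ord1 mul0r /fps_exp !expr0 subrr.
rewrite fps_monom1M /fps_dexp /fps_exp -mulrBr [(- s) ^+ _]exprNn [(- t) ^+ _]exprNn -mulrBr subrXX.
rewrite rmorphM rmorphXn rmorphN rmorph1 mulrCA [RHS]mulrCA -!mulrA; congr (_ * (_ * (_ * _))).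
rewrite (reindex_inj rev_ord_inj) /=; apply: eq_bigr => i _.
by rewrite subSS subKn // -ltnS.
Qed.

(** For the Bernoulli numbers, (s - t) tau / (e^(s tau) - e^(t tau)) written without division. A
    general [b] also covers the derivative, whose coefficients are shifted. *)
Definition bern_series b (s t : R) : fps R := fps_bern b (s - t) * fps_exp (- t).

Lemma fps_monom1_inj z (f g : fps R) : GRing.lreg z ->
  fps_monom1 z * f = fps_monom1 z * g -> f = g.
Proof.
move=> zr e; apply: funext => n; apply: zr; rewrite -!fps_monom1M.
by rewrite e.
Qed.

(** Let F(s, t) be the series [c] at tau = 1. Then F_s is [c1] and F_t is -(c1 + c), so this is
    e^(-s) F_s + e^(-t) F_t = F (e^(-s) - e^(-t)) / (s - t), which is what [Psi_x, Psi_1] = 0 says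
    at equal arguments. *)
Lemma bern_series_pde s t : GRing.lreg (s - t) ->
  let c := bern_series (bernoulli K) s t in
  let c1 := bern_series (fun k => bernoulli K k.+1) s t in
  fps_exp (- s) * c1 - fps_exp (- t) * (c1 + c) = fps_dexp s t * c.
Proof.
move=> zr c c1; apply: (fps_monom1_inj zr); rewrite [RHS]mulrA fps_dexpP /c /c1 /bern_series.
set Z := fps_monom1 _; set b := fps_bern (bernoulli K) _; set b1 := fps_bern _ _.
have zT : fps_exp (s - t) * fps_exp t = fps_exp s by rewrite -fps_expD subrK.
have E : fps_exp s - fps_exp t = (fps_exp (s - t) - 1) * fps_exp t.
  by rewrite mulrBl mul1r zT.
have hb : b * (fps_exp s - fps_exp t) = Z * fps_exp t.
  by rewrite E mulrA fps_bernP.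
have hb1 : b1 * (fps_exp s - fps_exp t) + b * fps_exp s = fps_exp t.
  by rewrite E -zT !mulrA -mulrDl fps_bern_derivP mul1r.
have hS := fps_expN s; have hT := fps_expN t.
move: hb hb1 hS hT; move: (fps_exp s) (fps_exp t) (fps_exp (- s)) (fps_exp (- t)).
move=> S T S' T' hb hb1 hS hT.
have e1 : S' - T' = S' * T' * (T - S).
  have -> : S' - T' = S' * (T * T') - T' * (S * S') by rewrite hS hT !mulr1.
  ring.
have e2 : (S' - T') * b = - (S' * (T * T') * Z).
  rewrite e1; transitivity (- (S' * T' * (b * (S - T)))); first ring.
  by rewrite hb; ring.
have e3 : (S' - T') * b1 = T' * (S * S') * b - S' * (T * T').
  rewrite e1; transitivity (- (S' * T' * (b1 * (S - T) + b * S - b * S))); first ring.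
  by rewrite hb1; ring.
transitivity (Z * T' * ((S' - T') * b1 - T' * b)); first ring.
transitivity (T' * ((S' - T') * b)); last ring.
by rewrite e3 e2 hS hT; ring.
Qed.

End BernoulliSeries.

(** * Reindexing of triangular sums *)

Section TriangularSums.
Variable W : nmodType.
Implicit Types F : nat -> nat -> W.

Lemma sum_antidiagonal F n :
  \sum_(i < n.+1) \sum_(j < n.+1 | (i + j == n)%N) F i j = \sum_(i < n.+1) F i (n - i)%N.
Proof.
apply: eq_bigr => i _; have ni : (n - i < n.+1)%N by rewrite ltnS leq_subr.
rewrite (big_pred1 (Ordinal ni)) // => j; rewrite /= -val_eqE /=.
by have := ltn_ord i; have := ltn_ord j; lia.
Qed.

Lemma sum_triangle_widen F n :
  \sum_(m < n.+1) \sum_(l < (n - m).+1) F m l =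
  \sum_(m < n.+1) \sum_(l < n.+1 | (m + l <= n)%N) F m l.
Proof.
apply: eq_bigr => m _; have h : ((n - m).+1 <= n.+1)%N by rewrite ltnS leq_subr.
rewrite (big_ord_widen n.+1 _ h); apply: eq_bigl => l.
by have := ltn_ord m; lia.
Qed.

Lemma sum_triangle_swap F n :
  \sum_(m < n.+1) \sum_(l < (n - m).+1) F m l =
  \sum_(l < n.+1) \sum_(m < (n - l).+1) F m l.
Proof.
rewrite sum_triangle_widen (sum_triangle_widen (fun l m => F m l)).
rewrite (exchange_big_dep predT) //=; apply: eq_bigr => l _.
by apply: eq_bigl => m; rewrite addnC.
Qed.

Lemma sum_triangle_diag F n :
  \sum_(m < n.+1) \sum_(l < (n - m).+1) F m l =
  \sum_(r < n.+1) \sum_(m < r.+1) F m (r - m)%N.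
Proof.
have -> : \sum_(r < n.+1) \sum_(m < r.+1) F m (r - m)%N =
    \sum_(r < n.+1) \sum_(m < n.+1 | (m <= r)%N) F m (r - m)%N.
  by apply: eq_bigr => r _; rewrite (big_ord_widen n.+1 (fun m => F m (r - m)%N) (ltn_ord r)).
rewrite (exchange_big_dep predT) //=; apply: eq_bigr => m _.
have mn : (m <= n)%N by rewrite -ltnS.
rewrite -(big_mkord predT (F m)) -(big_geq_mkord _ _ predT (fun r => F m (r - m)%N)).
have := big_addn 0 n.+1 m predT (fun r => F m (r - m)%N); rewrite add0n => ->.
by rewrite subSn //; apply: eq_bigr => l _; rewrite addnK.
Qed.

End TriangularSums.

(** * The numbers B_ij as coefficients of the generating series *)

Section BernoulliCoefficients.
Variables (K : fieldType) (charK : [pchar K] =i pred0).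

Definition bern2 (b : nat -> K) i j : K :=
  (-1) ^+ j * \sum_(k < j.+1) 'C(j, k)%:R * b (i + k)%N.

(** Pascal's rule; for the generating function F it is F_s + F_t = -F. *)
Lemma bern2_rec b i j : bern2 b i.+1 j + bern2 b i j.+1 = - bern2 b i j.
Proof.
suff -> : bern2 b i j.+1 = - (bern2 b i j + bern2 b i.+1 j) by rewrite opprD addrC addrNK.
rewrite /bern2 exprS mulN1r mulNr -mulrDr; congr (- (_ * _)).
rewrite [in LHS]big_ord_recl /= bin0 addn0 [in X in _ = X + _]big_ord_recl /= bin0 addn0.
rewrite -addrA; congr (_ + _).
under eq_bigr => k _ do rewrite /bump /= !add1n binS natrD mulrDl addnS -addSn.
rewrite big_split /=; congr (_ + _).
by rewrite big_ord_recr /= bin_small // mul0r addr0; apply: eq_bigr => k _; rewrite addSnnS.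
Qed.

Variables (R : comNzRingType) (kappa : {rmorphism K -> R}).

(** With binomials written as quotients of factorials, the expansion of (s - t)^m on the left and
    the sum in [bern2] on the right become the same double sum. *)
Lemma bern_series_coef b (s t : R) n : bern_series kappa b s t n =
  \sum_(i < n.+1) kappa (bern2 b i (n - i) / (i`!%:R * (n - i)`!%:R)) * (s ^+ i * t ^+ (n - i)).
Proof.
pose F m i : R := kappa (b m / (i`!%:R * (m - i)`!%:R * (n - m)`!%:R)) * (s ^+ i * (- t) ^+ (n - i)).
transitivity (\sum_(m < n.+1) \sum_(i < m.+1) F m i).
  rewrite /bern_series fpsM; apply: eq_bigr => m _; rewrite /fps_bern /fps_exp.
  have mn : (m <= n)%N by rewrite -ltnS.
  rewrite addrC exprDn mulr_sumr mulr_suml; apply: eq_bigr => i _.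
  have im : (i <= m)%N by rewrite -ltnS.
  have E : b m / (i`!%:R * (m - i)`!%:R * (n - m)`!%:R) =
      b m / m`!%:R * 'C(m, i)%:R * (n - m)`!%:R^-1.
    rewrite !invfM !mulrA -[_ / m`!%:R * _]mulrA [_^-1 * 'C(_, _)%:R]mulrC.
    by rewrite (bin_fact_inv charK im) !mulrA.
  rewrite /F; have -> : (n - i)%N = (m - i + (n - m))%N by clear -mn im; lia.
  rewrite E !rmorphM rmorph_nat exprD -[_ *+ 'C(m, i)]mulr_natl.
  move: (kappa _) (kappa _) (kappa _) ('C(m, i)%:R) (s ^+ i) (_ ^+ _) (_ ^+ _).
  by move=> x1 x2 x3 x4 x5 x6 x7; ring.
transitivity (\sum_(i < n.+1) \sum_(k < (n - i).+1) F (i + k)%N i).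
  transitivity (\sum_(i < n.+1) \sum_(m < n.+1 | (i <= m)%N) F m i).
    have -> : \sum_(m < n.+1) \sum_(i < m.+1) F m i =
        \sum_(m < n.+1) \sum_(i < n.+1 | (i <= m)%N) F m i.
      by apply: eq_bigr => m _; rewrite (big_ord_widen n.+1 (F m) (ltn_ord m)).
    by rewrite (exchange_big_dep predT).
  apply: eq_bigr => i _; have le_in : (i <= n)%N by rewrite -ltnS.
  rewrite -(big_geq_mkord _ _ predT (fun m => F m i)).
  have := big_addn 0 n.+1 i predT (fun m => F m i); rewrite add0n => ->.
  by rewrite subSn // big_mkord; apply: eq_bigr => k _; rewrite addnC.
apply: eq_bigr => i _; pose j := (n - i)%N; rewrite -/j.
have -> : bern2 b i j / (i`!%:R * j`!%:R) =
    (-1) ^+ j * \sum_(k < j.+1) b (i + k)%N / (i`!%:R * k`!%:R * (j - k)`!%:R).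
  rewrite /bern2 -mulrA; congr (_ * _); rewrite mulr_suml; apply: eq_bigr => k _.
  have kj : (k <= j)%N by rewrite -ltnS.
  rewrite !invfM !mulrA -[_ / k`!%:R / _]mulrA -(bin_fact_inv charK kj).
  by move: ('C(j, k)%:R) (b _) (_^-1) (_^-1) => x1 x2 x3 x4; ring.
rewrite rmorphM rmorphXn rmorphN1 rmorph_sum -mulrA mulrCA mulr_suml.
apply: eq_bigr => k _; rewrite /F subnDA -/j addKn exprNn.
by move: (kappa _) (_ ^+ _) (_ ^+ _) (_ ^+ _) => x1 x2 x3 x4; ring.
Qed.

End BernoulliCoefficients.

(** * Evaluation at left and right multiplication *)

Section BivariateEvaluation.
Variables (K : fieldType) (A : gradedAlgType K) (a y : A).

(* The bivariate polynomial sum p_ij s^i t^j is evaluated to sum p_ij a^i y a^j. *)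
Definition eval2_coef (c : {poly K}) : A := poly_eval a c * y.
Definition eval2 (P : {poly {poly K}}) : A := (map_poly eval2_coef P).[a].

Lemma eval2_coef0 : eval2_coef 0 = 0.
Proof. by rewrite /eval2_coef rmorph0 mul0r. Qed.

Lemma eval2D P Q : eval2 (P + Q) = eval2 P + eval2 Q.
Proof.
rewrite /eval2 -hornerD; congr (_.[a]); apply/polyP => i.
by rewrite coefD !(coef_map_id0 _ _ eval2_coef0) coefD /eval2_coef rmorphD mulrDl.
Qed.

Lemma eval2_0 : eval2 0 = 0.
Proof. by have /eqP := eval2D 0 0; rewrite addr0 -subr_eq subrr => /eqP<-. Qed.

Lemma eval2N P : eval2 (- P) = - eval2 P.
Proof. by apply/eqP; rewrite -addr_eq0 -eval2D addNr eval2_0. Qed.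

Lemma eval2_sum (I : Type) (r : seq I) (Q : pred I) (F : I -> {poly {poly K}}) :
  eval2 (\sum_(i <- r | Q i) F i) = \sum_(i <- r | Q i) eval2 (F i).
Proof. exact: (big_morph eval2 eval2D eval2_0). Qed.

Lemma eval2C c P : eval2 (c%:P * P) = poly_eval a c * eval2 P.
Proof.
rewrite /eval2 -hornerCM; congr (_.[a]); apply/polyP => i.
by rewrite coefCM !(coef_map_id0 _ _ eval2_coef0) coefCM /eval2_coef rmorphM mulrA.
Qed.

Lemma eval2Z k P : eval2 (k%:P%:P * P) = k *: eval2 P.
Proof. by rewrite eval2C /poly_eval horner_algC mulr_algl. Qed.

Lemma eval2X P : eval2 ('X%:P * P) = a * eval2 P.
Proof. by rewrite eval2C poly_evalX. Qed.

Lemma eval2Y P : eval2 (P * 'X) = eval2 P * a.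
Proof.
rewrite /eval2 -hornerMX; congr (_.[a]); apply/polyP => i.
by rewrite coefMX !(coef_map_id0 _ _ eval2_coef0) coefMX; case: eqP => // _; rewrite eval2_coef0.
Qed.

Lemma eval2_1 : eval2 1 = y.
Proof.
rewrite /eval2 (_ : map_poly _ _ = y%:P) ?hornerC //; apply/polyP => i.
rewrite (coef_map_id0 _ _ eval2_coef0) coef1 coefC; case: eqP => _; last exact: eval2_coef0.
by rewrite /eval2_coef rmorph1 mul1r.
Qed.

Lemma eval2Xn i P : eval2 ('X%:P ^+ i * P) = a ^+ i * eval2 P.
Proof. by elim: i => [|i IH]; rewrite ?expr0 ?mul1r // exprS -mulrA eval2X IH exprS mulrA. Qed.

Lemma eval2Yn i P : eval2 (P * 'X ^+ i) = eval2 P * a ^+ i.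
Proof. by elim: i => [|i IH]; rewrite ?expr0 ?mulr1 // exprSr mulrA eval2Y IH exprSr mulrA. Qed.

End BivariateEvaluation.

Section BernoulliWordIdentity.
Variables (K : fieldType) (charK : [pchar K] =i pred0).

(* The component of degree n in a of b(L, R) y, for the exponential series
   b(s, t) = sum b_ij s^i t^j / (i! j!) and L, R the left and right
   multiplications by a. *)
Definition biword (A : gradedAlgType K) (b : nat -> nat -> K) n (a y : A) : A :=
  \sum_(i < n.+1) (b i (n - i)%N / (i`!%:R * (n - i)`!%:R)) *:
    (a ^+ i * y * a ^+ (n - i)).

Local Notation B := (bernoulli2 K).
Local Notation B1 := (fun i j => bernoulli2 K i.+1 j).
Local Notation B2 := (fun i j => bernoulli2 K i j.+1).

Section FixedAlgebra.
Variables (A : gradedAlgType K) (a : A).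
Implicit Types y w : A.

Let kappa : {rmorphism K -> {poly {poly K}}} := polyC \o polyC.
(** The inner variable s becomes left multiplication by a, the outer variable t right
    multiplication. *)
Local Notation s := ('X%:P : {poly {poly K}}).
Local Notation t := ('X : {poly {poly K}}).

Lemma eval2_bern_series b n y : eval2 a y (bern_series kappa b s t n) =
  biword (bern2 b) n a y.
Proof.
rewrite (bern_series_coef charK) eval2_sum; apply: eq_bigr => i _.
by rewrite eval2Z eval2Yn -[_ ^+ i]mulr1 eval2Xn eval2_1.
Qed.

Lemma eval2_expl m y P : eval2 a y (fps_exp kappa (- s) m * P) =
  ((-1) ^+ m / m`!%:R) *: (a ^+ m * eval2 a y P).
Proof. by rewrite fps_exp_opp -mulrA eval2Z eval2Xn. Qed.

Lemma eval2_expr m y P : eval2 a y (fps_exp kappa (- t) m * P) =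
  ((-1) ^+ m / m`!%:R) *: (eval2 a y P * a ^+ m).
Proof. by rewrite fps_exp_opp -mulrA eval2Z [t ^+ m * P]mulrC eval2Yn. Qed.

Lemma biwordD b b' n y : biword (fun i j => b i j + b' i j) n a y =
  biword b n a y + biword b' n a y.
Proof. by rewrite -big_split; apply: eq_bigr => i _; rewrite mulrDl scalerDl. Qed.

Lemma biwordN b n y : biword (fun i j => - b i j) n a y = - biword b n a y.
Proof. by rewrite -sumrN; apply: eq_bigr => i _; rewrite mulNr scaleNr. Qed.

Lemma eq_biword b b' n y : (forall i j, b i j = b' i j) ->
  biword b n a y = biword b' n a y.
Proof. by move=> bb; apply: eq_bigr => i _; rewrite bb. Qed.

Lemma biword_rec n y : biword B1 n a y + biword B2 n a y = - biword B n a y.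
Proof.
by rewrite -biwordD -biwordN; apply: eq_biword => i j; exact: bern2_rec.
Qed.

(** The image of [bern_series_pde] under [eval2]. The factor s - t has to be cancelled before the
    evaluation: left minus right multiplication by a kills 1. *)
Lemma biword_pde n y :
  \sum_(m < n.+1) ((-1) ^+ m / m`!%:R) *:
     (a ^+ m * biword B1 (n - m) a y + biword B2 (n - m) a y * a ^+ m) =
  \sum_(m < n.+1) ((-1) ^+ m.+1 / m.+1`!%:R) *:
     \sum_(r < m.+1) a ^+ r * biword B (n - m) a y * a ^+ (m - r).
Proof.
have st : GRing.lreg (s - t).
  apply: mulfI; rewrite subr_eq0; apply/eqP => /(congr1 (fun P : {poly {poly K}} => P`_0)).
  by rewrite coefC coefX /= => /eqP; rewrite polyX_eq0.
have := bern_series_pde charK kappa st.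
set c := bern_series _ _ _ _; set c1 := bern_series _ _ _ _.
move/(congr1 (fun f : fps {poly {poly K}} => eval2 a y (f n))) => /=.
have ck k : eval2 a y (c k) = biword B k a y by rewrite eval2_bern_series.
have c1k k : eval2 a y (c1 k) = biword B1 k a y by rewrite eval2_bern_series.
rewrite fpsD fpsN !fpsM eval2D eval2N !eval2_sum -sumrB => e.
transitivity (\sum_(i < n.+1) (eval2 a y (fps_exp kappa (- s) i * c1 (n - i)%N) -
    eval2 a y (fps_exp kappa (- t) i * (c1 + c) (n - i)%N))).
  apply: eq_bigr => m _; rewrite eval2_expl eval2_expr.
  rewrite fpsD eval2D ck c1k -scalerBr -mulNr; congr (_ *: (_ + _ * _)).
  by apply/esym/eqP; rewrite eqr_oppLR -addr_eq0 addrAC biword_rec addNr.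
rewrite {}e; apply: eq_bigr => m _; rewrite /fps_dexp -mulrA eval2Z; congr (_ *: _).
rewrite mulr_suml eval2_sum; apply: eq_bigr => r _.
by rewrite -mulrA eval2Xn [_ * c _]mulrC eval2Yn ck mulrA.
Qed.

End FixedAlgebra.
Section Derivative.
Variables (A : gradedAlgType K) (b : nat -> nat -> K).
Implicit Types a y w : A.
Local Notation b1 := (fun i j => b i.+1 j).
Local Notation b2 := (fun i j => b i j.+1).

(** The partial derivative in s, rewritten over the monomials of degree n.+1 to be added termwise to
    the one in t. At i = 0 the multiple is 0, so the default value of [i.-1] is harmless. *)
Lemma biword_shift1 n a y : biword b1 n a y =
  \sum_(i < n.+2) (b i (n.+1 - i)%N / (i`!%:R * (n.+1 - i)`!%:R)) *:
    ((a ^+ i.-1 * y * a ^+ (n.+1 - i)) *+ i).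
Proof.
rewrite [RHS]big_ord_recl mulr0n scaler0 add0r; apply: eq_bigr => i _ /=.
rewrite /bump /= add1n subSS -scaler_nat scalerA; congr (_ *: _).
rewrite (factrS K); have := natr_neq0 charK i; have := factr_neq0 charK i.
have := factr_neq0 charK (n - i); move: (i.+1%:R) (i`!%:R) (_`!%:R) => u v z hz hv hu.
by field; rewrite hu hv hz.
Qed.

Lemma biword_shift2 n a y : biword b2 n a y =
  \sum_(i < n.+2) (b i (n.+1 - i)%N / (i`!%:R * (n.+1 - i)`!%:R)) *:
    ((a ^+ i * y * a ^+ (n.+1 - i).-1) *+ (n.+1 - i)).
Proof.
rewrite [RHS]big_ord_recr /= subnn mulr0n scaler0 addr0; apply: eq_bigr => i _ /=.
have le_in : (i <= n)%N by rewrite -ltnS.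
rewrite subSn //= -scaler_nat scalerA; congr (_ *: _).
rewrite (factrS K); have := natr_neq0 charK (n - i); have := factr_neq0 charK i.
have := factr_neq0 charK (n - i); move: ((n - i).+1%:R) (i`!%:R) ((n - i)`!%:R) => u v z hz hv hu.
by field; rewrite hu hv hz.
Qed.

(** Euler's identity for the homogeneous component of degree n.+1. *)
Lemma biword_euler n a y :
  a * biword b1 n a y + biword b2 n a y * a = n.+1%:R *: biword b n.+1 a y.
Proof.
rewrite biword_shift1 biword_shift2 mulr_sumr mulr_suml scaler_sumr -big_split.
apply: eq_bigr => i _ /=; rewrite -scalerAr -scalerAl -scalerDr.
move: (b i (n.+1 - i)%N / _) => c; rewrite scalerA [n.+1%:R * _]mulrC -scalerA.
congr (_ *: _); rewrite scaler_nat mulrnAr mulrnAl !mulrA.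
have -> : a * a ^+ i.-1 * y * a ^+ (n.+1 - i) *+ i = a ^+ i * y * a ^+ (n.+1 - i) *+ i.
  by case: (i : nat) => [|k]; rewrite ?mulr0n // -exprS.
have -> : a ^+ i * y * a ^+ (n.+1 - i).-1 * a *+ (n.+1 - i) =
    a ^+ i * y * a ^+ (n.+1 - i) *+ (n.+1 - i).
  by case: (n.+1 - i)%N => [|k]; rewrite ?mulr0n // -mulrA -exprSr.
have le_in : (i <= n.+1)%N by rewrite -ltnS.
by rewrite -mulrnDr subnKC.
Qed.

Lemma adjoin_exp e a y n : a \in homog 0 ->
  ((a, y) : adjoin A e) ^+ n = (a ^+ n, \sum_(r < n) a ^+ r * y * a ^+ (n - r.+1)).
Proof.
move=> a0; elim: n => [|n IH]; first by rewrite big_ord0.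
rewrite exprS IH adjoin_mulE /= (koszul_twist_homog _ a0) mulr0 expr0z scale1r -exprS.
rewrite [in RHS]big_ord_recl mul1r subn1; congr (_, _ + _).
rewrite mulr_sumr; apply: eq_bigr => r _ /=.
by rewrite /bump /= add1n subSS !mulrA -exprS.
Qed.

Lemma adjoin0_exp a w n : a \in homog 0 -> a * w = w * a ->
  ((a, w) : adjoin A 0) ^+ n = (a ^+ n, (a ^+ n.-1 * w) *+ n).
Proof.
move=> a0 aw; rewrite adjoin_exp //; congr (_, _).
rewrite (eq_bigr (fun=> a ^+ n.-1 * w)) ?sumr_const ?card_ord // => r _.
have cw k : w * a ^+ k = a ^+ k * w by exact/commrX/esym.
by rewrite -mulrA cw mulrA -exprD; congr (_ ^+ _ * _); have := ltn_ord r; lia.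
Qed.

(** Derivative at a in the direction w. As w commutes with a, the derivatives of a^i and a^j are i w
    a^(i-1) and j a^(j-1) w, so that w stands at the outer ends. *)
Lemma biword_adjoin n a w y y' : a \in homog 0 -> a * w = w * a ->
  biword b n.+1 ((a, w) : adjoin A 0) (y, y') =
  (biword b n.+1 a y,
   w * biword b1 n a y + biword b2 n a y * w + biword b n.+1 a y').
Proof.
move=> a0 aw; rewrite {1}/biword adjoin_sumE; congr (_, _).
  by apply: eq_bigr => i _; rewrite !adjoin0_exp.
rewrite biword_shift1 biword_shift2 mulr_sumr mulr_suml -!big_split.
apply: eq_bigr => i _; rewrite !adjoin0_exp // !adjoin_mulE adjoin_scaleE /= !koszul_twist0.
rewrite -scalerAr -scalerAl -!scalerDr; congr (_ *: _).
have cw k : w * a ^+ k = a ^+ k * w by exact/commrX/esym.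
by rewrite mulrDl !mulrnAr !mulrnAl !mulrA -cw addrAC; congr (_ + _ + _).
Qed.

End Derivative.

End BernoulliWordIdentity.

(** * Equal arguments of degree zero *)

Section EqualArguments.
Variables (K : fieldType) (charK : [pchar K] =i pred0).
Variable (Psi : assignment K)
  (hPsi : koszul_brackets Psi).

(** One argument c among copies of a is read off from the eps-component at a + eps c, again a value
    at equal arguments of degree 0, but in a larger algebra. *)
Lemma mark_of_nseq (A : gradedAlgType K) e p (u : seq A -> A)
    (u' : seq (adjoin A e) -> adjoin A e) (a c : A) n :
  D_homog p u' -> gop_clinear (adjoin_eps A e) e p (fun=> u') ->
  (forall b, u' (map (adjoin_in e) b) = adjoin_in e (u b)) ->
  a \in homog 0 -> c \in homog (- e) ->
  u (c :: nseq n a) *+ n.+1 = (-1) ^ (e * p) *: (u' (nseq n.+1 ((a, c) : adjoin A e))).2.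
Proof.
move=> hu uc ui a0 ce; have [ul us] := D_homog_gop hu.
have a0' : adjoin_in e a \in homog 0 by rewrite adjoin_in_homog.
have c0' : adjoin_in e c \in homog (- e) by rewrite adjoin_in_homog.
have E : u' (nseq n.+1 ((a, c) : adjoin A e)) = adjoin_in e (u (nseq n.+1 a)) +
    (-1) ^ (e * p) *: (adjoin_eps A e * adjoin_in e (u (c :: nseq n a)) *+ n.+1).
  have := adjoin_expand n.+1 ul us uc a0' c0' (homogs_nil (adjoin A e)).
  rewrite big_nil addr0 -!ui map_cons !map_nseq -[adjoin_in e a + _](adjoinE (a, c)).
  exact.
rewrite E adjoin_addE /= add0r scalerA signzMK scale1r adjoin_mulrn.
by rewrite adjoin_epsM.
Qed.

Lemma Psi_1_nseq (A : gradedAlgType K) (a : A) n : a \in homog 0 ->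
  Psi (of_vec 1) (nseq n a) = (-1) ^+ n *: a ^+ n.
Proof.
move=> a0.
have := Psi_natural_vec hPsi 1 (nseq n 'X) (poly_eval_graded a0).
rewrite map_nseq /= poly_evalX rmorph1 => <-.
rewrite (gop_clinear_nseq (u := Psi (of_vec 1)) _ (polyX_homog K)); last first.
  exact: Psi_1_clinear (polyX_homog K) (@polyX_central K).
rewrite (Psi_1_ones charK hPsi) rmorphM rmorphXn /= poly_evalX rmorphXn rmorphN1.
have -> : (-1) ^+ n = ((-1) ^+ n)%:A :> A.
  by elim: n => [|n IH]; rewrite ?scale1r // !exprS IH mulN1r mulN1r scaleNr.
by rewrite mulr_algr.
Qed.

(* The value of Psi_1 at (y, a, ..., a) divided by m!, with m occurrences of a. *)
Definition exp_deriv (A : gradedAlgType K) (a : A) m (y : A) : A :=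
  ((-1) ^+ m.+1 / m.+1`!%:R) *: \sum_(r < m.+1) a ^+ r * y * a ^+ (m - r).

Lemma exp_derivZ (A : gradedAlgType K) (a : A) m (k : K) y :
  exp_deriv a m (k *: y) = k *: exp_deriv a m y.
Proof.
rewrite /exp_deriv scalerA [k * _]mulrC -[RHS]scalerA; congr (_ *: _).
by rewrite scaler_sumr; apply: eq_bigr => r _; rewrite -scalerAr -scalerAl.
Qed.

Lemma exp_deriv_sum (A : gradedAlgType K) (a : A) m n (F : 'I_n -> A) :
  exp_deriv a m (\sum_i F i) = \sum_i exp_deriv a m (F i).
Proof.
rewrite /exp_deriv -scaler_sumr exchange_big; congr (_ *: _); apply: eq_bigr => r _ /=.
by rewrite mulr_sumr mulr_suml.
Qed.

(** The eps-component of (-1)^(m+1) (a + eps y)^(m+1), with eps of degree -q to allow y of any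
    degree q. *)
Lemma Psi_1_mark (A : gradedAlgType K) (a y : A) q m : a \in homog 0 -> y \in homog q ->
  Psi (of_vec 1) (y :: nseq m a) = m`!%:R *: exp_deriv a m y.
Proof.
move=> a0 yq; have yq' : y \in homog (- - q) by rewrite opprK.
have nt (b : seq A) : Psi (of_vec 1) (map (adjoin_in (- q)) b) = adjoin_in (- q) (Psi (of_vec 1) b).
  by rewrite (Psi_natural_vec hPsi 1 b (@adjoin_in_graded K A (- q))) rmorph1.
have cl := Psi_1_clinear hPsi (adjoin_eps_homog A (- q)) (@adjoin_eps_comm K A (- q)).
have := mark_of_nseq m (Psi_vec_D hPsi (homog1 : (1 : adjoin A (- q)) \in homog 0)) cl nt a0 yq'.
have ay0 : ((a, y) : adjoin A (- q)) \in homog 0 by rewrite adjoin_homog a0 /= add0r.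
rewrite Psi_1_nseq // mulr0 expr0z scale1r adjoin_scaleE adjoin_exp //= -scaler_nat => e.
apply: (scalerI (natr_neq0 charK m)); rewrite e /exp_deriv !scalerA.
rewrite factrS invfM; have := natr_neq0 charK m; have := factr_neq0 charK m.
move: (m.+1%:R) (m`!%:R) ((-1) ^+ m.+1) => u v w hv hu.
by congr (_ *: _); field; rewrite hu hv.
Qed.

End EqualArguments.

Section UniversalFormulas.
Variables (K : fieldType) (charK : [pchar K] =i pred0).
Variable (Psi : assignment K)
  (hPsi : koszul_brackets Psi).
Local Notation B := (bernoulli2 K).
Local Notation B1 := (fun i j => bernoulli2 K i.+1 j).
Local Notation B2 := (fun i j => bernoulli2 K i j.+1).

(* Comparison of the recursion defining an operator u with the functional
   equation satisfied by a formula psi; mu k w stands for the formula at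
   (w, a, ..., a) divided by k!. *)
Lemma nseq_step (A : gradedAlgType K) (u : seq A -> A) p n (lam : K) (a w : A)
    (psi : nat -> A) (mu : nat -> A -> A) :
  D_homog p u -> a \in homog 0 ->
  (n%:R - lam) *: u (nseq n.+1 a) =
    nr_prod_homog (op_trunc n.+1 u) (Psi (of_vec 1)) (nseq n.+1 0) (nseq n.+1 a) -
    nr_prod_homog (Psi (of_vec 1)) (op_trunc n.+1 u) (nseq n.+1 0) (nseq n.+1 a) -
    n.+1`!%:R *: w ->
  (forall k, (k <= n)%N -> u (nseq k a) = k`!%:R *: psi k) ->
  (forall k m, (k < n)%N -> u (a ^+ m :: nseq k a) = k`!%:R *: mu k (a ^+ m)) ->
  mu n.+1 1 = lam *: psi n.+1 -> mu n a = n.+1%:R *: psi n.+1 ->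
  \sum_(m < n.+2) ((-1) ^+ m / m`!%:R) *: mu (n.+1 - m)%N (a ^+ m) -
    \sum_(m < n.+2) exp_deriv a m (psi (n.+1 - m)%N) = w ->
  (n%:R - lam) *: u (nseq n.+1 a) = (n%:R - lam) *: (n.+1`!%:R *: psi n.+1).
Proof.
move=> hu a0 -> upsi umu mu1 mua; have [ul _ ud] := hu.
have [vl _ _] := Psi_vec_D hPsi (homog1 : (1 : A) \in homog 0).
have mulZ (k : K) x b : u (k *: x :: b) = k *: u (x :: b) by exact: (multilinearZ [::] b k x ul).
rewrite !nr_prod_homog_nseq.
pose S1 := \sum_(i < n) ((-1) ^+ i.+2 / i.+2`!%:R) *: mu (n.+1 - i.+2)%N (a ^+ i.+2).
pose S2 := \sum_(i < n.+1) exp_deriv a i.+1 (psi (n - i)%N).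
have -> : \sum_(m < n.+2) 'C(n.+1, m)%:R *:
    op_trunc n.+1 u (Psi (of_vec 1) (nseq m a) :: nseq (n.+1 - m) a) = n.+1`!%:R *: S1.
  (* For m = 0 and m = 1 the argument list has length at least n.+1 and is truncated. *)
  have tr0 x m : (m <= 1)%N -> op_trunc n.+1 u (x :: nseq (n.+1 - m) a) = 0.
    by move=> m1; rewrite /op_trunc /= size_nseq ltnS ltnNge; case: m m1 => [|[|]] // _;
      rewrite ?subn0 ?subn1 /= ?leqnn ?leqnSn.
  rewrite !big_ord_recl !tr0 // !scaler0 !add0r scaler_sumr; apply: eq_bigr => i _.
  rewrite (_ : nat_of_ord (lift ord0 (lift ord0 i)) = i.+2) //; have i_n := ltn_ord i.
  rewrite /op_trunc -[size _]/(size (nseq (n.+1 - i.+2) a)).+1 size_nseq.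
  have -> : ((n.+1 - i.+2)%N.+1 < n.+1)%N by lia.
  rewrite (Psi_1_nseq charK hPsi) // mulZ umu; last by lia.
  have le_in : (i.+2 <= n.+1)%N by lia.
  rewrite !scalerA; congr (_ *: _).
  have := factr_neq0 charK i.+2; have := bin_fact le_in.
  move: (i.+2)`! (n.+1 - i.+2)`! 'C(n.+1, i.+2) n.+1`! => f g c N <- hf.
  by rewrite !natrM; field.
have -> : \sum_(m < n.+2) 'C(n.+1, m)%:R *:
    Psi (of_vec 1) (op_trunc n.+1 u (nseq m a) :: nseq (n.+1 - m) a) = n.+1`!%:R *: S2.
  have tr1 : op_trunc n.+1 u (nseq n.+1 a) = 0 by rewrite /op_trunc size_nseq ltnn.
  have v0 (b : seq A) : Psi (of_vec (1 : A)) (0 :: b) = 0 by rewrite (multilinear0 vl) ?mem_head.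
  (* The term m = n.+1 is truncated; the others are numbered by i = n - m to match [S2]. *)
  rewrite big_ord_recr tr1 v0 scaler0 [LHS]addr0 (reindex_inj rev_ord_inj) scaler_sumr.
  apply: eq_bigr => i _ /=; have i_n := ltn_ord i; rewrite subSS /op_trunc size_nseq ltnS leq_subr.
  have -> : (n.+1 - (n - i))%N = i.+1 by lia.
  have uh := ud _ _ (homogs_nseq (n - i) a0).
  rewrite (Psi_1_mark charK hPsi _ a0 uh) upsi ?leq_subr // exp_derivZ !scalerA.
  congr (_ *: _); have le_in : (n - i <= n.+1)%N by lia.
  have := bin_fact le_in; have -> : (n.+1 - (n - i))%N = i.+1 by lia.
  by move: (n - i)`! i.+1`! 'C(n.+1, n - i) n.+1`! => f g c N <-; rewrite !natrM; ring.
(* The terms m = 0 and m = 1 are lam psi and -n.+1 psi by [mu1] and [mua], and the term m = 0 of the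
   other sum is -psi. Together they give (lam - n) psi, with the factor of [nr_bracket_top]. *)
have -> : \sum_(m < n.+2) ((-1) ^+ m / m`!%:R) *: mu (n.+1 - m)%N (a ^+ m) =
    (lam - n.+1%:R) *: psi n.+1 + S1.
  rewrite !big_ord_recl /= -[bump 0 0]/1%N subn0 subn1 expr0 expr1 fact0 divr1 scale1r.
  rewrite mu1 mua divr1 scaleN1r addrA -scaleNr -scalerDl; congr (_ + _).
have -> : \sum_(m < n.+2) exp_deriv a m (psi (n.+1 - m)%N) = - psi n.+1 + S2.
  rewrite big_ord_recl subn0; congr (_ + _).
  by rewrite /exp_deriv big_ord1 !mul1r mulr1 divr1 scaleN1r.
move=> <-; rewrite -!scalerBr scalerA mulrC -scalerA; congr (_ *: _).
have -> : (lam - n.+1%:R) *: psi n.+1 + S1 - (- psi n.+1 + S2) =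
    (lam - n%:R) *: psi n.+1 + (S1 - S2).
  rewrite [- (- _ + _)]opprD opprK addrACA -[X in _ + X + _]scale1r -scalerDl.
  by congr (_ *: _ + _); rewrite -natr1; ring.
by rewrite opprD addrCA subrr addr0 -scaleNr opprB.
Qed.

(** * Linearity over graded central elements *)

Section Linearity.
Variables (A : gradedAlgType K) (c : A) (e : int).
Hypotheses (ce : c \in homog e)
  (cc : forall j (a : A), a \in homog j -> a * c = (-1) ^ (j * e) *: (c * a)).

Lemma nr_bracket_1_clinear p (u : seq A -> A) n d1 q d2 b1 b2 y :
  D_homog p u -> gop_clinear c e p (fun=> u) -> (size b1 + size b2).+1 = n ->
  homogs d1 b1 -> homogs d2 b2 -> y \in homog q ->
  let H d b := nr_prod_homog u (Psi (of_vec 1)) d b - nr_prod_homog (Psi (of_vec 1)) u d b in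
  H (d1 ++ (e + q) :: d2) (b1 ++ (c * y) :: b2) =
  (-1) ^ (e * (p + \sum_(i <- d1) i)) *: (c * H (d1 ++ q :: d2) (b1 ++ y :: b2)).
Proof.
case=> ul _ ud uc sz h1 h2 yq H; have [vl _ vd] := Psi_vec_D hPsi (homog1 : (1 : A) \in homog 0).
have vc := Psi_1_clinear hPsi ce cc; rewrite /H.
rewrite (nr_prod_homog_clinear ul vd uc vc sz h1 h2 yq).
rewrite (nr_prod_homog_clinear vl ud vc uc sz h1 h2 yq).
by rewrite addr0 add0r mulrBr scalerBr.
Qed.

Lemma op_clinear_gop p (u : seq A -> A) : (forall k, op_clinear_at c e p u k) ->
  gop_clinear c e p (fun=> u).
Proof. by move=> h d1 q d2 b1 b2 y h1 h2 yq; exact: h (erefl _) h1 h2 yq. Qed.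

Lemma D_homog_trunc n p (u : seq A -> A) : D_homog p u -> D_homog p (op_trunc n u).
Proof.
case=> ul us ud; split; [exact: op_trunc_multilinear| |exact: op_trunc_degree].
move=> a d s h; rewrite /op_trunc size_permseq; case: ifP => _; first exact: us.
by rewrite scaler0.
Qed.

(** Induction on the arity: the recursion involves only lower arities of Psi_x and [Psi_1], whose
    linearity comes from the axioms. *)
Lemma Psi_vec_clinear p (x : A) : x \in homog p -> gop_clinear c e p (fun=> Psi (of_vec x)).
Proof.
move=> xp; apply: op_clinear_gop; elim/ltn_ind => -[|n] IH d1 q d2 b1 b2 y // sz h1 h2 yq.
have hh r z : z \in homog r -> homogs (d1 ++ r :: d2) (b1 ++ z :: b2).
  by move=> zr; apply: homogs_cat => //; apply/homogs_cons.
have sa z : size (b1 ++ z :: b2) = n.+1 by rewrite size_cat /= addnS.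
apply: (scalerI (natr_neq0 charK n)).
rewrite (Psi_vec_rec charK hPsi xp (hh _ _ (homogM _ _ _ _ ce yq)) (sa _)).
have := nr_bracket_1_clinear (D_homog_trunc n.+1 (Psi_vec_D hPsi xp))
  (op_trunc_clinear IH) sz h1 h2 yq => /= ->.
rewrite -(Psi_vec_rec charK hPsi xp (hh _ _ yq) (sa _)).
by rewrite -scalerAr !scalerA; congr (_ *: _); exact: mulrC.
Qed.

(** Arity 1 is a separate start, through the explicit [Psi_end_arity1]; this is where f itself must
    graded commute with c. *)
Lemma Psi_end_clinear p (f : A -> A) : is_Hom p f ->
  (forall x, f (c * x) = (-1) ^ (e * p) *: (c * f x)) ->
  gop_clinear c e p (fun=> Psi (of_end f)).
Proof.
move=> hf fc; have f1p := is_Hom_1 hf.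
have f1c := Psi_vec_clinear f1p.
apply: op_clinear_gop; elim/ltn_ind => -[|[|n]] IH d1 q d2 b1 b2 y // sz h1 h2 yq.
  case: b1 b2 sz h1 h2 => [|? ?] // [|? ?] // _ h1 h2.
  case: d1 d2 h1 h2 => [|? ?] [|? ?] [] // _ _ [] // _ _ /=.
  have cy : c * y \in homog (e + q) by rewrite homogM.
  rewrite (Psi_end_arity1 charK hPsi hf cy) (Psi_end_arity1 charK hPsi hf yq) fc.
  have /= -> := f1c [::] _ [::] [::] [::] _ (homogs_nil A) (homogs_nil A) yq.
  by rewrite big_nil addr0 mulrDr scalerDr.
have hh r z : z \in homog r -> homogs (d1 ++ r :: d2) (b1 ++ z :: b2).
  by move=> zr; apply: homogs_cat => //; apply/homogs_cons.
have sa z : size (b1 ++ z :: b2) = n.+2 by rewrite size_cat /= addnS.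
apply: (scalerI (natr_neq0 charK n)).
rewrite (Psi_end_rec charK hPsi hf (hh _ _ (homogM _ _ _ _ ce yq)) (sa _)).
have := nr_bracket_1_clinear (D_homog_trunc n.+2 (Psi_end_D hPsi hf))
  (op_trunc_clinear IH) sz h1 h2 yq => /= ->.
rewrite (f1c _ _ _ _ _ _ h1 h2 yq) -scalerBr -mulrBr.
rewrite -(Psi_end_rec charK hPsi hf (hh _ _ yq) (sa _)).
by rewrite -scalerAr !scalerA; congr (_ *: _); exact: mulrC.
Qed.

End Linearity.

Lemma biword0 (A : gradedAlgType K) (a y : A) : biword B 0 a y = y.
Proof.
have b0 : bernoulli K 0 = 1 by rewrite bernoulliE big_ord0 subr0 mulr1.
rewrite /biword big_ord1 !expr0 mul1r mulr1 /bernoulli2 big_ord1 addn0 b0.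
by rewrite expr0 bin0 fact0 !mulr1 divr1 scale1r.
Qed.

Lemma biword_r0 (A : gradedAlgType K) b n (a : A) : biword b n a 0 = 0.
Proof. by rewrite /biword big1 // => i _; rewrite mulr0 mul0r scaler0. Qed.

Lemma biwordZr (A : gradedAlgType K) b n (a y : A) (k : K) :
  biword b n a (k *: y) = k *: biword b n a y.
Proof.
rewrite scaler_sumr; apply: eq_bigr => i _.
by rewrite -scalerAr -scalerAl !scalerA; congr (_ *: _); exact: mulrC.
Qed.

(** The coefficient of degree r in e^(-x) e^x = 1. *)
Lemma sum_exp_inv r : \sum_(m < r.+1) (-1) ^+ m / m`!%:R / (r - m)`!%:R = (r == 0%N)%:R :> K.
Proof.
have := fps_expN charK (idfun : {rmorphism K -> K}) (- 1).
move/(congr1 (fun f : fps K => f r)); rewrite fpsM opprK => E.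
rewrite -[RHS]E; apply: eq_bigr => m _; rewrite /fps_exp /= expr1n mulr1.
by congr (_ * _); exact: mulrC.
Qed.

Lemma Psi_vec_in (A : gradedAlgType K) e (x : A) b :
  Psi (of_vec (adjoin_in e x)) (map (adjoin_in e) b) = adjoin_in e (Psi (of_vec x) b).
Proof. by rewrite (Psi_natural_vec hPsi x b (@adjoin_in_graded K A e)). Qed.

Lemma Psi_end_in (A : gradedAlgType K) e p (f : A -> A) b : is_Hom p f ->
  Psi (of_end (@adjoin_map K A e p f)) (map (adjoin_in e) b) =
  adjoin_in e (Psi (of_end f) b).
Proof.
move=> hf; have gr := @adjoin_in_graded K A e; have E (x : A) :
    @adjoin_map K A e p f (adjoin_in e x) = adjoin_in e (f x) by exact: adjoin_map_in.
by rewrite (Psi_natural_end hPsi b gr (is_End_Hom hf)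
  (is_End_Hom (is_Hom_adjoin_map e hf)) E).
Qed.

Lemma Psi_vec_nseq (A : gradedAlgType K) p (a x : A) n : a \in homog 0 -> x \in homog p ->
  Psi (of_vec x) (nseq n a) = n`!%:R *: biword B n a x.
Proof.
(* The algebra is generalized because the values at (a^m, a, ..., a) come from the formula in A +
   eps A, in arity k.+1 <= n. *)
elim/ltn_ind: n A a x => -[|n] IH A a x a0 xp.
  by rewrite (Psi0_vec hPsi) biword0 scale1r.
have hu := Psi_vec_D hPsi xp.
have xp' : adjoin_in 0 x \in homog p by rewrite adjoin_in_homog.
have cl := Psi_vec_clinear (adjoin_eps_homog A 0) (@adjoin_eps_comm K A 0) xp'.
have nz : n%:R - (-1) != 0 :> K by rewrite opprK natr1 natr_neq0.
apply: (scalerI nz).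
apply: (nseq_step (w := 0) (psi := fun k => biword B k a x) (mu := fun k w =>
  w * biword B1 k a x + biword B2 k a x * w) hu a0).
- rewrite opprK natr1 (Psi_vec_rec charK hPsi xp (homogs_nseq n.+1 a0)) ?size_nseq //.
  by rewrite scaler0 subr0.
- by move=> k kn; apply: IH.
- move=> k m kn; have am0 := homog_exp m a0.
  have am0' : a ^+ m \in homog (- 0) by rewrite oppr0.
  have := mark_of_nseq k (Psi_vec_D hPsi xp') cl (fun b => Psi_vec_in 0 x b) a0 am0'.
  have ay0 : ((a, a ^+ m) : adjoin A 0) \in homog 0.
    by rewrite adjoin_homog a0 /= subr0.
  rewrite (IH k.+1) // mul0r expr0z scale1r adjoin_scaleE biword_adjoin //; last first.
    by rewrite -exprS exprSr.
  rewrite biword_r0 addr0 /= => E; apply: (scalerI (natr_neq0 charK k)).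
  by rewrite scaler_nat E factrS scalerA.
- by rewrite mul1r mulr1 biword_rec scaleN1r.
- exact: biword_euler.
- apply/eqP; rewrite subr_eq0; apply/eqP; exact: biword_pde.
Qed.

(** The formula for Psi_f at (a, ..., a) divided by n!; l counts the arguments inside f. *)
Definition end_biword (A : gradedAlgType K) (f : A -> A) n (a : A) : A :=
  \sum_(l < n.+1) l`!%:R^-1 *: biword B (n - l) a (f (a ^+ l)).

(** The derivative of [end_biword f n.+1] at a in a direction w commuting with a: w comes from the
    left powers, from the right powers, or from inside f, where l / l! = 1 / (l-1)! shifts l by
    one. *)
Definition end_biword_mark (A : gradedAlgType K) (f : A -> A) (a : A) n (w : A) : A :=
  \sum_(l < n.+1) l`!%:R^-1 *:
    (w * biword B1 (n - l) a (f (a ^+ l)) + biword B2 (n - l) a (f (a ^+ l)) * w +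
     biword B (n - l) a (f (a ^+ l * w))).

Lemma end_biword_adjoin (A : gradedAlgType K) p (f : A -> A) n (a w : A) :
  is_Hom p f -> a \in homog 0 -> a * w = w * a ->
  (end_biword (@adjoin_map K A 0 p f) n.+1 (a, w)).2 = end_biword_mark f a n w.
Proof.
move=> hf a0 aw; pose y l := f (a ^+ l); pose y' l := f (a ^+ l.-1 * w *+ l).
have fE l : @adjoin_map K A 0 p f (((a, w) : adjoin A 0) ^+ l) = (y l, y' l).
  by rewrite adjoin0_exp // /adjoin_map /= mul0r expr0z scale1r.
rewrite /end_biword adjoin_sumE /= big_ord_recr /= subnn fE biword0.
have -> : y' n.+1 = biword B 0 a (y' n.+1) by rewrite biword0.
transitivity (\sum_(l < n.+1) l`!%:R^-1 *:
      (w * biword B1 (n - l) a (y l) + biword B2 (n - l) a (y l) * w) +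
    \sum_(l < n.+2) l`!%:R^-1 *: biword B (n.+1 - l) a (y' l)).
  rewrite [X in _ = _ + X]big_ord_recr /= subnn addrA; congr (_ + _).
  rewrite -big_split; apply: eq_bigr => l _ /=.
  have ln : (l <= n)%N by rewrite -ltnS.
  by rewrite fE subSn // biword_adjoin //= -scalerDr.
rewrite [X in _ + X]big_ord_recl /= {1}/y' mulr0n (is_Hom0 hf) biword_r0 scaler0 add0r.
rewrite -big_split; apply: eq_bigr => l _ /=; rewrite [RHS]scalerDr; congr (_ + _).
rewrite /bump /= add1n subSS /y' /= -scaler_nat (is_HomZ _ _ hf) biwordZr scalerA.
congr (_ *: _); rewrite factrS invfM mulrC mulrA divff ?mul1r //; exact: natr_neq0.
Qed.

Lemma end_biword_euler (A : gradedAlgType K) (f : A -> A) n (a : A) :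
  end_biword_mark f a n a = n.+1%:R *: end_biword f n.+1 a.
Proof.
pose X l := biword B (n.+1 - l) a (f (a ^+ l)).
transitivity (\sum_(l < n.+2) ((n.+1 - l)%N%:R *: (l`!%:R^-1 *: X l) +
    l%:R *: (l`!%:R^-1 *: X l))); last first.
  rewrite scaler_sumr; apply: eq_bigr => l _; rewrite -scalerDl -natrD subnK //.
  by rewrite -ltnS.
rewrite big_split /= [X in X + _]big_ord_recr /= subnn scale0r addr0.
rewrite [X in _ + X]big_ord_recl /= scale0r add0r -big_split; apply: eq_bigr => l _ /=.
have ln : (l <= n)%N by rewrite -ltnS.
rewrite (biword_euler charK) scalerDr /X subSn // /bump /= add1n subSS exprSr !scalerA.
congr (_ *: _ + _ *: _); first exact: mulrC.
by rewrite factrS invfM mulrA divff ?mul1r //; exact: natr_neq0.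
Qed.

(** For each fixed l the outer words cancel by [biword_pde]. With w inside f the powers merge into
    a^r, r = l + m, with the coefficient of degree r in e^(-x) e^x. Only r = 0 survives and produces
    f 1. *)
Lemma end_biword_pde (A : gradedAlgType K) (f : A -> A) n (a : A) :
  \sum_(m < n.+1) ((-1) ^+ m / m`!%:R) *: end_biword_mark f a (n - m) (a ^+ m) -
    \sum_(m < n.+1) exp_deriv a m (end_biword f (n - m) a) = biword B n a (f 1).
Proof.
pose y l := f (a ^+ l).
pose G m l : A := ((-1) ^+ m / m`!%:R / l`!%:R) *: (a ^+ m * biword B1 (n - m - l) a (y l) +
  biword B2 (n - m - l) a (y l) * a ^+ m).
pose H m l : A := ((-1) ^+ m / m`!%:R / l`!%:R) *: biword B (n - m - l) a (f (a ^+ l * a ^+ m)).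
have -> : \sum_(m < n.+1) ((-1) ^+ m / m`!%:R) *: end_biword_mark f a (n - m) (a ^+ m) =
    \sum_(m < n.+1) \sum_(l < (n - m).+1) G m l + \sum_(m < n.+1) \sum_(l < (n - m).+1) H m l.
  rewrite -big_split; apply: eq_bigr => m _; rewrite scaler_sumr -big_split.
  by apply: eq_bigr => l _ /=; rewrite scalerA -scalerDr.
have -> : \sum_(m < n.+1) exp_deriv a m (end_biword f (n - m) a) =
    \sum_(m < n.+1) \sum_(l < (n - m).+1)
      l`!%:R^-1 *: exp_deriv a m (biword B (n - m - l) a (y l)).
  by apply: eq_bigr => m _; rewrite exp_deriv_sum; apply: eq_bigr => l _; rewrite exp_derivZ.
rewrite !(sum_triangle_swap G) (sum_triangle_swap (fun m l =>
  l`!%:R^-1 *: exp_deriv a m (biword B (n - m - l) a (y l)))).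
have -> : \sum_(l < n.+1) \sum_(m < (n - l).+1) G m l =
    \sum_(l < n.+1) \sum_(m < (n - l).+1)
      l`!%:R^-1 *: exp_deriv a m (biword B (n - m - l) a (y l)).
  apply: eq_bigr => l _; rewrite -scaler_sumr.
  have := biword_pde charK a (n - l) (y l) => E.
  transitivity (l`!%:R^-1 *: \sum_(m < (n - l).+1) ((-1) ^+ m / m`!%:R) *:
     (a ^+ m * biword B1 (n - l - m) a (y l) + biword B2 (n - l - m) a (y l) * a ^+ m)).
    rewrite scaler_sumr; apply: eq_bigr => m _; rewrite /G scalerA [_^-1 * _]mulrC.
    by rewrite subnAC.
  by rewrite E; congr (_ *: _); apply: eq_bigr => m _; rewrite /exp_deriv subnAC.
rewrite addrAC subrr add0r (sum_triangle_diag H).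
transitivity (\sum_(r < n.+1) (r == 0%N :> nat)%:R *: biword B (n - r) a (f (a ^+ r))).
  apply: eq_bigr => r _; rewrite -sum_exp_inv scaler_suml; apply: eq_bigr => m _.
  have mr : (m <= r)%N by rewrite -ltnS.
  by rewrite /H -exprD subnK // -subnDA subnKC.
rewrite big_ord_recl subn0 scale1r big1 ?addr0 // => r _.
by rewrite scale0r.
Qed.

Lemma Psi_end_nseq (A : gradedAlgType K) p (f : A -> A) (a : A) n : is_Hom p f ->
  a \in homog 0 -> Psi (of_end f) (nseq n a) = n`!%:R *: end_biword f n a.
Proof.
elim/ltn_ind: n A f a => -[|[|n]] IH A f a hf a0.
- rewrite (Psi0_end hPsi); last exact: is_End_Hom hf.
  by rewrite /end_biword big_ord1 biword0 fact0 invr1 !scale1r.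
- have f1p := is_Hom_1 hf.
  rewrite /= (Psi_end_arity1 charK hPsi hf a0) (Psi_vec_nseq 1 a0 f1p).
  by rewrite /end_biword big_ord_recl big_ord1 /= biword0 invr1 !scale1r addrC.
have hu := Psi_end_D hPsi hf.
have f1p := is_Hom_1 hf.
have hf' := is_Hom_adjoin_map 0 hf.
have cl := Psi_end_clinear (adjoin_eps_homog A 0) (@adjoin_eps_comm K A 0) hf'
  (fun x => adjoin_map_eps x hf).
have nz : n.+1%:R - 0 != 0 :> K by rewrite subr0 natr_neq0.
apply: (scalerI nz).
apply: (nseq_step (w := biword B n.+2 a (f 1)) (psi := fun k => end_biword f k a)
  (mu := fun k w => end_biword_mark f a k w) hu a0).
- rewrite subr0 (Psi_end_rec charK hPsi hf (homogs_nseq n.+2 a0)) ?size_nseq //.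
  by rewrite (Psi_vec_nseq n.+2 a0 f1p).
- by move=> k kn; apply: IH.
- move=> k m kn; have am0 := homog_exp m a0.
  have am0' : a ^+ m \in homog (- 0) by rewrite oppr0.
  have := mark_of_nseq k (Psi_end_D hPsi hf') cl (fun b => Psi_end_in 0 b hf) a0 am0'.
  have ay0 : ((a, a ^+ m) : adjoin A 0) \in homog 0.
    by rewrite adjoin_homog a0 /= subr0.
  rewrite (IH k.+1) // mul0r expr0z scale1r adjoin_scaleE /= end_biword_adjoin //; last first.
    by rewrite -exprS exprSr.
  move=> E; apply: (scalerI (natr_neq0 charK k)).
  by rewrite scaler_nat E factrS scalerA.
(* At w = 1 the two outer derivatives add up to minus the term with w inside f: the formula vanishes
   at an argument 1, as [Psi_f] does. *)
- rewrite scale0r /end_biword_mark big1 // => l _.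
  by rewrite !mulr1 mul1r biword_rec addNr scaler0.
- exact: end_biword_euler.
- exact: end_biword_pde.
Qed.

End UniversalFormulas.

(** * Arbitrary arguments *)

Section Conclusion.
Variables (K : fieldType) (charK : [pchar K] =i pred0).
Variable (Psi : assignment K)
  (hPsi : koszul_brackets Psi).

Lemma gop_linear_sub (V : gradedLmodType K) (W W' : gop V) :
  gop_linear W -> gop_linear W' -> gop_linear (fun d a => W d a - W' d a).
Proof.
move=> l l' d1 q d2 b1 b2 k x y h1 h2 xq yq; rewrite l // l' //.
by rewrite scalerBr opprD addrACA.
Qed.

Lemma gop_symmetric_sub (V : gradedLmodType K) (W W' : gop V) :
  gop_symmetric W -> gop_symmetric W' -> gop_symmetric (fun d a => W d a - W' d a).
Proof.
move=> l l' d1 q r d2 b1 b2 x y h1 h2 xq yr.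
by rewrite (l _ _ _ _ _ _ _ _ h1 h2 xq yr) (l' _ _ _ _ _ _ _ _ h1 h2 xq yr) scalerBr.
Qed.

Lemma gop_clinear_sub (A : gradedAlgType K) (c : A) e p (W W' : gop A) :
  gop_clinear c e p W -> gop_clinear c e p W' ->
  gop_clinear c e p (fun d a => W d a - W' d a).
Proof.
move=> l l' d1 q d2 b1 b2 x h1 h2 xq.
by rewrite (l _ _ _ _ _ _ h1 h2 xq) (l' _ _ _ _ _ _ h1 h2 xq) -scalerBr -mulrBr.
Qed.

Section Words.
Variable A : gradedAlgType K.

Lemma gop_cat_nseq i n p (W1 W2 : gop A) (a : A) : (i <= n)%N ->
  gop_cat i p W1 W2 (nseq n 0) (nseq n a) =
  W1 (nseq i 0) (nseq i a) * W2 (nseq (n - i) 0) (nseq (n - i) a).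
Proof.
by move=> le_in; rewrite /gop_cat !take_nseq // !drop_nseq sum_nseq0 mulr0 expr0z scale1r.
Qed.

Lemma prod_nseq n (a : A) : \prod_(b <- nseq n a) b = a ^+ n.
Proof. by elim: n => [|n IH]; rewrite /= ?big_nil // big_cons IH exprS. Qed.

Lemma vec_word_nseq p (x a : A) n :
  vec_word p x (nseq n 0) (nseq n a) = biword (bernoulli2 K) n a x.
Proof.
rewrite /vec_word size_nseq /biword -(sum_antidiagonal (fun i j =>
  (bernoulli2 K i j / (i`!%:R * j`!%:R)) *: (a ^+ i * x * a ^+ j))).
apply: eq_bigr => i _; apply: eq_bigr => j /eqP ij.
have le_in : (i <= n)%N by rewrite -ltnS.
rewrite gop_cat_nseq // /gop_prod /gop_vec_prod !prod_nseq mulrA.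
by rewrite -[X in _ ^+ (X - i)%N]ij addKn.
Qed.

Lemma end_word_nseq p (f : A -> A) (a : A) n :
  end_word p f (nseq n 0) (nseq n a) = end_biword f n a.
Proof.
pose F i j k : A := (bernoulli2 K i j / (i`!%:R * j`!%:R * k`!%:R)) *:
  (a ^+ i * f (a ^+ k) * a ^+ j).
transitivity (\sum_(i < n.+1) \sum_(j < n.+1) \sum_(k < n.+1 | (i + j + k == n)%N) F i j k).
  rewrite /end_word size_nseq; apply: eq_bigr => i _; apply: eq_bigr => j _.
  apply: eq_bigr => k /eqP ijk; have le_in : (i <= n)%N by lia.
  have le_k : (k <= n - i)%N by lia.
  rewrite !gop_cat_nseq // /gop_prod /gop_end_prod !prod_nseq mul1r mulrA /F.
  by have -> : (n - i - k)%N = j by lia.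
transitivity (\sum_(k < n.+1) \sum_(i < (n - k).+1) F i (n - k - i)%N k); last first.
  apply: eq_bigr => k _; rewrite scaler_sumr; apply: eq_bigr => i _.
  by rewrite scalerA /F; congr (_ *: _); rewrite !invfM; ring.
rewrite (sum_triangle_swap (fun k i => F i (n - k - i)%N k)).
apply: eq_bigr => i _.
transitivity (\sum_(j < n.+1) \sum_(k < n.+1 | (i + k + j == n)%N) F i j k).
  by apply: eq_bigr => j _; apply: eq_bigl => k; rewrite addnAC.
rewrite (exchange_big_dep predT) //=.
have i_n := ltn_ord i; have h : ((n - i).+1 <= n.+1)%N by lia.
rewrite (big_ord_widen n.+1 (fun k => F i (n - k - i)%N k) h) [RHS]big_mkcond.
apply: eq_bigr => k _ /=; case: ifP => ki.
  have jn : (n - k - i < n.+1)%N by lia.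
  rewrite (big_pred1 (Ordinal jn)) // => j; rewrite /= -val_eqE /=.
  by have := ltn_ord j; lia.
by rewrite big1 // => j; have := ltn_ord j; lia.
Qed.

End Words.

(** Polarization of the difference of both sides. The class of operators consists of these
    differences for all homogeneous z of degree p in all algebras; it is stable under A -> A + eps
    A, which sends z to its image. *)
Lemma Psi_vec_word (A : gradedAlgType K) p (x : A) d a : x \in homog p -> homogs d a ->
  Psi (of_vec x) a = gop_symm (vec_word p x) d a.
Proof.
move=> xp h; apply/eqP; rewrite -subr_eq0; apply/eqP.
pose W (B : gradedAlgType K) (z : B) : gop B :=
  fun d b => Psi (of_vec z) b - gop_symm (vec_word p z) d b.
apply: (@gop_polarize K (fun B V => exists2 z : B, z \in homog p & V = W B z) p
  charK _ _ _ A (W A x) d a _ h); last by exists x.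
- move=> B _ [z zp ->]; have [l s] := D_homog_gop (Psi_vec_D hPsi zp); split.
    by apply: gop_linear_sub l _; exact/gop_symm_linear/vec_word_linear.
  by apply: gop_symmetric_sub s _; exact: gop_symm_symmetric.
- move=> B _ e [z zp ->]; exists (W (adjoin B e) (adjoin_in e z)).
  have zp' : adjoin_in e z \in homog p by rewrite adjoin_in_homog.
  have comm := @adjoin_eps_comm K B e; split; first by exists (adjoin_in e z).
    apply: gop_clinear_sub (Psi_vec_clinear charK hPsi (adjoin_eps_homog B e) comm zp') _.
    exact: gop_symm_clinear (vec_word_clinear comm zp').
  move=> d' b _; rewrite /W (Psi_vec_in hPsi).
  by rewrite (gop_symm_in (fun d b => vec_word_in e p z d b)) -raddfB.
move=> B _ z n [y yp ->] z0; rewrite /W (Psi_vec_nseq charK hPsi n z0 yp).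
by rewrite gop_symm_nseq vec_word_nseq subrr.
Qed.

(** As for vectors, with the class indexed by endomorphisms; [adjoin_map] extends each of them so
    that it graded commutes with eps. *)
Lemma Psi_end_word (A : gradedAlgType K) p (f : A -> A) d a : is_Hom p f -> homogs d a ->
  Psi (of_end f) a = gop_symm (end_word p f) d a.
Proof.
move=> hf h; apply/eqP; rewrite -subr_eq0; apply/eqP.
pose W (B : gradedAlgType K) (g : B -> B) : gop B :=
  fun d b => Psi (of_end g) b - gop_symm (end_word p g) d b.
apply: (@gop_polarize K (fun B V => exists2 g : B -> B, is_Hom p g & V = W B g) p
  charK _ _ _ A (W A f) d a _ h); last by exists f.
- move=> B _ [g hg ->]; have [l s] := D_homog_gop (Psi_end_D hPsi hg); split.
    by apply: gop_linear_sub l _; exact/gop_symm_linear/end_word_linear.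
  by apply: gop_symmetric_sub s _; exact: gop_symm_symmetric.
- move=> B _ e [g hg ->]; exists (W (adjoin B e) (@adjoin_map K B e p g)).
  have hg' := is_Hom_adjoin_map e hg; have comm := @adjoin_eps_comm K B e.
  have geps x := @adjoin_map_eps K B e p g x hg.
  split; first by exists (@adjoin_map K B e p g).
    apply: gop_clinear_sub (Psi_end_clinear charK hPsi (adjoin_eps_homog B e) comm hg' geps) _.
    exact: gop_symm_clinear (end_word_clinear comm hg' geps).
  move=> d' b _; rewrite /W (Psi_end_in hPsi e b hg).
  by rewrite (gop_symm_in (fun d b => end_word_in e d b hg)) -raddfB.
move=> B _ z n [g hg ->] z0; rewrite /W (Psi_end_nseq charK hPsi n hg z0).
by rewrite gop_symm_nseq end_word_nseq subrr.
Qed.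

End Conclusion.

Theorem theorem4p2 (K : fieldType) (charK : [pchar K] =i pred0)
    (Psi : assignment K) (hPsi : koszul_brackets Psi)
    (A : gradedAlgType K) (n : nat) (a : n.-tuple A) (d : n.-tuple int)
    (ha : homogs d a) :
  (forall (p : int) (x : A), x \in homog p ->
    Psi A (of_vec x) a =
      \sum_(i < n.+1) \sum_(j < n.+1 | (i + j == n)%N)
        (bernoulli2 K i j / (i`!%:R * j`!%:R)) *:
        \sum_(s : 'S_n)
          (koszul s d * (-1) ^ (p * \sum_(e <- take i (permseq s d)) e)) *:
          (\prod_(b <- take i (permseq s a)) b * x *
           \prod_(b <- drop i (permseq s a)) b)) /\
  (forall (p : int) (f : A -> A), is_Hom p f ->
    Psi A (of_end f) a =
      \sum_(i < n.+1) \sum_(j < n.+1) \sum_(k < n.+1 | (i + j + k == n)%N)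
        (bernoulli2 K i j / (i`!%:R * j`!%:R * k`!%:R)) *:
        \sum_(s : 'S_n)
          (koszul s d * (-1) ^ (p * \sum_(e <- take i (permseq s d)) e)) *:
          (\prod_(b <- take i (permseq s a)) b *
           f (1 * \prod_(b <- take k (drop i (permseq s a))) b) *
           \prod_(b <- drop (i + k) (permseq s a)) b)).
Proof.
(* Symmetrized words have the sum over permutations outermost; it only remains to move it inside. *)
split=> [p x xp|p f hf].
  rewrite (Psi_vec_word charK hPsi xp ha) (gop_symmE _ _ (size_tuple a)) /gop_sum.
  under eq_bigr => s _.
    rewrite /vec_word size_permseq scaler_sumr.
    under eq_bigr => i _ do rewrite scaler_sumr.
    over.
  rewrite exchange_big; apply: eq_bigr => i _; rewrite exchange_big; apply: eq_bigr => j _.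
  rewrite scaler_sumr; apply: eq_bigr => s _; rewrite /gop_cat /gop_prod /gop_vec_prod.
  by rewrite !scalerA; congr (_ *: _); [rewrite [RHS]mulrA; congr (_ * _); exact: mulrC|rewrite mulrA].
rewrite (Psi_end_word charK hPsi hf ha) (gop_symmE _ _ (size_tuple a)) /gop_sum.
under eq_bigr => s _.
  rewrite /end_word size_permseq scaler_sumr.
  under eq_bigr => i _.
    rewrite scaler_sumr.
    under eq_bigr => j _ do rewrite scaler_sumr.
    over.
  over.
rewrite exchange_big; apply: eq_bigr => i _; rewrite exchange_big; apply: eq_bigr => j _.
rewrite exchange_big; apply: eq_bigr => k _.
rewrite scaler_sumr; apply: eq_bigr => s _; rewrite /gop_cat /gop_prod /gop_end_prod.
rewrite mul0r expr0z scale1r drop_drop [(k + i)%N]addnC.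
by rewrite !scalerA; congr (_ *: _); [rewrite [RHS]mulrA; congr (_ * _); exact: mulrC|rewrite mulrA].
Qed.
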